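(* Let $J=\{1,\ldots,n-1\}$, $\psi_0,\psi_n\in\mathbb{C}^*$ and $\zeta=(\psi_0\psi_n\kappa^{n-1},\psi_0\psi_n\kappa^{n-3},\ldots,\psi_0\psi_n\kappa^{1-n})$. For generic parameters, $\mathrm{Sol}_{KZ}(M_J^{\underline\kappa}(\zeta);\underline\kappa;\upsilon_0,\upsilon_n)^{W_0}\cap(\mathbb{C}[T]\otimes M_J^{\underline\kappa}(\zeta))\ne\{0\}$ if and only if $$\psi_0\psi_nq^m=(\kappa_0\kappa_n\kappa^{n-1})^{\eta(m)}$$ for some $m\in\mathbb{Z}$, where $\eta(m)=1$ if $m>0$ and $\eta(m)=-1$ if $m\le0$. In that case the nonzero elements of this intersection are the nonzero multiples of $$\sum_{w\in W_0^J}\varpi(T_{w(w_0^J)^{-1}})P_{\mathbf m}\otimes v_w^J(\zeta;\underline\kappa),\qquad \mathbf m=(m,\ldots,m).$$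
   Context: Fix $n\ge2$, $\underline\kappa=(\kappa_0,\kappa,\ldots,\kappa,\kappa_n)$, $\upsilon_0,\upsilon_n\in\mathbb{C}^*$, $q\in\mathbb{C}^*$ with square root $q^{1/2}$; ''generic'' includes that $\gamma_\lambda\neq\gamma_\mu$ for $\lambda\ne\mu$. $H(\underline\kappa)$: unital algebra with generators $T_0,\ldots,T_n$, type $\widetilde C_n$ braid relations ($T_0T_1T_0T_1=T_1T_0T_1T_0$, $T_{n-1}T_nT_{n-1}T_n=T_nT_{n-1}T_nT_{n-1}$, $T_iT_{i+1}T_i=T_{i+1}T_iT_{i+1}$, $T_iT_j=T_jT_i$ for $|i-j|>1$), and $(T_j-\kappa_j)(T_j+\kappa_j^{-1})=0$. $Y_i=T_{i-1}^{-1}\cdots T_1^{-1}T_0T_1\cdots T_{n-1}T_nT_{n-1}\cdots T_i$. $W_0=\langle s_1,\ldots,s_n\rangle$ (hyperoctahedral group) acting on $T=(\mathbb{C}^* )^n$ ($s_i$ swaps $t_i,t_{i+1}$, $s_n$ inverts $t_n$); $s_0\mathbf t=(qt_1^{-1},t_2,\ldots,t_n)$. $T_w=T_{i_1}\cdots T_{i_r}$ for a reduced expression $w=s_{i_1}\cdots s_{i_r}$. $W_{0,J}=\langle s_1,\ldots,s_{n-1}\rangle$, $W_0^J$ = minimal-length representatives of $W_0/W_{0,J}$, $w_0^J=w_0w_{0,J}^{-1}$ ($w_0,w_{0,J}$ longest elements). $M_J^{\underline\kappa}(\zeta)=H(\underline\kappa)\otimes_{H_J(\underline\kappa)}\mathbb{C}_{J,\zeta}$,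 where $H_J(\underline\kappa)$ is generated by $T_1,\ldots,T_{n-1}$ and all $Y^\lambda$, acting on $\mathbb{C}_{J,\zeta}$ by $T_i\mapsto\kappa$, $Y^\lambda\mapsto\zeta^\lambda$; basis $v_w^J(\zeta;\underline\kappa)=T_w\otimes1$ ($w\in W_0^J$). (This module is isomorphic to the spin representation of $H(\underline\kappa)$ on $(\mathbb{C}^2)^{\otimes n}$.) $\varpi$: representation of $H(\underline\kappa^{-1})$ on meromorphic functions on $T$ by $(\varpi(T_j)f)(\mathbf t)=\kappa_j^{-1}f(\mathbf t)+\tilde c_j(\mathbf t)(f(s_j\mathbf t)-f(\mathbf t))$, $\tilde c_j$ obtained from $c_0(\mathbf t)=\kappa_0^{-1}\frac{(1-q^{1/2}\kappa_0\upsilon_0t_1^{-1})(1+q^{1/2}\kappa_0\upsilon_0^{-1}t_1^{-1})}{1-qt_1^{-2}}$, $c_i(\mathbf t)=\kappa^{-1}\frac{1-\kappa^2t_i/t_{i+1}}{1-t_i/t_{i+1}}$, $c_n(\mathbf t)=\kappa_n^{-1}\frac{(1-\kappa_n\upsilon_nt_n)(1+\kappa_n\upsilon_n^{-1}t_n)}{1-t_n^2}$ by inverting $\kappa_0,\kappa,\kappa_n,\upsilon_0,\upsilon_n$. $\gamma_\lambda$: $\gamma_{\lambda,i}=q^{\lambda_i}(\kappa_0\kappa_n)^{-\eta(\lambda_i)}\prod_{j<i}\kappa^{\eta(\lambda_j-\lambda_i)}\prod_{j>i}\kappa^{-\eta(\lambda_i-\lambda_j)}\prod_{j\ne i}\kappa^{-\eta(\lambda_i+\lambda_j)}$.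 $P_\lambda$ is the unique Laurent polynomial with $\varpi(Y_i)P_\lambda=\gamma_{\lambda,i}^{-1}P_\lambda$ for all $i$ and coefficient of $t^\lambda$ equal to 1 (monic nonsymmetric Koornwinder polynomial). For an $H(\underline\kappa)$-module $(\pi,V)$: $K_0^V(x)=\frac{\pi(T_0^{-1})+(\upsilon_0^{-1}-\upsilon_0)x-x^2\pi(T_0)}{\kappa_0^{-1}(1-\kappa_0\upsilon_0x)(1+\kappa_0\upsilon_0^{-1}x)}$, $R_i^V(x)=\frac{\pi(T_i^{-1})-x\pi(T_i)}{\kappa^{-1}(1-\kappa^2x)}$, $K_n^V(x)=\frac{\pi(T_n^{-1})+(\upsilon_n^{-1}-\upsilon_n)x-x^2\pi(T_n)}{\kappa_n^{-1}(1-\kappa_n\upsilon_nx)(1+\kappa_n\upsilon_n^{-1}x)}$; $\mathrm{Sol}_{KZ}(V;\underline\kappa;\upsilon_0,\upsilon_n)^{W_0}=\{f\in\mathcal M(T)\otimes V:K_0^V(q^{1/2}/t_1)f(s_0\mathbf t)=f(\mathbf t),\ R_i^V(t_i/t_{i+1})f(s_i\mathbf t)=f(\mathbf t)\ (1\le i<n),\ K_n^V(t_n)f(s_n\mathbf t)=f(\mathbf t)\}$ with $\mathcal M(T)$ the meromorphic functions on $T$. *)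

(* Defs.v *)
From HB Require Import structures.
From mathcomp Require Import all_boot all_order all_algebra.
Set Implicit Arguments. Unset Strict Implicit. Unset Printing Implicit Defensive.
Import Order.TTheory GRing.Theory Num.Theory.
Local Open Scope ring_scope.

Fixpoint mpoly (R : nzRingType) (k : nat) : nzRingType :=
  if k is k'.+1 then {poly mpoly R k'} else R.

Fixpoint meval (R : nzRingType) (k : nat) : mpoly R k -> (nat -> R) -> R :=
  match k return mpoly R k -> (nat -> R) -> R with
  | 0 => fun p _ => p
  | k'.+1 => fun p x => (map_poly (fun c => meval c x) p).[x k']
  end.

Definition eta_sgn (m : int) : int := if 0 < m then 1 else -1.

Definition apply_word (X : Type) (op : nat * bool -> X -> X)
  (w : seq (nat * bool)) (x : X) : X := foldr op x w.

(* letters of a plain word (no inverses) *)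
Definition plain (s : seq nat) : seq (nat * bool) := [seq (j, false) | j <- s].

Section Defs.
Variable F : fieldType.
Variable n : nat.

Definition at_nat (lam : {ffun 'I_n -> int}) (k : nat) : int :=
  \sum_(i < n | (i : nat) == k) lam i.

(* action of s_j (1 <= j <= n) on Z^n : s_j swaps j, j+1 (1-indexed), s_n negates n *)
Definition sact (j : nat) (lam : {ffun 'I_n -> int}) : {ffun 'I_n -> int} :=
  [ffun i : 'I_n =>
     if j == n then (if (i : nat) == n.-1 then - lam i else lam i)
     else if (i : nat) == j.-1 then at_nat lam j
     else if (i : nat) == j then at_nat lam j.-1
     else lam i].

(* faithful encoding of w in W_0 : image of rho = (1,2,...,n) *)
Definition rho : {ffun 'I_n -> int} := [ffun i : 'I_n => (i.+1)%:Z].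
Definition elt (s : seq nat) : {ffun 'I_n -> int} := foldr sact rho s.

Definition legal (s : seq nat) : bool := all (fun j => (0 < j <= n)%N) s.
Definition Jletter (j : nat) : bool := (0 < j < n)%N.

Definition reduced (s : seq nat) : Prop :=
  legal s /\ forall s', legal s' -> elt s' = elt s -> (size s <= size s')%N.

Definition longest_in (L : pred nat) (s : seq nat) : Prop :=
  all L s /\ reduced s /\
  forall s', all L s' -> reduced s' -> (size s' <= size s)%N.

Definition minrep (s : seq nat) : Prop :=
  reduced s /\ forall u s', all Jletter u -> legal s' ->
     elt s' = elt (s ++ u) -> (size s <= size s')%N.

(* red : choice of reduced expressions; ws : reduced words enumerating W_0^J
   (each element once); w0, w0J : reduced words of w_0 and w_{0,J}. *)
Definition W0data (red : seq nat -> seq nat) (ws : seq (seq nat))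
  (w0 w0J : seq nat) : Prop :=
  (forall s, legal s -> reduced (red s) /\ elt (red s) = elt s) /\
  longest_in (fun j => (0 < j <= n)%N) w0 /\
  longest_in Jletter w0J /\
  (forall s, s \in ws -> minrep s) /\
  uniq (map elt ws) /\
  (forall s, minrep s -> elt s \in map elt ws).

(* word for Y_i (1 <= i <= n):
   T_{i-1}^{-1}...T_1^{-1} T_0 T_1...T_{n-1} T_n T_{n-1} ... T_i *)
Definition Yword (i : nat) : seq (nat * bool) :=
  [seq (j, true) | j <- rev (iota 1 i.-1)] ++ [:: (0%N, false)] ++
  [seq (j, false) | j <- iota 1 n] ++ [seq (j, false) | j <- rev (iota i (n - i))].

Variables (q12 k0 k kn u0 un : F).
Definition q : F := q12 ^+ 2.
Definition kap (j : nat) : F := if j == 0%N then k0 else if j == n then kn else k.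

(* points are t : nat -> F, coordinates t_1,...,t_n being t 0, ..., t (n-1) *)
Definition torus (t : nat -> F) : Prop := forall i, (i < n)%N -> t i != 0.

Definition mono (lam : {ffun 'I_n -> int}) (t : nat -> F) : F :=
  \prod_(i < n) t i ^ lam i.

Definition sj (j : nat) (t : nat -> F) : nat -> F := fun i =>
  if j == 0%N then (if i == 0%N then q / t 0%N else t i)
  else if j == n then (if i == n.-1 then (t i)^-1 else t i)
  else if i == j.-1 then t j
  else if i == j then t j.-1
  else t i.

Definition laurent (f : (nat -> F) -> F) : Prop :=
  exists s : seq ({ffun 'I_n -> int} * F),
    forall t, torus t -> f t = \sum_(p <- s) p.2 * mono p.1 t.

Definition laurentV (V : lmodType F) (f : (nat -> F) -> V) : Prop :=
  exists s : seq ({ffun 'I_n -> int} * V),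
    forall t, torus t -> f t = \sum_(p <- s) mono p.1 t *: p.2.

Definition coef_is (f : (nat -> F) -> F) (lam : {ffun 'I_n -> int}) (c : F) : Prop :=
  exists s : seq ({ffun 'I_n -> int} * F),
    uniq (map fst s) /\
    (forall t, torus t -> f t = \sum_(p <- s) p.2 * mono p.1 t) /\
    c = \sum_(p <- s | p.1 == lam) p.2.

(* equality as meromorphic functions: equality off the zero set of a
   nonzero Laurent polynomial *)
Definition aeq (X : Type) (f g : (nat -> F) -> X) : Prop :=
  exists h, laurent h /\ (exists t, torus t /\ h t != 0) /\
    forall t, torus t -> h t != 0 -> f t = g t.

Definition ctilde (j : nat) (t : nat -> F) : F :=
  if j == 0%N then
    k0 * (1 - q12 * k0^-1 * u0^-1 * (t 0%N)^-1) * (1 + q12 * k0^-1 * u0 * (t 0%N)^-1)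
      / (1 - q * (t 0%N)^-2)
  else if j == n then
    kn * (1 - kn^-1 * un^-1 * t n.-1) * (1 + kn^-1 * un * t n.-1) / (1 - t n.-1 ^+ 2)
  else
    k * (1 - k^-2 * (t j.-1 / t j)) / (1 - t j.-1 / t j).

Definition varpiT (j : nat) (f : (nat -> F) -> F) : (nat -> F) -> F :=
  fun t => (kap j)^-1 * f t + ctilde j t * (f (sj j t) - f t).

(* T_j or T_j^{-1} = T_j - (kap_j^{-1} - kap_j) in H(kappa^{-1}) *)
Definition varpiop (p : nat * bool) (f : (nat -> F) -> F) : (nat -> F) -> F :=
  if p.2 then fun t => varpiT p.1 f t - ((kap p.1)^-1 - kap p.1) * f t
  else varpiT p.1 f.

Definition gamma (lam : {ffun 'I_n -> int}) (i : 'I_n) : F :=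
  q ^ lam i * (k0 * kn) ^ (- eta_sgn (lam i)) *
  (\prod_(j < n | (j < i)%N) k ^ eta_sgn (lam j - lam i)) *
  (\prod_(j < n | (i < j)%N) k ^ (- eta_sgn (lam i - lam j))) *
  (\prod_(j < n | j != i) k ^ (- eta_sgn (lam i + lam j))).

Definition isKoornwinder (lam : {ffun 'I_n -> int}) (P : (nat -> F) -> F) : Prop :=
  laurent P /\ coef_is P lam 1 /\
  forall i : 'I_n,
    aeq (apply_word varpiop (Yword i.+1) P) (fun t => (gamma lam i)^-1 * P t).

Definition constvec (m : int) : {ffun 'I_n -> int} := [ffun => m].

Variable V : lmodType F.
Variable pi : 'I_n.+1 -> {linear V -> V}.

Definition piT (j : nat) (v : V) : V := pi (inord j) v.
(* T_j or T_j^{-1} = T_j - (kap_j - kap_j^{-1}) in H(kappa) *)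
Definition piop (p : nat * bool) (v : V) : V :=
  if p.2 then piT p.1 v - (kap p.1 - (kap p.1)^-1) *: v else piT p.1 v.

Definition hecke_rep : Prop :=
  (forall j v, (j <= n)%N -> piT j (piT j v) = (kap j - (kap j)^-1) *: piT j v + v) /\
  (forall v, piT 0 (piT 1 (piT 0 (piT 1 v))) = piT 1 (piT 0 (piT 1 (piT 0 v)))) /\
  (forall v, piT n.-1 (piT n (piT n.-1 (piT n v))) = piT n (piT n.-1 (piT n (piT n.-1 v)))) /\
  (forall i v, (1 <= i)%N -> (i.+1 < n)%N ->
     piT i (piT i.+1 (piT i v)) = piT i.+1 (piT i (piT i.+1 v))) /\
  (forall i j v, (j <= n)%N -> (i.+1 < j)%N -> piT i (piT j v) = piT j (piT i v)).

Definition Tw (s : seq nat) (v : V) : V := apply_word piop (plain s) v.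

Variables (psi0 psin : F).
Definition zeta (i : 'I_n) : F := psi0 * psin * k ^ (n%:Z - 1 - 2 * (i : nat)%:Z).

(* (V, pi, v0) is (isomorphic to) M_J(zeta) with v0 = 1 (x) 1 and
   v_w^J = T_w v0 for w in W_0^J (enumerated by ws):
   universal property (T_i v0 = kappa v0 for i in J, Y_i v0 = zeta_i v0)
   and the T_w v0, w in W_0^J, form a basis. *)
Definition is_MJ (ws : seq (seq nat)) (v0 : V) : Prop :=
  hecke_rep /\
  (forall i, Jletter i -> piT i v0 = k *: v0) /\
  (forall i : 'I_n, apply_word piop (Yword i.+1) v0 = zeta i *: v0) /\
  (forall x : V, exists c : seq F, size c = size ws /\
       x = \sum_(i < size ws) c`_i *: Tw (nth [::] ws i) v0) /\
  (forall c : seq F, size c = size ws ->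
       \sum_(i < size ws) c`_i *: Tw (nth [::] ws i) v0 = 0 ->
       forall i, (i < size ws)%N -> c`_i = 0).

Definition K0 (x : F) (v : V) : V :=
  (k0^-1 * (1 - k0 * u0 * x) * (1 + k0 * u0^-1 * x))^-1 *:
    (piop (0%N, true) v + ((u0^-1 - u0) * x) *: v - (x ^+ 2) *: piT 0 v).
Definition Ri (i : nat) (x : F) (v : V) : V :=
  (k^-1 * (1 - k ^+ 2 * x))^-1 *: (piop (i, true) v - x *: piT i v).
Definition Kn (x : F) (v : V) : V :=
  (kn^-1 * (1 - kn * un * x) * (1 + kn * un^-1 * x))^-1 *:
    (piop (n, true) v + ((un^-1 - un) * x) *: v - (x ^+ 2) *: piT n v).

Definition KZsol (f : (nat -> F) -> V) : Prop :=
  aeq (fun t => K0 (q12 / t 0%N) (f (sj 0 t))) f /\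
  (forall i, Jletter i -> aeq (fun t => Ri i (t i.-1 / t i) (f (sj i t))) f) /\
  aeq (fun t => Kn (t n.-1) (f (sj n t))) f.

(* the candidate solution sum_{w in W_0^J} varpi(T_{w (w_0^J)^{-1}}) P (x) v_w^J,
   with (w_0^J)^{-1} = w_{0,J} w_0^{-1} *)
Definition KZcand (red : seq nat -> seq nat) (ws : seq (seq nat)) (w0 w0J : seq nat)
  (v0 : V) (P : (nat -> F) -> F) : (nat -> F) -> V := fun t =>
  \sum_(s <- ws)
     apply_word varpiop (plain (red (s ++ w0J ++ rev w0))) P t *: Tw s v0.

End Defs.

Definition params6 (F : fieldType) (a b c d e f : F) : nat -> F :=
  nth 0 [:: a; b; c; d; e; f].

(* Main.v *)
Require Import Defs.
From HB Require Import structures.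
From mathcomp Require Import all_boot all_order all_algebra.
From mathcomp Require Import boolp functions.
From mathcomp Require Import zify ring.
Set Implicit Arguments. Unset Strict Implicit. Unset Printing Implicit Defensive.
Import Order.TTheory GRing.Theory Num.Theory.
Local Open Scope ring_scope.

(* Expand a solution f of the KZ equations in the basis v_w^J, which is indexed by the sign
   patterns d in {+,-}^n (w^J being determined by the coordinates that w makes negative).
   Componentwise the KZ equations say varpi(T_j) f = pi(T_j) f - (kappa_j - kappa_j^-1) f.
   Since pi(T_j) permutes the v_d up to the quadratic relation, this means that all the f_d
   are obtained from the single function P = f_(-...-) by raising words in the varpi(T_j), and
   the remaining equations are equivalent to: varpi(T_j) P = kappa^-1 P for 0 < j < n, and
   varpi(T_0 T_1 ... T_n) P = psi_0 psi_n P. For Laurent polynomials these conditions force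
   P to be a joint eigenvector of the Y_i with eigenvalues psi_0 psi_n kappa^(2i - n - 1). The Y_i are
   triangular with respect to the order [level] with diagonal entries gamma_lambda^-1, which
   separate the lambda for generic parameters; so P is a multiple of some P_lambda, and
   comparing eigenvalues (powers of q first) gives lambda = (m, ..., m) and the condition on
   psi_0 psi_n. Conversely the eigenvalues of P_(m, ..., m) make it symmetric, because
   (T_j - kappa^-1) P_(m, ..., m) would have a joint eigenvalue outside the spectrum.

   Rational functions are handled by their values on the good points of the torus, where all
   operators are defined and which are dense because F is uncountable. *)

(** * Vectors indexed by sign patterns *)

(** The lemmas on [spinvec] rest on the braid relations and the action on one vector, and they are
    applied twice: to pi(T_j) on the module, where the middle letters act by kappa, and to
    varpi(T_j) on functions, where they act by kappa^-1. Solutions and basis vectors are therefore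
    both given by raising words, with complementary sign patterns. A letter T_j moves the leading
    exponent, so the order used for triangularity has to move too: [level] depends on a direction
    that each letter reflects together with the exponent. The linear part of Y_i being trivial, the
    direction returns to its start at the end of the word. Genericity means that q^a k0^b kn^c k^d =
    1 forces a = d = 0. The exponent a recovers lambda_i from the eigenvalue of Y_i; d = 0 excludes
    k^2 = 1 in the symmetry argument. These are countably many polynomial conditions. Uncountability
    also gives the existence of P: a suitable combination of the operators x^i Y_(i+1) separates an
    exponent from all the others, so that P is found as an eigenvector of a single operator. *)

Definition affine_braid (n : nat) (X : Type) (T : nat -> X -> X) : Prop :=
  [/\ forall v, T 0 (T 1 (T 0 (T 1 v))) = T 1 (T 0 (T 1 (T 0 v))),
      forall v, T n.-1 (T n (T n.-1 (T n v))) = T n (T n.-1 (T n (T n.-1 v))),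
      forall i v, (1 <= i)%N -> (i.+1 < n)%N ->
        T i (T i.+1 (T i v)) = T i.+1 (T i (T i.+1 v)) &
      forall i j v, (j <= n)%N -> (i.+1 < j)%N -> T i (T j v) = T j (T i v)].

Section SpinVectors.
Variables (F : fieldType) (n : nat) (X : lmodType F) (T : nat -> X -> X).
Hypothesis n_ge2 : (2 <= n)%N.
Hypothesis T_braid : affine_braid n T.
Hypothesis T_scale : forall j a v, T j (a *: v) = a *: T j v.

Lemma comm_word_gt j w y : all (fun k => (j.+1 < k <= n)%N) w ->
  T j (foldr T y w) = foldr T (T j y) w.
Proof.
case: T_braid => _ _ _ com.
by elim: w => //= k w IH /andP[/andP[jk kn] /IH <-]; rewrite com.
Qed.

(* T_i T_(i+1) ... T_n *)
Definition tailop (i : nat) (y : X) : X := foldr T y (iota i (n.+1 - i)).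

Lemma tailopS i y : (i <= n)%N -> tailop i y = T i (tailop i.+1 y).
Proof. by move=> le; rewrite /tailop subSS subSn. Qed.

Lemma tailop_n y : tailop n y = T n y.
Proof. by rewrite /tailop subSnn. Qed.

Lemma tailop_comm j i y : (j.+1 < i)%N -> T j (tailop i y) = tailop i (T j y).
Proof.
move=> ji; apply: comm_word_gt; apply/allP => k; rewrite mem_iota => /andP[a b]; lia.
Qed.

(** [T_j] commutes with the first letters of $T_i\cdots T_n$ until it meets $T_{j-1}T_j$; there the
    braid relation turns it into $T_{j-1}$, which passes the remaining letters. *)
Lemma tailop_shift i j y : (0 < i < j)%N -> (j < n)%N ->
  T j (tailop i y) = tailop i (T j.-1 y).
Proof.
case: T_braid => _ _ br com.
move E : (j - i)%N => k; elim: k i E => [|k IH] i E ij jn; first lia.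
case: (eqVneq j i.+1) => [ji|nj].
  subst j; rewrite !(@tailopS i) ?(@tailopS i.+1); try lia.
  by rewrite -br -?tailop_comm //; lia.
rewrite !(@tailopS i); [|lia|lia].
rewrite -(com i j); [|lia|lia].
congr (T i _); apply: IH; lia.
Qed.

(** Descending induction on j from the length four relation of $T_{n-1}$ and $T_n$. It brings out a
    letter $T_{n-1}$ on the right, as required for two equal minus signs in [spinvec_fix]. *)
Lemma tailop_sq j y : (0 < j < n)%N ->
  tailop j (tailop j y) = tailop j.+1 (tailop j (T n.-1 y)).
Proof.
case: T_braid => _ br4 br com.
move E : (n - j)%N => k; elim: k j E => [|k IH] j E jn; first lia.
case: (eqVneq j.+1 n) => [ji|nj].
  have -> : j = n.-1 by lia.
  have np : n.-1.+1 = n by lia.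
  rewrite !(@tailopS n.-1) ?np ?tailop_n; try lia.
  by rewrite br4.
have jn' : (j <= n)%N by lia.
have jn1 : (j.+1 <= n)%N by lia.
have c1 z : T j (tailop j.+2 z) = tailop j.+2 (T j z) by apply: tailop_comm; lia.
rewrite (tailopS _ jn') (tailopS y jn') (tailopS (T j _) jn1) -c1 br //; try lia.
rewrite -(tailopS (tailop j.+1 y) jn1) IH; try lia.
by rewrite (tailopS _ jn') c1 -(tailopS _ jn1).
Qed.

Section Vectors.
Variable x0 : X.

(** [true] is a minus sign. A minus at the 0-based position i contributes $T_{i+1}\cdots T_n$, which
    creates the sign at the last place and carries it to i; smaller positions are applied first.
    This spells a reduced word of the minimal representative with sign pattern d. *)
Fixpoint spinpart (k : nat) (d : nat -> bool) : X :=
  if k is k'.+1 then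
    (if d k' then tailop k (spinpart k' d) else spinpart k' d)
  else x0.

Definition spinvec (d : nat -> bool) : X := spinpart n d.

Lemma spinpart_ext k d d' : (forall i, (i < k)%N -> d i = d' i) ->
  spinpart k d = spinpart k d'.
Proof.
elim: k => //= k IH dd; rewrite dd // IH // => i ik; apply: dd; lia.
Qed.

(** The factors of the positions from k on begin beyond j + 1 and commute with [T_j], so a relation
    among the first k positions persists. *)
Lemma spinpart_lift j k m a d d' : (j < k <= m)%N -> (m <= n)%N ->
  (forall i, (k <= i)%N -> d i = d' i) ->
  T j (spinpart k d) = a *: spinpart k d' -> T j (spinpart m d) = a *: spinpart m d'.
Proof.
move=> jk mn dd E; elim: m jk mn => [|m IH] jk mn; first by lia.
case: (eqVneq k m.+1) => [<- //|km].
have IH' : T j (spinpart m d) = a *: spinpart m d' by apply: IH; lia.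
rewrite /= dd; last lia.
case: (d' m) => //; rewrite tailop_comm ?IH'; last lia.
by rewrite /tailop; elim: (iota _ _) => //= i s ->.
Qed.

Variables (c psi : F).
Hypothesis T_x0 : forall j, (0 < j < n)%N -> T j x0 = c *: x0.
Hypothesis T_affine_x0 : T 0 (tailop 1 x0) = psi *: x0.

Definition flipsign (j : nat) (d : nat -> bool) : nat -> bool := fun k =>
  if j == 0%N then (if k == 0%N then ~~ d k else d k)
  else if j == n then (if k == n.-1 then ~~ d k else d k)
  else if k == j.-1 then d j
  else if k == j then d j.-1
  else d k.

(** The letters that lengthen the representative of d: n creates a minus sign at the last place, a
    middle letter moves one a place to the left. *)
Definition raises (j : nat) (d : nat -> bool) : bool :=
  if j == n then ~~ d n.-1 else [&& (0 < j < n)%N, ~~ d j.-1 & d j].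

Lemma tailopZ i a y : tailop i (a *: y) = a *: tailop i y.
Proof. by rewrite /tailop; elim: (iota _ _) => //= k s ->. Qed.

Lemma spinpart_fix j k d : (k < j < n)%N -> T j (spinpart k d) = c *: spinpart k d.
Proof.
elim: k j => [|k IH] j kj /=; first by apply: T_x0; lia.
case: (d k); last by apply: IH; lia.
by rewrite tailop_shift ?IH ?tailopZ //; lia.
Qed.

Lemma spinvec_fix j d : (0 < j < n)%N -> d j.-1 = d j ->
  T j (spinvec d) = c *: spinvec d.
Proof.
move=> jn dj; apply: (@spinpart_lift j j.+1) => //; first lia.
case: j jn dj => // j jn /= dj; rewrite dj.
case: (d j.+1); last by apply: spinpart_fix; lia.
(* With two minus signs [T_j] completes the outer factor to the same word as the inner one;
   [tailop_sq] then brings out $T_{n-1}$, which acts by c on the part below. *)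
rewrite -tailopS ?tailop_sq ?spinpart_fix ?tailopZ //; lia.
Qed.

Lemma spinvec_raise j d : raises j d -> T j (spinvec d) = spinvec (flipsign j d).
Proof.
rewrite /raises; case: eqVneq => [-> dn | jn /and3P[j0 d1 d2]].
  have spinS m e : m = n.-1.+1 -> spinpart m e =
      if e n.-1 then tailop m (spinpart n.-1 e) else spinpart n.-1 e by move=> ->.
  have nn : (n == 0)%N = false by lia.
  have nn1 : n = n.-1.+1 by lia.
  rewrite /spinvec (spinS n d nn1) (spinS n (flipsign n d) nn1).
  rewrite (negbTE dn) /flipsign ?eqxx nn dn /= tailop_n.
  congr (T n _); apply: spinpart_ext => i ni.
  by rewrite ltn_eqF.
rewrite /spinvec -[RHS]scale1r; apply: (@spinpart_lift j j.+1) => //; first lia.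
  move=> i ji; rewrite /flipsign (negbTE jn) [j == 0]gtn_eqF; last lia.
  by rewrite ![i == _]gtn_eqF //; lia.
case: j jn j0 d1 d2 => // j jn j0 d1 d2; rewrite scale1r /= d2 (negbTE d1).
have -> : flipsign j.+1 d j.+1 = false.
  rewrite /flipsign (negbTE jn) /= eqxx; case: eqP => [|_]; first lia.
  exact: negbTE.
have -> : flipsign j.+1 d j = true by rewrite /flipsign (negbTE jn) /= eqxx.
rewrite -tailopS; last lia.
congr tailop; apply: spinpart_ext => i ij; rewrite /flipsign (negbTE jn) /=.
by rewrite !ltn_eqF //; lia.
Qed.

Lemma spinvec_0 (d : nat -> bool) : d 0%N -> T 0 (spinvec d) = psi *: spinvec (flipsign 0 d).
Proof.
move=> d0; apply: (@spinpart_lift 0 1) => //; first lia.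
  by move=> i i0; rewrite /flipsign /= gtn_eqF.
by rewrite /= d0 T_affine_x0 /flipsign /= d0.
Qed.

Lemma spinvec_plus (d : nat -> bool) :
  (forall i, (i < n)%N -> d i = false) -> spinvec d = x0.
Proof.
rewrite /spinvec => d0; have: (n <= n)%N by []; elim: {-2}n => //= k IH kn.
by rewrite d0 // IH // ltnW.
Qed.

End Vectors.
End SpinVectors.

(** * Commutation of the Y operators *)

Section CommutingY.
Variables (n : nat) (X : Type) (T T' : nat -> X -> X).
Hypothesis n_ge2 : (2 <= n)%N.
Hypothesis T_braid : affine_braid n T.
Hypothesis TK : forall j, (j <= n)%N -> cancel (T j) (T' j).
Hypothesis T'K : forall j, (j <= n)%N -> cancel (T' j) (T j).

Let op (p : nat * bool) : X -> X := if p.2 then T' p.1 else T p.1.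
Definition Yop (i : nat) : X -> X := apply_word op (Yword n i).

Definition commutes (A B : X -> X) := forall v, A (B v) = B (A v).

Lemma commutes_inv A j : (j <= n)%N -> commutes A (T j) -> commutes A (T' j).
Proof. by move=> jn AT v; rewrite -{2}(T'K jn v) AT TK. Qed.

(** The words of $Y_{i+1}T_i$ and $T_i^{-1}Y_i$ coincide letter by letter. *)
Lemma Yop_rec i v : (0 < i < n)%N -> Yop i v = T i (Yop i.+1 (T i v)).
Proof.
move=> ij; have E : rcons (Yword n i.+1) (i, false) = (i, true) :: Yword n i.
  case: i ij => // i ij; rewrite /Yword -!pred_Sn.
  have -> : iota 1 i.+1 = rcons (iota 1 i) i.+1 by rewrite -{1}(addn1 i) iotaD cats1 add1n.
  have -> : iota i.+1 (n - i.+1) = i.+1 :: iota i.+2 (n - i.+2).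
    by rewrite -[in RHS]/(iota i.+1 (n - i.+2).+1); congr iota; lia.
  rewrite rev_rcons rev_cons !map_rcons /=.
  by rewrite rcons_cat /= rcons_cat.
have : apply_word op (rcons (Yword n i.+1) (i, false)) v =
       apply_word op ((i, true) :: Yword n i) v by rewrite E.
rewrite /apply_word foldr_rcons => H.
by rewrite /Yop /apply_word -[T i v]/(op (i, false) v) H /= {2}/op /= T'K //; lia.
Qed.

Lemma YopS i v : (0 < i < n)%N -> Yop i.+1 v = T' i (Yop i (T' i v)).
Proof. by move=> ij; rewrite (@Yop_rec i) // T'K ?TK //; lia. Qed.

(* [palin k] is T_(n-k) ... T_(n-1) T_n T_(n-1) ... T_(n-k) *)
Fixpoint palin (k : nat) (v : X) : X :=
  if k is k'.+1 then T (n - k) (palin k' (T (n - k) v)) else T n v.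

Lemma commutes_palin A k : (forall j, (n - k <= j <= n)%N -> commutes A (T j)) ->
  commutes A (palin k).
Proof.
elim: k => [|k IH] /= com v; first by apply: com; lia.
have cT : commutes A (T (n - k.+1)) by apply: com; lia.
by rewrite cT IH ?cT // => j jn; apply: com; lia.
Qed.

Lemma commutes_T i j : (i <= n)%N -> (j <= n)%N -> (i.+1 < j)%N || (j.+1 < i)%N ->
  commutes (T i) (T j).
Proof.
by case: T_braid => _ _ _ com ? ? /orP[] ? v; [apply: com | symmetry; apply: com].
Qed.

(** Induction on k. A letter not adjacent to the outermost one passes both copies of it. For the
    adjacent letter the braid relation is applied on either side of the inner palindrome; when k = 1
    it is the relation of length four. *)
Lemma palin_T k j : (k < n)%N -> (n - k < j <= n)%N -> commutes (T j) (palin k).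
Proof.
case: T_braid => _ br4 br _.
elim/ltn_ind: k j => -[|k] IH j kn jn; first lia.
have [->|jk] := eqVneq j (n - k)%N; last first.
  have cj : commutes (T j) (T (n - k.+1)) by apply: commutes_T; lia.
  have cp : commutes (T j) (palin k) by apply: IH; lia.
  by move=> v /=; rewrite cj cp cj.
case: k IH kn jn => [|k] IH kn jn v /=.
  by rewrite subn0 subn1 -br4.
have nk1 : (n - k.+1 = (n - k.+2).+1)%N by lia.
have com := @commutes_palin (T (n - k.+2)) k.
have {}com : commutes (T (n - k.+2)) (palin k).
  by apply: com => j' jn'; apply: commutes_T; lia.
rewrite !nk1 -br; try lia.
by rewrite com br ?com //; lia.
Qed.

Lemma Yop1 v : Yop 1 v = T 0 (palin n.-1 v).
Proof.
rewrite /Yop /Yword /= {1}/op /=; congr (T 0 _).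
have H k w : (k < n)%N -> palin k w =
  apply_word op ([seq (j, false) | j <- iota (n - k) k.+1] ++
                 [seq (j, false) | j <- rev (iota (n - k) k)]) w.
  elim: k w => [|k IH] w kn /=; first by rewrite subn0.
  rewrite IH; last lia.
  have -> : (n - k.+1).+1 = (n - k)%N by lia.
  by rewrite rev_cons map_rcons /apply_word -rcons_cat foldr_rcons.
rewrite H; last lia.
by rewrite (_ : n - n.-1 = 1)%N ?prednK ?subn1 //; lia.
Qed.

(** Induction on i through $Y_{i+1}=T_i^{-1}Y_iT_i^{-1}$. The delicate letter is j = i - 2: braiding
    across $T_{i-1}^{-1}T_{i-2}^{-1}$ turns it into $T_{i-1}$, which commutes with $Y_{i-2}$. *)
Lemma Yop_T i j : (0 < i <= n)%N -> (0 < j <= n)%N -> j != i -> j.+1 != i ->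
  commutes (T j) (Yop i).
Proof.
case: T_braid => _ _ br _.
elim/ltn_ind: i j => -[|[|i]] IH j iN jN ji ji1; first lia.
  have cj : commutes (T j) (T 0) by apply: commutes_T; lia.
  have cp : commutes (T j) (palin n.-1) by apply: palin_T; lia.
  by move=> v; rewrite !Yop1 cj cp.
move=> v; rewrite !(@YopS i.+1); try lia.
have [ij|ij] := eqVneq j i; last first.
  have comI : commutes (T j) (T' i.+1) by apply/commutes_inv/commutes_T; lia.
  have comY : commutes (T j) (Yop i.+1) by apply: IH; lia.
  by rewrite comI comY comI.
rewrite {}ij in jN ji ji1 *; rewrite !(@YopS i); try lia.
have b1 w : T i (T' i.+1 (T' i w)) = T' i.+1 (T' i (T i.+1 w)).
  apply: (can_inj (@TK i.+1 _)); first lia.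
  rewrite T'K; last lia.
  apply: (can_inj (@TK i _)); first lia.
  by rewrite T'K ?br ?T'K //; lia.
have b2 w : T i.+1 (T' i (T' i.+1 w)) = T' i (T' i.+1 (T i w)).
  apply: (can_inj (@TK i _)); first lia.
  rewrite T'K; last lia.
  apply: (can_inj (@TK i.+1 _)); first lia.
  by rewrite T'K -?br ?T'K //; lia.
have comY : commutes (T i.+1) (Yop i) by apply: IH; lia.
by rewrite b1 comY b2.
Qed.

(** Put $p=T_2\cdots T_n\cdots T_2$; then $Y_1=T_0T_1pT_1$ and $Y_2=T_1^{-1}T_0T_1p$. Besides the
    length four relation of $T_0,T_1$, the computation uses that p commutes with $T_0$ and with
    $T_1pT_1$. *)
Lemma Yop1_Yop2 : commutes (Yop 1) (Yop 2).
Proof.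
case: T_braid => br0 _ _ _ v; rewrite !(@YopS 1); try lia.
have palS w : palin n.-1 w = T 1 (palin (n - 2) (T 1 w)).
  rewrite (_ : n.-1 = (n - 2).+1)%N; last lia.
  by rewrite /= (_ : n - (n - 2).+1 = 1)%N //; lia.
have E w : Yop 1 w = T 0 (T 1 (palin (n - 2) (T 1 w))) by rewrite Yop1 palS.
have c0 : commutes (T 0) (palin (n - 2)).
  by apply: commutes_palin => j jn; apply: commutes_T; lia.
have c1 w : palin (n - 2) (T 1 (palin (n - 2) (T 1 w))) =
    T 1 (palin (n - 2) (T 1 (palin (n - 2) w))).
  have H : commutes (palin n.-1) (palin (n - 2)).
    by apply: commutes_palin => j jn u; rewrite palin_T //; lia.
  by have := H w; rewrite !palS => ->.
rewrite !E !T'K; try lia.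
apply: (can_inj (@TK 1 _)); first lia.
rewrite T'K; last lia.
by rewrite -!c0 -br0 -c1.
Qed.

(** The pair (1, 2) is the real computation: raising j and then i by $Y_{i+1}=T_i^{-1}Y_iT_i^{-1}$
    multiplies on both sides by letters that commute with the other operator. *)
Lemma Yop_comm i j : (0 < i <= n)%N -> (0 < j <= n)%N -> commutes (Yop i) (Yop j).
Proof.
wlog ij : i j / (i < j)%N.
  move=> H i_n j_n v; case: (ltngtP i j) => [ij|ji|-> //]; first exact: H.
  by symmetry; apply: H.
elim: i ij => [|i IH] ij i_n j_n; first lia.
case: i IH ij i_n => [|i] IH ij i_n v.
  clear IH; elim: j ij j_n v => [|[|[|j]] IHj] ij j_n v; try lia; first exact: Yop1_Yop2.
  rewrite !(@YopS j.+2); try lia.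
  have com : commutes (Yop 1) (T' j.+2).
    by apply: commutes_inv => [|w]; [lia | rewrite Yop_T //; lia].
  have comY : commutes (Yop 1) (Yop j.+2) by move=> w; apply: IHj; lia.
  by rewrite com comY com.
rewrite !(@YopS i.+1); try lia.
have com : commutes (Yop j) (T' i.+1).
  by apply: commutes_inv => [|w]; [lia | rewrite Yop_T //; lia].
have comY : commutes (Yop i.+1) (Yop j) by move=> w; apply: IH; lia.
by rewrite -com comY -com.
Qed.

End CommutingY.

(** * The operators varpi(T_j) on good points *)

Section RankTwo.
Variables (F : fieldType) (P : Type).
Implicit Types (f c : P -> F) (s : P -> P).

(** The shape of a Demazure-Lusztig operator. Over an abstract set of points the rank two relations
    become rational identities in the values of two or three coordinate functions. *)
Definition reflop (a : F) c s f : P -> F := fun p => a * f p + c p * (f (s p) - f p).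

Lemma reflop_comm a b c d s r f p :
  (forall p, s (r p) = r (s p)) -> (forall p, c (r p) = c p) -> (forall p, d (s p) = d p) ->
  reflop a c s (reflop b d r f) p = reflop b d r (reflop a c s f) p.
Proof. by move=> sr cr ds; rewrite /reflop !sr !cr !ds; ring. Qed.

Lemma reflop_braid3 a C c d s r (x y z : P -> F) f p :
  involutive s -> involutive r -> (forall p, s (r (s p)) = r (s (r p))) ->
  (forall p, x (s p) = y p) -> (forall p, y (s p) = x p) -> (forall p, z (s p) = z p) ->
  (forall p, x (r p) = x p) -> (forall p, y (r p) = z p) -> (forall p, z (r p) = y p) ->
  (forall p, c p = a - C / (1 - x p / y p)) -> (forall p, d p = a - C / (1 - y p / z p)) ->
  (forall p, y p != 0) -> (forall p, x p != y p) ->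
  reflop a c s (reflop a d r (reflop a c s f)) p = reflop a d r (reflop a c s (reflop a d r f)) p.
Proof.
move=> sK rK srs xs ys zs xr yr zr cE dE y0 xy.
have := xy (r p); have := xy p; have := xy (r (s p)); have := y0 (s p); have := y0 (r p); have := y0 p.
rewrite /reflop !cE !dE ?(xs, ys, zs, xr, yr, zr) ?(sK, rK) -?srs ?(sK, rK).
move: (x p) (y p) (z p) => X Y Z Y0 Z0 X0 nYZ nXY nXZ.
by field; rewrite !subr_eq0 Y0 Z0 X0 !(eq_sym Z) !(eq_sym Y X) nXY nXZ nYZ.
Qed.

(** The coefficient d covers both ends of the diagram: y is $t_n$ at the node n and $q^{1/2}/t_1$ at
    the node 0, x being the neighbouring coordinate in the same normalisation. *)
Lemma reflop_braid4 a b C A B c d s r (x y : P -> F) f p :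
  involutive s -> involutive r -> (forall p, s (r (s (r p))) = r (s (r (s p)))) ->
  (forall p, x (s p) = y p) -> (forall p, y (s p) = x p) ->
  (forall p, x (r p) = x p) -> (forall p, y (r p) = (y p)^-1) ->
  (forall p, c p = a - C / (1 - x p / y p)) ->
  (forall p, d p = b - (A + B * y p) / (1 - y p ^+ 2)) ->
  (forall p, y p != 0) -> (forall p, x p != y p) -> (forall p, 1 - y p ^+ 2 != 0) ->
  reflop a c s (reflop b d r (reflop a c s (reflop b d r f))) p =
  reflop b d r (reflop a c s (reflop b d r (reflop a c s f))) p.
Proof.
move=> sK rK srs xs ys xr yr cE dE y0 xy y1.
have := xy (r p); have := xy p; have := y0 (s p); have := y0 p; have := y1 p; have := y1 (s p).
rewrite /reflop !cE !dE ?(xs, ys, xr, yr) ?invrK.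
rewrite ?(xs, ys, xr, yr) ?invrK.
rewrite ?(sK, rK) -?srs ?(sK, rK).
move: (x p) (y p) => X Y X1 Y1 Y0 X0 nXY nXYi.
have XY1 : 1 - X * Y != 0.
  by apply: contra nXYi; rewrite subr_eq0 => /eqP e; rewrite -(mulfK Y0 X) -e mul1r.
have XY2 : Y - X != 0 by rewrite subr_eq0 eq_sym.
have XY3 : Y * X - 1 != 0 by rewrite -opprB oppr_eq0 mulrC.
have XY4 : X - Y != 0 by rewrite subr_eq0.
have X2 : X ^+ 2 - 1 != 0 by rewrite -opprB oppr_eq0.
have Y2 : Y ^+ 2 - 1 != 0 by rewrite -opprB oppr_eq0.
rewrite (mulrC Y X) (mulrC Y^-1 X).
(* Inverting its argument replaces each fraction by a constant minus itself, so four unknowns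
   remain: [m1], [m2] for X/Y, XY and [n1], [n2] for Y, X. *)
have -> : C / (1 - Y / X) = C - C / (1 - X / Y) by field; rewrite Y0 X0 XY2.
have -> : C / (1 - Y^-1 / X) = C - C / (1 - X * Y).
  by field; rewrite Y0 X0 XY1 XY3.
have -> : (A + B / Y) / (1 - Y^-1 ^+ 2) = A - (A + B * Y) / (1 - Y ^+ 2).
  by field; rewrite Y0 Y1 Y2.
have -> : (A + B / X) / (1 - X^-1 ^+ 2) = A - (A + B * X) / (1 - X ^+ 2).
  by field; rewrite X0 X1 X2.
(* The braid relation reduces, coefficient by coefficient, to this one. *)
have : (A + B * X) / (1 - X ^+ 2) * (C - C / (1 - X / Y)) +
    C / (1 - X / Y) * ((A + B * Y) / (1 - Y ^+ 2)) +
    C / (1 - X * Y) * (A - (A + B * Y) / (1 - Y ^+ 2) - (A + B * X) / (1 - X ^+ 2)) = 0.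
  by field; rewrite X1 Y0 Y1 XY1 XY2.
move: (C / (1 - X / Y)) (C / (1 - X * Y)) ((A + B * Y) / _) ((A + B * X) / _) => m1 m2 n1 n2.
move=> rel; apply/eqP; rewrite -subr_eq0; apply/eqP.
set E := (X in X = 0) in rel.
(* The difference of the two sides is this multiple of the relation. *)
have -> : 0 = E * ((a - m1) * (n2 - n1) * f (s p) + (b - n1) * (m1 - m2) * f (r p)
   + (a - m1) * (b - n2) * f (r (s p)) - (b - n1) * (a - m2) * f (s (r p))) by rewrite rel mul0r.
by rewrite /E; ring.
Qed.
End RankTwo.

Section SwapRelations.
Variables (T : Type) (s r : (nat -> T) -> nat -> T) (a b : nat).
Hypotheses (ab : a != b) (s_a : forall t, s t a = t b) (s_b : forall t, s t b = t a).
Hypothesis s_out : forall t i, i != a -> i != b -> s t i = t i.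

(** [g] will be $x\mapsto q/x$ at the node 0 and $x\mapsto 1/x$ at the node n. *)
Lemma swap_braid4 g t i : (forall t, r t b = g (t b)) -> (forall t i, i != b -> r t i = t i) ->
  s (r (s (r t))) i = r (s (r (s t))) i.
Proof.
move=> r_b r_out; have ba : b != a by rewrite eq_sym.
have [->|ia] := eqVneq i a.
  by rewrite s_a r_b s_b r_out // r_out // s_a r_b s_b.
have [->|ib] := eqVneq i b.
  by rewrite s_b r_out // s_a r_b r_b s_b r_out // s_a.
by rewrite s_out // r_out // s_out // r_out // r_out // s_out // r_out // s_out.
Qed.

Lemma swap_braid3 c t i : c != a -> c != b -> (forall t, r t b = t c) ->
  (forall t, r t c = t b) -> (forall t i, i != b -> i != c -> r t i = t i) ->
  s (r (s t)) i = r (s (r t)) i.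
Proof.
move=> ca cb r_b r_c r_out; have ac : a != c by rewrite eq_sym.
have [->|ia] := eqVneq i a.
  by rewrite s_a r_b s_out // r_out // s_a r_b.
have [->|ib] := eqVneq i b.
  by rewrite s_b r_out // s_a r_b s_out // r_c.
have [->|ic] := eqVneq i c.
  by rewrite s_out // r_c s_b r_c s_b r_out.
by rewrite s_out // r_out // s_out // r_out // s_out // r_out.
Qed.

End SwapRelations.

Section GoodPoints.
Variables (F : fieldType) (n : nat) (q12 k0 k kn u0 un : F).
Hypothesis n_ge2 : (2 <= n)%N.

Let qq := q q12.
Let act := sj n q12.

Definition coord_pm (t : nat -> F) (a : nat * bool) : F :=
  if a.2 then (t a.1)^-1 else t a.1.

(* The 2n numbers t_i, 1/t_i lie in distinct classes modulo powers of q, so that no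
   denominator of the operators vanishes on the orbit of t under the affine Weyl group. *)
Definition good_pt (t : nat -> F) : Prop :=
  torus n t /\ forall a b : nat * bool, (a.1 < n)%N -> (b.1 < n)%N -> a != b ->
    forall z : int, coord_pm t a != coord_pm t b * qq ^ z.

Lemma sj0_0 t : act 0 t 0%N = qq / t 0%N. Proof. by []. Qed.
Lemma sj0_out t i : i != 0%N -> act 0 t i = t i.
Proof. by rewrite /act /sj /= => /negbTE ->. Qed.
Lemma sjn_last t : act n t n.-1 = (t n.-1)^-1.
Proof. by rewrite /act /sj !eqxx gtn_eqF //; lia. Qed.
Lemma sjn_out t i : i != n.-1 -> act n t i = t i.
Proof. by rewrite /act /sj !eqxx [n == 0]gtn_eqF ?(ltnW n_ge2) // => /negbTE ->. Qed.
Lemma sjm_l j t : (0 < j < n)%N -> act j t j.-1 = t j.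
Proof. by move=> jn; rewrite /act /sj !eqxx gtn_eqF ?ltn_eqF //; lia. Qed.
Lemma sjm_r j t : (0 < j < n)%N -> act j t j = t j.-1.
Proof.
move=> jn; rewrite /act /sj !eqxx [j == 0]gtn_eqF ?[j == n]ltn_eqF ?[j == j.-1]gtn_eqF //; lia.
Qed.
Lemma sjm_out j t i : (0 < j < n)%N -> i != j.-1 -> i != j -> act j t i = t i.
Proof.
by move=> jn /negbTE h1 /negbTE h2; rewrite /act /sj h1 h2 gtn_eqF ?ltn_eqF //; lia.
Qed.

Hypothesis q12_neq0 : q12 != 0.

Lemma q_neq0 : qq != 0. Proof. exact: expf_neq0. Qed.

(** The permutation of the 2n symbols $t_i^{\pm1}$ induced by $s_j$ once powers of q are ignored;
    its injectivity is what preserves good points. *)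
Definition letter_of (j : nat) (a : nat * bool) : nat * bool :=
  if j == 0%N then (if a.1 == 0%N then (0%N, ~~ a.2) else a)
  else if j == n then (if a.1 == n.-1 then (n.-1, ~~ a.2) else a)
  else (if a.1 == j.-1 then j else if a.1 == j then j.-1 else a.1, a.2).

Lemma coord_pm_sj j t a : (j <= n)%N -> torus n t -> (a.1 < n)%N ->
  exists z : int, coord_pm (act j t) a = coord_pm t (letter_of j a) * qq ^ z.
Proof.
move=> jn tt; case: a => i e /= i_n; rewrite /letter_of.
have [->|j0] := eqVneq j 0%N.
  have [->|i0] := eqVneq i 0%N; last first.
    by exists 0; rewrite expr0z mulr1 /coord_pm /= sj0_out.
  case: e; rewrite /coord_pm /= sj0_0; [exists (-1) | exists 1].
    by rewrite invf_div exprN1.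
  by rewrite expr1z mulrC.
exists 0; rewrite expr0z mulr1 /=; have [->|jn'] := eqVneq j n.
  have [->|i0] := eqVneq i n.-1; last by rewrite /coord_pm /= sjn_out.
  by case: e; rewrite /coord_pm /= sjn_last ?invrK.
have jm : (0 < j < n)%N by lia.
rewrite /coord_pm /=; have [->|i0] := eqVneq i j.-1; first by rewrite sjm_l.
by have [->|i1] := eqVneq i j; [rewrite sjm_r | rewrite sjm_out].
Qed.

Lemma letter_ofK j : involutive (letter_of j).
Proof.
case=> i e; rewrite /letter_of; have [j0|j0] := eqVneq j 0%N.
  by have [i0|i0] := eqVneq i 0%N; rewrite /= ?i0 ?negbK // (negbTE i0).
have [jn|jn] := eqVneq j n.
  by have [i0|i0] := eqVneq i n.-1; rewrite /= ?i0 ?eqxx ?negbK // (negbTE i0).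
rewrite /=; congr (_, _); case: (eqVneq i j.-1) => [i1|i1].
  by rewrite eqxx i1; case: eqP => //; lia.
by case: (eqVneq i j) => [i2|i2]; rewrite ?eqxx ?(negbTE i1) ?(negbTE i2) //= i2.
Qed.

Lemma letter_of_lt j a : (j <= n)%N -> (a.1 < n)%N -> ((letter_of j a).1 < n)%N.
Proof.
by case: a => i e /= jn i_n; rewrite /letter_of; do ![case: eqP => /= ?]; lia.
Qed.

Lemma torus_sj j t : (j <= n)%N -> torus n t -> torus n (act j t).
Proof.
move=> jn tt i i_n; have [z E] := @coord_pm_sj j t (i, false) jn tt i_n.
have := @letter_of_lt j (i, false) jn i_n; move: E; rewrite /coord_pm /= => ->.
case: letter_of => i' e /= i'n; rewrite mulf_neq0 ?expfz_neq0 ?q_neq0 //.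
by case: e => /=; rewrite ?invr_eq0 tt.
Qed.

Lemma good_pt_sj j t : (j <= n)%N -> good_pt t -> good_pt (act j t).
Proof.
move=> jn [tt gt]; split=> [|a b an bn ab z]; first exact: torus_sj.
have [za ->] := coord_pm_sj jn tt an; have [zb ->] := coord_pm_sj jn tt bn.
rewrite -mulrA -expfzDr ?q_neq0 //.
have := gt _ _ (letter_of_lt jn an) (letter_of_lt jn bn) _ (zb + z - za).
rewrite (inj_eq (inv_inj (letter_ofK j))) => /(_ ab); apply: contra => /eqP e.
by rewrite expfzDr ?q_neq0 // mulrA -e -mulrA -expfzDr ?q_neq0 // subrr expr0z mulr1.
Qed.

Definition gpt := {t : nat -> F | good_pt t}.
Definition pt (p : gpt) : nat -> F := proj1_sig p.

Lemma pt_inj (p r : gpt) : pt p =1 pt r -> p = r.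
Proof.
case: p r => [t gt] [t' gt'] /= /funext e; rewrite -{}e in gt' *.
by rewrite (Prop_irrelevance gt gt').
Qed.

(** Matching on the proof of j <= n makes the action total; letters beyond n act as the identity. *)
Definition sG (j : nat) (p : gpt) : gpt :=
  if @idP (j <= n)%N is ReflectT jn then exist _ _ (good_pt_sj jn (proj2_sig p)) else p.

Lemma pt_sG j p : (j <= n)%N -> pt (sG j p) = act j (pt p).
Proof. by rewrite /sG; case: {-}_ / idP. Qed.

Lemma pt_torus p : torus n (pt p). Proof. by case: (proj2_sig p). Qed.

Lemma pt_neq p i j (e f : bool) : (i < n)%N -> (j < n)%N -> (i, e) != (j, f) ->
  forall z : int, coord_pm (pt p) (i, e) != coord_pm (pt p) (j, f) * qq ^ z.
Proof. by case: (proj2_sig p) => _ gt; exact: (gt (i, e) (j, f)). Qed.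

Lemma sGK j : involutive (sG j).
Proof.
move=> p; have [jn|jn] := leqP j n; last first.
  by rewrite /sG; case: {-}_ / idP => // jn'; lia.
apply: pt_inj => i; rewrite !(pt_sG _ jn).
have [->|j0] := eqVneq j 0%N.
  have [->|i0] := eqVneq i 0%N; last by rewrite !sj0_out.
  by rewrite !sj0_0 invf_div mulrC divfK ?q_neq0.
have [->|jn'] := eqVneq j n.
  have [->|i0] := eqVneq i n.-1; last by rewrite !sjn_out.
  by rewrite !sjn_last invrK.
have jm : (0 < j < n)%N by lia.
have [->|i0] := eqVneq i j.-1; first by rewrite sjm_l // sjm_r.
by have [->|i1] := eqVneq i j; [rewrite sjm_r // sjm_l | rewrite !sjm_out].
Qed.

(** varpi(T_j) as an honest operator: the orbit of a good point is good and no denominator vanishes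
    on it. The codomain [F^o] makes the functions an F-module. *)
Definition TX (j : nat) (f : gpt -> F^o) : gpt -> F^o :=
  reflop (kap n k0 k kn j)^-1 (fun p => ctilde n q12 k0 k kn u0 un j (pt p)) (sG j) f.

Lemma TX_linear j a f g : TX j (a *: f + g) = a *: TX j f + TX j g.
Proof.
by apply: funext => p; rewrite /TX /reflop !fctE /GRing.scale /=; ring.
Qed.

(** In the coordinates $q^{1/2}/t_2$ and $q^{1/2}/t_1$ the node 0 looks like the node n: $s_0$
    inverts the second one and $s_1$ exchanges them. *)
Let x0_of (p : gpt) := q12 / pt p 1%N.
Let y0_of (p : gpt) := q12 / pt p 0%N.

Lemma pt_neq0 p i : (i < n)%N -> pt p i != 0.
Proof. by move=> i_n; apply: pt_torus. Qed.

Lemma pt_inj_coord p i j : (i < n)%N -> (j < n)%N -> i != j -> pt p i != pt p j.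
Proof.
move=> i_n jn ij; have := @pt_neq p i j false false i_n jn _ 0.
by rewrite /coord_pm /= expr0z mulr1 => -> //; rewrite xpair_eqE (negbTE ij).
Qed.

Lemma pt_sqr_neq1 p i : (i < n)%N -> 1 - pt p i ^+ 2 != 0.
Proof.
move=> i_n; have := @pt_neq p i i false true i_n i_n _ 0.
rewrite /coord_pm /= expr0z mulr1 xpair_eqE andbF => /(_ isT); apply: contra; rewrite subr_eq0 => /eqP e.
by rewrite -(mulr1 (pt p i)^-1) e expr2 mulKf ?pt_neq0.
Qed.

Lemma pt_sqr_neqq p i : (i < n)%N -> 1 - (q12 / pt p i) ^+ 2 != 0.
Proof.
move=> i_n; have := @pt_neq p i i false true i_n i_n _ 1.
rewrite /coord_pm /= expr1z xpair_eqE andbF => /(_ isT); apply: contra; rewrite subr_eq0 => /eqP e.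
have := pt_neq0 p i_n => t0; apply/eqP; apply: (mulfI t0).
by rewrite mulrA mulfV // mul1r -expr2 -[LHS]mul1r e expr_div_n divfK ?expf_neq0.
Qed.

Hypotheses (k0_neq0 : k0 != 0) (k_neq0 : k != 0) (kn_neq0 : kn != 0).
Hypotheses (u0_neq0 : u0 != 0) (un_neq0 : un != 0).

(** Partial fractions put the coefficients, here and in the next two lemmas, into the shape of the
    rank two identities. *)
Lemma ctildem j p : (0 < j < n)%N ->
  ctilde n q12 k0 k kn u0 un j (pt p) = k^-1 - (k^-1 - k) / (1 - pt p j.-1 / pt p j).
Proof.
move=> jm; have tj : pt p j != 0 by apply: pt_neq0; lia.
have tt : pt p j.-1 != pt p j by apply: pt_inj_coord; lia.
have [e1 e2] : (j == 0)%N = false /\ (j == n) = false by lia.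
rewrite /ctilde e1 e2; by field; rewrite tj k_neq0 subr_eq0 eq_sym tt.
Qed.

Lemma ctilden p : ctilde n q12 k0 k kn u0 un n (pt p) =
  kn^-1 - ((kn^-1 - kn) + (un^-1 - un) * pt p n.-1) / (1 - pt p n.-1 ^+ 2).
Proof.
have t1 : 1 - pt p n.-1 ^+ 2 != 0 by apply: pt_sqr_neq1; lia.
have e1 : (n == 0)%N = false by lia.
rewrite /ctilde eqxx e1.
by field; rewrite t1 kn_neq0 un_neq0.
Qed.

Lemma ctilde0 p : ctilde n q12 k0 k kn u0 un 0 (pt p) =
  k0^-1 - ((k0^-1 - k0) + (u0^-1 - u0) * y0_of p) / (1 - y0_of p ^+ 2).
Proof.
have t1 : 1 - y0_of p ^+ 2 != 0 by apply: pt_sqr_neqq; lia.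
have tj : pt p 0%N != 0 by apply: pt_neq0; lia.
have t2 : pt p 0%N ^+ 2 - q12 ^+ 2 != 0.
  apply: contra t1; rewrite subr_eq0 => /eqP e.
  by rewrite expr_div_n -e divff ?subrr ?expf_neq0.
by rewrite /ctilde /= /y0_of /q; field; rewrite k0_neq0 u0_neq0 tj t2.
Qed.

Let kapn : kap n k0 k kn n = kn.
Proof. by rewrite /kap eqxx; case: (n) n_ge2. Qed.
Let kapm j : (0 < j < n)%N -> kap n k0 k kn j = k.
Proof.
move=> jn; have [e1 e2] : (j == 0)%N = false /\ (j == n) = false by lia.
by rewrite /kap e1 e2.
Qed.

Lemma sG_comm i j p : (j <= n)%N -> (i.+1 < j)%N -> sG i (sG j p) = sG j (sG i p).
Proof.
move=> jn ij; have i_n : (i <= n)%N by lia.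
apply: pt_inj => l; rewrite !(pt_sG _ jn, pt_sG _ i_n).
have out t l' : l' != j.-1 -> l' != j -> act j t l' = t l'.
  by move=> l1 l2; have [E|jn'] := eqVneq j n; [subst j; rewrite sjn_out | rewrite sjm_out //; lia].
have [lj|lj] := boolP ((l == j.-1) || (l == j)); last first.
  have [l1 l2] := norP lj.
  have [i0|i0] := eqVneq i 0%N.
    subst i; have [->|l0] := eqVneq l 0%N; last by rewrite sj0_out ?out // sj0_out.
    by rewrite !sj0_0 !out ?sj0_0 //; lia.
  have im : (0 < i < n)%N by lia.
  have [->|li] := eqVneq l i.-1; first by rewrite sjm_l ?out ?sjm_l //; lia.
  have [->|li'] := eqVneq l i; first by rewrite sjm_r ?out ?sjm_r //; lia.
  by rewrite sjm_out ?out ?sjm_out.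
have outi t l' : (l' == j.-1) || (l' == j) -> act i t l' = t l'.
  move=> lj'; have [i0|i0] := eqVneq i 0%N; first by subst i; rewrite sj0_out //; lia.
  by rewrite sjm_out //; lia.
rewrite outi //; have [E|jn'] := eqVneq j n; last first.
  by case/orP: lj => /eqP->; rewrite ?sjm_l ?sjm_r ?outi ?eqxx ?orbT //; lia.
subst j; have [->|l1] := eqVneq l n.-1; first by rewrite !sjn_last outi ?eqxx.
by rewrite !sjn_out ?outi.
Qed.

Lemma ctilde_out i j p : (j <= n)%N -> (i <= n)%N -> (i.+1 < j)%N || (j.+1 < i)%N ->
  ctilde n q12 k0 k kn u0 un i (pt (sG j p)) = ctilde n q12 k0 k kn u0 un i (pt p).
Proof.
move=> jn i_n ij; rewrite pt_sG // /ctilde.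
have outj l : ((l == i.-1) || (l == i)) && (l < n)%N -> act j (pt p) l = pt p l.
  move=> li; have [i0|i0] := eqVneq j 0%N; first by subst j; rewrite sj0_out //; lia.
  by have [E|jn'] := eqVneq j n; [subst j; rewrite sjn_out // | rewrite sjm_out //]; lia.
have [i0|i0] := eqVneq i 0%N; first by rewrite !outj //; lia.
have [i1|i1] := eqVneq i n; first by rewrite !outj //; lia.
by rewrite !outj //; lia.
Qed.

Lemma TX_braid : affine_braid n TX.
Proof.
have y0n p : y0_of p != 0 by rewrite /y0_of mulf_neq0 ?invr_eq0 ?pt_neq0 //; lia.
have x0n p : x0_of p != 0 by rewrite /x0_of mulf_neq0 ?invr_eq0 ?pt_neq0 //; lia.
split.
- move=> f; apply: funext => p; symmetry; rewrite /TX.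
  have l t : act 1 t 0%N = t 1%N by apply: (@sjm_l 1).
  have r t : act 1 t 1%N = t 0%N by apply: (@sjm_r 1).
  have o t i : i != 0%N -> i != 1%N -> act 1 t i = t i by apply: (@sjm_out 1).
  have n1 : (1 <= n)%N by lia.
  have n0 : (0 <= n)%N by [].
  apply: (@reflop_braid4 _ _ _ _ (k^-1 - k) (k0^-1 - k0) (u0^-1 - u0) _ _ _ _ x0_of y0_of) => //.
  + exact: sGK.
  + exact: sGK.
  + move=> {}p; apply: pt_inj => i; rewrite !(pt_sG _ n1, pt_sG _ n0).
    apply: (@swap_braid4 _ _ _ 1 0 isT r l _ (fun x => qq / x)) => //.
      by move=> t i' i1 i0; apply: o.
    exact: sj0_out.
  + by move=> {}p; rewrite /x0_of /y0_of pt_sG // r.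
  + by move=> {}p; rewrite /x0_of /y0_of pt_sG // l.
  + by move=> {}p; rewrite /x0_of /y0_of pt_sG // sj0_out.
  + move=> {}p; have t0 : pt p 0%N != 0 by apply: pt_neq0; lia.
    by rewrite /x0_of /y0_of pt_sG // sj0_0 /qq /q; field; rewrite q12_neq0 t0.
  + move=> {}p; rewrite (ctildem (j := 1)) // kapm // /x0_of /y0_of invf_div.
    by rewrite [_ * (_ / q12)]mulrC mulrA divfK.
  + by move=> {}p; rewrite ctilde0.
  + move=> {}p; rewrite /x0_of /y0_of (inj_eq (mulfI q12_neq0)) (inj_eq invr_inj).
    by apply: pt_inj_coord; lia.
  + by move=> {}p; apply: pt_sqr_neqq; lia.
- move=> f; apply: funext => p; rewrite /TX.
  have m : (0 < n.-1 < n)%N by lia.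
  have n1 : (n.-1 <= n)%N by lia.
  have n2 : n.-1.-1 != n.-1 by lia.
  apply: (@reflop_braid4 _ _ _ _ (k^-1 - k) (kn^-1 - kn) (un^-1 - un) _ _ _ _
    (fun p => pt p n.-1.-1) (fun p => pt p n.-1)) => //.
  + exact: sGK.
  + exact: sGK.
  + move=> {}p; apply: pt_inj => i; rewrite !(pt_sG _ n1, pt_sG _ (leqnn n)).
    apply: (@swap_braid4 _ _ _ n.-1.-1 n.-1 _ _ _ _ (fun x => x^-1)) => // => [t|t|t i' *|t|t i' *].
    * exact: sjm_l.
    * exact: sjm_r.
    * exact: sjm_out.
    * exact: sjn_last.
    * exact: sjn_out.
  + by move=> {}p; rewrite pt_sG // sjm_l.
  + by move=> {}p; rewrite pt_sG // sjm_r.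
  + by move=> {}p; rewrite pt_sG // sjn_out.
  + by move=> {}p; rewrite pt_sG // sjn_last.
  + by move=> {}p; rewrite ctildem // kapm.
  + by move=> {}p; rewrite ctilden kapn.
  + by move=> {}p; apply: pt_neq0; lia.
  + by move=> {}p; apply: pt_inj_coord; lia.
  + by move=> {}p; apply: pt_sqr_neq1; lia.
- move=> j f j1 jn; apply: funext => p; rewrite /TX.
  have m : (0 < j < n)%N by lia.
  have m1 : (0 < j.+1 < n)%N by lia.
  have [nj nj1] : (j <= n)%N /\ (j.+1 <= n)%N by lia.
  have [d1 d2 d3] : [/\ j.-1 != j, j != j.+1 & j.-1 != j.+1] by split; lia.
  have [d4 d5 d6] : [/\ j != j.-1, j.+1 != j & j.+1 != j.-1] by split; lia.
  have l t : act j.+1 t j = t j.+1 by apply: (@sjm_l j.+1).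
  have o t i : i != j -> i != j.+1 -> act j.+1 t i = t i by apply: (@sjm_out j.+1).
  rewrite (kapm m) (kapm m1); apply: (@reflop_braid3 _ _ _ (k^-1 - k) _ _ _ _
    (fun p => pt p j.-1) (fun p => pt p j) (fun p => pt p j.+1)) => //.
  + exact: sGK.
  + exact: sGK.
  + move=> {}p; apply: pt_inj => i; rewrite !(pt_sG _ nj, pt_sG _ nj1).
    apply: (@swap_braid3 _ _ _ j.-1 j _ _ _ _ j.+1) => // => [t|t|t i' *|t].
    * exact: sjm_l.
    * exact: sjm_r.
    * exact: sjm_out.
    * exact: (sjm_r (j := j.+1)).
  + by move=> {}p; rewrite pt_sG // sjm_l.
  + by move=> {}p; rewrite pt_sG // sjm_r.
  + by move=> {}p; rewrite pt_sG // sjm_out.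
  + by move=> {}p; rewrite pt_sG // o.
  + by move=> {}p; rewrite pt_sG // l.
  + by move=> {}p; rewrite pt_sG // sjm_r.
  + by move=> {}p; rewrite ctildem.
  + by move=> {}p; rewrite ctildem.
  + by move=> {}p; apply: pt_neq0; lia.
  + by move=> {}p; apply: pt_inj_coord; lia.
- move=> i j f jn ij; apply: funext => p; rewrite /TX; apply: reflop_comm => {}p.
  + exact: sG_comm.
  + by apply: ctilde_out => //; [lia | rewrite ij].
  + by apply: ctilde_out => //; [lia | rewrite ij orbT].
Qed.

End GoodPoints.

(** * Laurent polynomials *)

Section LaurentLists.
Variables (F : fieldType) (n : nat).

(* Laurent polynomials as lists of (exponent, coefficient), repetitions allowed. *)
Definition lpoly := seq ({ffun 'I_n -> int} * F).
Definition lev (s : lpoly) (t : nat -> F) : F := \sum_(p <- s) p.2 * mono p.1 t.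
Definition lcoef (s : lpoly) (lam : {ffun 'I_n -> int}) : F := \sum_(p <- s | p.1 == lam) p.2.
Definition lnz (s : lpoly) : Prop := exists lam, lcoef s lam != 0.

Lemma lev_lcoef s u t : uniq u -> {subset map fst s <= u} ->
  lev s t = \sum_(lam <- u) lcoef s lam * mono lam t.
Proof.
move=> uu su; rewrite /lev /lcoef.
under [RHS]eq_bigr => lam _ do rewrite mulr_suml.
rewrite (exchange_big_dep xpredT) //= big_seq [RHS]big_seq; apply: eq_bigr => p ps.
rewrite [RHS]big_mkcond (bigD1_seq p.1) //=; last by apply: su; apply: map_f.
by rewrite eqxx big1 ?addr0 // => lam; rewrite eq_sym => /negbTE ->.
Qed.

Lemma lcoef_out s lam : lam \notin map fst s -> lcoef s lam = 0.
Proof.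
move=> ls; rewrite /lcoef big_seq_cond big1 // => p /andP[ps /eqP e].
by rewrite -e map_f in ls.
Qed.

Lemma lnz_of_lev s t : lev s t != 0 -> lnz s.
Proof.
move=> st; apply: contrapT => H; case/eqP: st.
rewrite (@lev_lcoef s (undup (map fst s))) ?undup_uniq //; last by move=> x; rewrite mem_undup.
rewrite big1 // => lam _; case: (eqVneq (lcoef s lam) 0) => [->|h]; first by rewrite mul0r.
by case: H; exists lam.
Qed.

End LaurentLists.

Lemma nonroot_nat (P : {poly int}) : P != 0 -> exists B : nat, P.[B%:Z] != 0.
Proof.
move=> P0; apply: contrapT => H.
suff: (size [seq Posz i | i <- iota 0 (size P)] < size P)%N by rewrite size_map size_iota ltnn.
apply: max_poly_roots => //; last by rewrite map_inj_uniq ?iota_uniq // => i j [].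
apply/allP => _ /mapP[B _ ->]; apply/rootP/eqP; apply: contrapT => h; case: H.
by exists B; apply/negP.
Qed.

(** * Density of the good points *)

Section Density.
Variables (F : closedFieldType) (n : nat) (q12 : F).
Hypothesis uncountable : forall f : nat -> F, exists x : F, forall i, f i != x.
Hypothesis q12_neq0 : q12 != 0.

(** Countably many polynomials have countably many roots: root j of polynomial i is listed at the
    code of (i, j), with 0 where nothing is coded. *)
Lemma avoid_roots (P : nat -> {poly F}) : exists x : F, forall i, P i != 0 -> (P i).[x] != 0.
Proof.
pose r i := sval (closed_field_poly_normal (P i)).
pose f N := if @unpickle (nat * nat)%type N is Some (i, j) then (r i)`_j else 0.
have [x fx] := uncountable f; exists x => i Pi; apply/negP => rx.
have xr : x \in r i.
  have /= E := svalP (closed_field_poly_normal (P i)).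
  move: rx; rewrite E hornerZ mulf_eq0 lead_coef_eq0 (negbTE Pi) /=.
  by rewrite -[_ == 0]/(root _ x) root_prod_XsubC.
have := fx (pickle (i, index x (r i))).
by rewrite /f pickleK nth_index ?eqxx.
Qed.

(** Kronecker substitution: on [curve], where $t_i=x^{B^i}$, a monomial becomes a power of x with
    this exponent, and a Laurent polynomial becomes one in a single variable. *)
Definition weight (B : nat) (lam : {ffun 'I_n -> int}) : int := \sum_(i < n) (B%:Z ^+ i) * lam i.
Definition curve (B : nat) (x : F) : nat -> F := fun i => x ^+ (B ^ i)%N.

Lemma mono_curve B x lam : x != 0 -> mono lam (curve B x) = x ^ (weight B lam).
Proof.
move=> x0; rewrite /mono /weight (big_morph (fun z => x ^ z) (fun a b => expfzDr a b x0) (expr0z x)).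
by apply: eq_bigr => i _; rewrite /curve exprnP -exprz_exp -[(B ^ i)%N : int]/(B ^ i)%:Z -natz natrX natz.
Qed.

(** Distinct exponents have equal weights only if B is a root of the nonzero integer polynomial
    $\sum_i(\lambda_i-\mu_i)X^i$, and finitely many pairs exclude finitely many B. *)
Lemma weight_inj (u : seq {ffun 'I_n -> int}) :
  exists B : nat, (1 < B)%N /\ {in u &, injective (weight B)}.
Proof.
pose dp (lam mu : {ffun 'I_n -> int}) : {poly int} := \sum_(i < n) (lam i - mu i) *: 'X^i.
have dpE lam mu B : (dp lam mu).[B%:Z] = weight B lam - weight B mu.
  rewrite /dp horner_sum /weight -sumrB; apply: eq_bigr => i _.
  by rewrite hornerZ hornerXn -mulrBr mulrC.
have dp0 lam mu : lam != mu -> dp lam mu != 0.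
  apply: contra => /eqP d0; apply/eqP/ffunP => i.
  have := congr1 (fun p : {poly int} => p`_i) d0; rewrite /dp coef_sum coef0 (bigD1 i) //=.
  rewrite big1 => [|j ji]; first by rewrite coefZ coefXn eqxx mulr1 addr0 => /subr0_eq.
  by rewrite coefZ coefXn eq_sym (inj_eq val_inj) (negbTE ji) mulr0.
(* The factors X and X - 1 exclude B = 0 and B = 1, where the powers of B are not distinct. *)
pose P := 'X * ('X - 1) * \prod_(lam <- u) \prod_(mu <- u | lam != mu) dp lam mu.
have : P != 0.
  rewrite !mulf_neq0 ?polyX_eq0 //; first by rewrite -polyC1 polyXsubC_eq0.
  rewrite prodf_seq_neq0; apply/allP => lam _ /=; rewrite prodf_seq_neq0.
  by apply/allP => mu _; apply/implyP; apply: dp0.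
case/nonroot_nat => B; rewrite /P !hornerM !mulf_eq0 !negb_or -andbA => /and3P[B0 B1 HB].
exists B; split.
  by move: B0 B1; rewrite hornerX hornerD hornerN hornerX hornerC; case: (B) => [|[]].
move=> lam mu lu mu_u e; apply/eqP; apply: contraT => lm; case/negP: HB.
rewrite horner_prod; apply/eqP; rewrite (big_rem lam) //= horner_prod (big_rem mu) //= lm.
by rewrite dpE e subrr !mul0r.
Qed.

(** The 2n numbers $t_i^{\pm1}$ are powers of x with distinct exponents $\pm B^i$, so they are
    separated modulo q as soon as no positive power of x is a power of q. *)
Lemma good_curve B x : (1 < B)%N -> x != 0 ->
  (forall (c : nat) (z : int), (0 < c)%N -> x ^+ c != (q q12) ^ z) -> good_pt n q12 (curve B x).
Proof.
move=> B1 x0 xq; have xq' (c z : int) : c != 0 -> x ^ c != (q q12) ^ z.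
  case: c => [c|c] c0; first by rewrite -exprnP xq //; case: c c0.
  rewrite NegzE -invr_expz -exprnP; apply: contra (xq c.+1 (- z) isT) => /eqP e.
  by rewrite -invr_expz -e invrK.
split=> [i _|[i e] [j f] /= i_n j_n ij z]; first by rewrite expf_neq0.
pose ex (i : nat) (e : bool) : int := if e then - (B ^ i)%:Z else (B ^ i)%:Z.
have pmE i' e' : coord_pm (curve B x) (i', e') = x ^ ex i' e'.
  by case: e'; rewrite /coord_pm /curve /ex /= -?invr_expz -exprnP.
rewrite !pmE; apply/eqP => E; have H := xq' (ex i e - ex j f) z.
have [h|/H /negP[]] := eqVneq (ex i e - ex j f) 0; last first.
  by rewrite expfzDr // E mulrAC -invr_expz mulfV ?mul1r // expfz_neq0.
case/negP: ij; have Bi := expn_gt0 B i; have Bj := expn_gt0 B j.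
have E2 : e = f /\ (B ^ i = B ^ j)%N by move: h Bi Bj; rewrite /ex; case: (e); case: (f); lia.
case: E2 => -> /eqP; rewrite eqn_exp2l // => /eqP ->; exact: eqxx.
Qed.

Lemma good_dense (ss : seq (lpoly F n)) : (forall s, s \in ss -> lnz s) ->
  exists t, good_pt n q12 t /\ forall s, s \in ss -> lev s t != 0.
Proof.
move=> ssnz; have q0 : q q12 != 0 by rewrite expf_neq0.
have [B [B1 Binj]] := weight_inj (flatten (map (map fst) ss)).
pose u (s : lpoly F n) := undup (map fst s).
(* A shift that makes all exponents nonnegative. *)
pose K (s : lpoly F n) : int := \sum_(lam <- u s) `|weight B lam|.
have Kge s lam : lam \in u s -> 0 <= weight B lam + K s.
  move=> lu; rewrite /K (big_rem lam) //= addrA.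
  apply: addr_ge0; last by apply: sumr_ge0.
  by rewrite -lerBlDl sub0r -normrN ler_norm.
pose pl s : {poly F} := \sum_(lam <- u s) lcoef s lam *: 'X^(absz (weight B lam + K s)%R).
(* One countable family collects the requirements on x: the given polynomials on the curve,
   $x^{c+1}\ne q^z$ for goodness, and x nonzero. *)
pose fam N : {poly F} := match @unpickle (option (nat + (nat * int)))%type N with
   | Some (Some (inl i)) => pl (nth [::] ss i)
   | Some (Some (inr (c, z))) => 'X^(c.+1) - ((q q12) ^ z)%:P
   | _ => 'X end.
have [x xP] := avoid_roots fam.
have x0 : x != 0.
  by have := xP (pickle (None : option (nat + (nat * int))%type)); rewrite /fam pickleK hornerX polyX_eq0; apply.
have xq (c : nat) (z : int) : (0 < c)%N -> x ^+ c != (q q12) ^ z.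
  case: c => // c _; have := xP (pickle (Some (inr (c, z)) : option (nat + (nat * int))%type)).
  rewrite /fam pickleK monic_neq0 ?monicXnsubC // => /(_ isT).
  by rewrite !hornerE subr_eq0.
exists (curve B x); split; first exact: good_curve.
move=> s sin; have := xP (pickle (Some (inl (index s ss)) : option (nat + (nat * int))%type)).
rewrite /fam pickleK nth_index //.
have plE : (pl s).[x] = x ^ (K s) * lev s (curve B x).
  rewrite (@lev_lcoef _ _ s (u s)) ?undup_uniq //; last by move=> y; rewrite mem_undup.
  rewrite horner_sum mulr_sumr big_seq [RHS]big_seq; apply: eq_bigr => lam lu.
  rewrite hornerZ hornerXn mulrCA mono_curve // -expfzDr // exprnP gez0_abs ?Kge //.
  by rewrite addrC.
have -> : pl s != 0.
  have [lam l0] := ssnz s sin.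
  have us mu : mu \in u s -> mu \in flatten (map (map fst) ss).
    rewrite mem_undup => ms; apply/flattenP; exists (map fst s) => //; exact: map_f.
  have lu : lam \in u s.
    by rewrite mem_undup; apply: contraR l0 => /lcoef_out ->.
  apply: contra l0 => /eqP pl0; have := congr1 (fun p : {poly F} => p`_(absz (weight B lam + K s)%R)) pl0.
  rewrite /= coef0 coef_sum (bigD1_seq lam) ?undup_uniq //= coefZ coefXn eqxx mulr1.
  rewrite big_seq_cond big1 ?addr0 => [->//|mu /andP[mu_u mu_lam]].
  rewrite coefZ coefXn; case: eqP => [e|_]; last by rewrite mulr0.
  case/eqP: mu_lam; apply: Binj; rewrite ?us //.
  have := congr1 Posz e; rewrite !gez0_abs ?Kge //.
  by move/addIr.
by move/(_ isT); rewrite plE mulf_eq0 negb_or => /andP[].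
Qed.

Lemma lev_good_eq0 (s : lpoly F n) : (forall t, good_pt n q12 t -> lev s t = 0) ->
  forall lam, lcoef s lam = 0.
Proof.
move=> s0 lam; apply/eqP; apply: contraT => l0.
have [t [gt /(_ s)]] : exists t, good_pt n q12 t /\ forall s', s' \in [:: s] -> lev s' t != 0.
  by apply: good_dense => s'; rewrite inE => /eqP ->; exists lam.
by rewrite inE eqxx s0 // eqxx => /(_ isT).
Qed.

End Density.

(** * Triangularity of the Y operators *)

Section Exponents.
Variable n : nat.
Local Notation vec := {ffun 'I_n -> int}.

Definition dot (a b : vec) : int := \sum_(i < n) a i * b i.
Definition addz (nu : vec) (z : int) (d : vec) : vec := [ffun i => nu i + z * d i].

Lemma dotC a b : dot a b = dot b a.
Proof. by apply: eq_bigr => i _; rewrite mulrC. Qed.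

Lemma dot_addz a nu z d : dot a (addz nu z d) = dot a nu + z * dot a d.
Proof.
by rewrite /dot mulr_sumr -big_split; apply: eq_bigr => i _; rewrite ffunE /=; ring.
Qed.

Lemma dot_addzl a nu z d : dot (addz nu z d) a = dot nu a + z * dot d a.
Proof. by rewrite dotC dot_addz !(dotC a). Qed.

Lemma dot_ge0 a : 0 <= dot a a.
Proof. by apply: sumr_ge0 => i _; rewrite -expr2 sqr_ge0. Qed.

Lemma dot_bound a b : `|2 * dot a b| <= dot a a + dot b b.
Proof.
have : 0 <= dot (addz a 1 b) (addz a 1 b) by exact: dot_ge0.
have : 0 <= dot (addz a (-1) b) (addz a (-1) b) by exact: dot_ge0.
rewrite !dot_addz !dot_addzl (dotC b a); lia.
Qed.

(* Lexicographic in (|mu|^2, -a.mu), packed in one nonnegative integer. *)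
Definition level (a mu : vec) : int :=
  2 * dot mu mu ^+ 2 + 2 * dot a a * dot mu mu - 2 * dot a mu.

Lemma level_ge0 a mu : 0 <= level a mu.
Proof.
have := dot_bound a mu; have := dot_ge0 a; have := dot_ge0 mu.
have H : dot mu mu = 0 -> dot a mu = 0.
  move=> m0; rewrite /dot big1 // => i _; suff -> : mu i = 0 by rewrite mulr0.
  apply/eqP; rewrite -sqrf_eq0 eq_le sqr_ge0 andbT -m0 /dot (bigD1 i) //= expr2 lerDl.
  by apply: sumr_ge0 => j _; rewrite -expr2 sqr_ge0.
rewrite /level expr2; move: (dot a a) (dot mu mu) (dot a mu) H => D N d H N0 D0.
have [E|Nn] := eqVneq N 0; first by rewrite (H E) E; lia.
move=> B; have N1 : 1 <= N by lia.
have := mulr_ge0 D0 (_ : 0 <= N - 1); have := mulr_ge0 N0 (_ : 0 <= N - 1); lia.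
Qed.

(** A step in the squared norm outweighs the linear term: from N to M the first two terms grow by
    2(M - N)(M + N + D), more than the 2D + N + M that [dot_bound] allows for the others. *)
Lemma level_norm a b mu nu : dot a a = dot b b -> dot mu mu < dot nu nu -> level a mu < level b nu.
Proof.
move=> ab lt; have := dot_bound a mu; have := dot_bound b nu; have := dot_ge0 b.
have := dot_ge0 mu; rewrite /level ab !expr2.
move: (dot b b) (dot mu mu) (dot nu nu) (dot a mu) (dot b nu) lt => D N M x y lt N0 D0.
have [e E] : exists e, M = N + 1 + e by exists (M - N - 1); ring.
subst M => *; have e0 : 0 <= e by lia.
have := mulr_ge0 D0 e0; have := mulr_ge0 N0 e0; have := mulr_ge0 e0 e0; lia.
Qed.

Variables (F : fieldType).
Lemma mono_addz nu z d (t : nat -> F) : torus n t ->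
  mono (addz nu z d) t = mono nu t * mono d t ^ z.
Proof.
move=> tt; rewrite /mono (big_morph (fun x => x ^ z) (fun a b => expfzMl a b z) (exp1rz _ z)).
rewrite -big_split; apply: eq_bigr => i _ /=.
by rewrite ffunE expfzDr ?tt // exprz_exp [d i * z]mulrC.
Qed.

End Exponents.

(** The divided difference of a power as a Laurent polynomial; the sign of l decides which geometric
    sum occurs. *)
Lemma geometric_int (F : fieldType) (z : F) (l : int) : z != 0 -> 1 - z != 0 ->
  (1 - z ^ (- l)) / (1 - z) =
  if l <= 0 then \sum_(i < `|l|) z ^+ i else - \sum_(i < `|l|) z ^ (i%:Z - l).
Proof.
move=> z0 z1; have geo (m : nat) : (1 - z ^+ m) / (1 - z) = \sum_(i < m) z ^+ i.
  by rewrite -[1 - z ^+ m]opprB subrX1 -mulNr opprB mulrAC mulfV // mul1r.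
case: (lerP l 0) => l0.
  by rewrite -geo exprnP; congr ((1 - z ^ _) / _); lia.
case: l l0 => // m l0.
under eq_bigr => i _ do rewrite expfzDr //.
rewrite -mulr_suml -geo -invr_expz -!exprnP /=.
by field; rewrite z1 expf_neq0.
Qed.

Section LetterData.
Variables (F : fieldType) (n : nat) (q12 k0 k kn u0 un : F).
Hypothesis n_ge2 : (2 <= n)%N.
Local Notation vec := {ffun 'I_n -> int}.
Local Notation sj := (sj n q12).
Local Notation kap := (kap n k0 k kn).
Local Notation ctilde := (ctilde n q12 k0 k kn u0 un).
Local Notation gpt := (gpt n q12).

Definition uvec (a : nat) : vec := [ffun i : 'I_n => ((i : nat) == a)%:Z].

(* The reflection s_j is t_i |-> t_i y^(-m delta_i), where delta = [ldir j], m = [lmul j]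
   and y = [lvar j t]: all generators are treated at once in terms of these data. *)
Definition ldir (j : nat) : vec :=
  if j == 0%N then addz 0 (-1) (uvec 0)
  else if j == n then uvec n.-1 else addz (uvec j.-1) (-1) (uvec j).
Definition lmul (j : nat) : nat := if (j == 0%N) || (j == n) then 2 else 1.
Definition lscal (j : nat) : F := if j == 0%N then q12 else 1.
Definition lvar (j : nat) (t : nat -> F) : F :=
  if j == 0%N then q12 / t 0%N else if j == n then t n.-1 else t j.-1 / t j.
Definition lA (j : nat) : F := (kap j)^-1 - kap j.
Definition lB (j : nat) : F :=
  if j == 0%N then u0^-1 - u0 else if j == n then un^-1 - un else 0.
Definition pairing (j : nat) (nu : vec) : int := dot (ldir j) nu.
(** Exponents see the linear part of $s_j$. For j = 0 this negates the first entry, and the power of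
    q is recorded by [lscal]. *)
Definition iact (j : nat) (nu : vec) : vec := addz nu (- ((lmul j)%:Z * pairing j nu)) (ldir j).

Lemma mono_uvec a (t : nat -> F) : (a < n)%N -> mono (uvec a) t = t a.
Proof.
move=> an; rewrite /mono (bigD1 (Ordinal an)) //= ffunE eqxx expr1z big1 ?mulr1 // => i ia.
by rewrite ffunE (_ : (i : nat) == a = false) ?expr0z //; apply: negbTE.
Qed.

Lemma dot_uvec a nu : (a < n)%N -> dot (uvec a) nu = at_nat nu a.
Proof.
move=> an; rewrite /dot /at_nat [RHS]big_mkcond; apply: eq_bigr => i _.
by rewrite ffunE; case: eqP; rewrite ?mul1r ?mul0r.
Qed.

Lemma at_nat_uvec a b : (b < n)%N -> at_nat (uvec a) b = (b == a)%:Z.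
Proof.
move=> bn; rewrite /at_nat (bigD1 (Ordinal bn)) //= big1 ?ffunE ?addr0 // => i.
by case/andP => /eqP ib /eqP; case; apply: val_inj.
Qed.

Lemma dot0v nu : dot (0 : vec) nu = 0.
Proof. by rewrite /dot big1 // => i _; rewrite ffunE mul0r. Qed.

Lemma mono0 (t : nat -> F) : mono (0 : vec) t = 1.
Proof. by rewrite /mono big1 // => i _; rewrite ffunE expr0z. Qed.

Lemma letter_cases (P : nat -> Prop) : P 0%N -> P n -> (forall j, (0 < j < n)%N -> P j) ->
  forall j, (j <= n)%N -> P j.
Proof.
move=> P0 Pn Pm j jn; have [->//|j0] := eqVneq j 0%N; have [->//|j1] := eqVneq j n.
by apply: Pm; lia.
Qed.

Let n0 : (n == 0)%N = false. Proof. lia. Qed.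
Let mid j : (0 < j < n)%N -> ((j == 0)%N = false) * ((j == n) = false).
Proof. by move=> jn; split; lia. Qed.

Lemma ldir_sq j : (j <= n)%N -> (lmul j)%:Z * dot (ldir j) (ldir j) = 2.
Proof.
elim/letter_cases => [||{}j jm]; rewrite /ldir /lmul ?eqxx ?n0 ?(mid jm) ?orbT /=.
- rewrite !dot_addz !dot_addzl dotC !dot0v dot_uvec ?at_nat_uvec //; lia.
- rewrite dot_uvec ?at_nat_uvec ?eqxx //; lia.
- rewrite !dot_addz !dot_addzl !dot_uvec ?at_nat_uvec; lia.
Qed.

Lemma dot_iact j (a b : vec) : (j <= n)%N -> dot (iact j a) (iact j b) = dot a b.
Proof.
move=> jn; rewrite /iact !dot_addz !dot_addzl [dot a (ldir j)]dotC -/(pairing j a) -/(pairing j b).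
have := ldir_sq jn.
by rewrite /lmul; case: ifP => _; move: (dot (ldir j) _) => D; nia.
Qed.

Lemma level_iact j (a b : vec) : (j <= n)%N -> level (iact j a) (iact j b) = level a b.
Proof. by move=> jn; rewrite /level !dot_iact. Qed.

(** Reflecting a changes the linear term alone, which adds to the level twice [lmul] times the
    product of the two pairings. *)
Lemma level_behind j (a b : vec) : (j <= n)%N -> pairing j a * pairing j b < 0 ->
  level (iact j a) b < level a b.
Proof.
move=> jn ab; rewrite /level dot_iact // /iact dot_addzl -/(pairing j b).
by rewrite /lmul; case: ifP => _; lia.
Qed.

Hypothesis q12_neq0 : q12 != 0.

Lemma lvarE j t : (j <= n)%N -> torus n t -> lvar j t = lscal j * mono (ldir j) t.
Proof.
move=> + tt; elim/letter_cases => [||{}j jm]; rewrite /ldir /lvar /lscal ?eqxx ?n0 ?(mid jm) /=.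
- by rewrite mono_addz // mono0 mul1r mono_uvec ?exprN1 //; lia.
- by rewrite mul1r mono_uvec //; lia.
- by rewrite mono_addz // !mono_uvec ?exprN1 ?mul1r //; lia.
Qed.

Lemma sj_coord j t (i : 'I_n) : (j <= n)%N -> torus n t ->
  sj j t i = t i * lvar j t ^ (- ((lmul j)%:Z * ldir j i)).
Proof.
move=> + tt; elim/letter_cases => [||{}j jm]; rewrite /ldir /lvar /lmul ?eqxx ?n0 ?(mid jm) ?orbT /=.
- rewrite !ffunE; case: (eqVneq (i : nat) 0%N) => [->|i0].
    rewrite sj0_0 // (_ : - _ = Posz 2) // -exprnP /q; field; rewrite tt //; lia.
  by rewrite sj0_out // expr0z mulr1.
- rewrite ffunE; case: (eqVneq (i : nat) n.-1) => [->|i0].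
    rewrite sjn_last // mulr1 -invr_expz -exprnP; field; rewrite tt //; lia.
  by rewrite sjn_out // expr0z mulr1.
- have [t1 t2] : t j.-1 != 0 /\ t j != 0 by split; apply: tt; lia.
  rewrite !ffunE mul1r; case: (eqVneq (i : nat) j.-1) => [->|i0].
    rewrite sjm_l // (_ : j.-1 == j = false); last lia.
    by rewrite mulr0 addr0 exprN1 invf_div mulrC divfK.
  case: (eqVneq (i : nat) j) => [->|i1]; last by rewrite sjm_out // expr0z mulr1.
  by rewrite sjm_r // expr1z mulrC divfK.
Qed.

Lemma lvar_neq0 j (p : gpt) : (j <= n)%N -> lvar j (pt p) != 0.
Proof.
elim/letter_cases => [||{}j jm]; rewrite /lvar ?eqxx ?n0 ?(mid jm);
  by rewrite ?mulf_neq0 ?invr_eq0 ?(pt_neq0 p) //; lia.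
Qed.

Lemma lvar_neq1 j (p : gpt) : (j <= n)%N -> 1 - lvar j (pt p) ^+ lmul j != 0.
Proof.
elim/letter_cases => [||{}j jm]; rewrite /lvar /lmul ?eqxx ?n0 ?(mid jm) ?orbT /=.
- by apply: pt_sqr_neqq; lia.
- by apply: pt_sqr_neq1; lia.
- rewrite expr1 subr_eq0 eq_sym; have t2 : pt p j != 0 by apply: pt_neq0; lia.
  have : pt p j.-1 != pt p j by apply: pt_inj_coord; lia.
  by apply: contra => /eqP e; rewrite -(divfK t2 (pt p j.-1)) e mul1r.
Qed.

Lemma mono_sj j nu t : (j <= n)%N -> torus n t ->
  mono nu (sj j t) = mono nu t * lvar j t ^ (- ((lmul j)%:Z * pairing j nu)).
Proof.
move=> jn tt; have y0 : lvar j t != 0.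
  by elim/letter_cases: j / jn => [||j jm]; rewrite /lvar ?eqxx ?n0 ?(mid jm);
    rewrite ?mulf_neq0 ?invr_eq0 ?tt //; lia.
rewrite /mono /pairing /dot mulr_sumr -sumrN.
rewrite (big_morph _ (fun a b => expfzDr a b y0) (expr0z _)) -big_split.
apply: eq_bigr => i _ /=; rewrite sj_coord // expfzMl exprz_exp; congr (_ * _ ^ _); ring.
Qed.

Hypotheses (k0_neq0 : k0 != 0) (k_neq0 : k != 0) (kn_neq0 : kn != 0).
Hypotheses (u0_neq0 : u0 != 0) (un_neq0 : un != 0).

Lemma ctildeE j (p : gpt) : (j <= n)%N -> ctilde j (pt p) =
  (kap j)^-1 - (lA j + lB j * lvar j (pt p)) / (1 - lvar j (pt p) ^+ lmul j).
Proof.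
elim/letter_cases => [||{}j jm].
- by rewrite ctilde0 // /lA /lB /lvar /lmul.
- by rewrite ctilden // /lA /lB /lvar /lmul /Defs.kap !eqxx !n0.
- by rewrite ctildem // /lA /lB /lvar /lmul /Defs.kap !(mid jm) /= mul0r addr0 expr1.
Qed.

End LetterData.

Section Triangularity.
Variables (F : fieldType) (n : nat) (q12 k0 k kn u0 un : F).
Hypothesis n_ge2 : (2 <= n)%N.
Hypothesis q12_neq0 : q12 != 0.
Local Notation vec := {ffun 'I_n -> int}.
Local Notation kap := (kap n k0 k kn).
Local Notation gpt := (gpt n q12).
Local Notation X := (gpt -> F^o).
Local Notation TX := (@TX F n q12 k0 k kn u0 un n_ge2 q12_neq0).
Local Notation lA := (lA n k0 k kn).
Local Notation lB := (lB n u0 un).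
Local Notation lscal := (lscal q12).

Definition mX (nu : vec) : X := fun p => mono nu (pt p).
Definition levX (s : lpoly F n) : X := fun p => lev s (pt p).

Lemma lev_cat (s s' : lpoly F n) t : lev (s ++ s') t = lev s t + lev s' t.
Proof. by rewrite /lev big_cat. Qed.

Lemma lev_scale a (s : lpoly F n) t : lev [seq (p.1, a * p.2) | p <- s] t = a * lev s t.
Proof.
by rewrite /lev big_map mulr_sumr; apply: eq_bigr => p _ /=; rewrite mulrA.
Qed.

Lemma levX_cat s s' : levX (s ++ s') = levX s + levX s'.
Proof. by apply: funext => p; rewrite /levX lev_cat. Qed.

Lemma levX_scale a s : levX [seq (p.1, a * p.2) | p <- s] = a *: levX s.
Proof. by apply: funext => p; rewrite /levX lev_scale. Qed.

Lemma levX_cons p s : levX (p :: s) = p.2 *: mX p.1 + levX s.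
Proof. by apply: funext => x; rewrite /levX /lev big_cons. Qed.

Lemma levX_nil : levX [::] = 0.
Proof. by apply: funext => x; rewrite /levX /lev big_nil. Qed.

Definition lowX (a : vec) (M : int) (f : X) : Prop :=
  exists s : lpoly F n, f = levX s /\ forall p, p \in s -> level a p.1 < M.

Lemma lowX0 a M : lowX a M 0.
Proof. by exists [::]; rewrite levX_nil. Qed.

Lemma lowXD a M f g : lowX a M f -> lowX a M g -> lowX a M (f + g).
Proof.
move=> [s [-> sM]] [s' [-> sM']]; exists (s ++ s'); rewrite levX_cat; split=> // p.
by rewrite mem_cat => /orP[/sM|/sM'].
Qed.

Lemma lowXZ a M c f : lowX a M f -> lowX a M (c *: f).
Proof.
move=> [s [-> sM]]; exists [seq (p.1, c * p.2) | p <- s]; rewrite levX_scale; split=> // p.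
by case/mapP => p' /sM ? ->.
Qed.

Lemma lowX_sum a M m (f : 'I_m -> X) : (forall i, lowX a M (f i)) -> lowX a M (\sum_i f i).
Proof.
by move=> fl; elim/big_ind: _ => // [|f' g]; [exact: lowX0 | exact: lowXD].
Qed.

Lemma lowX_mX a M mu : level a mu < M -> lowX a M (mX mu).
Proof.
move=> muM; exists [:: (mu, 1)]; split; first by rewrite levX_cons levX_nil scale1r addr0.
by move=> p; rewrite inE => /eqP ->.
Qed.

Lemma lowX_le a M M' f : M <= M' -> lowX a M f -> lowX a M' f.
Proof.
by move=> MM [s [-> sM]]; exists s; split=> // p /sM h; apply: lt_le_trans MM.
Qed.

Lemma mX_shift j w nu p : (j <= n)%N ->
  lvar n q12 j (pt p) ^ w * mX nu p = lscal j ^ w * mX (addz nu w (ldir n j)) p.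
Proof.
move=> jn; rewrite /mX mono_addz; last exact: pt_torus.
rewrite (lvarE n_ge2 q12_neq0 jn); last exact: pt_torus.
by rewrite expfzMl -mulrA (mulrC (mono nu _)).
Qed.

Lemma lmul_cases j : (lmul n j = 1 /\ lB j = 0) \/ lmul n j = 2.
Proof.
rewrite /lmul /lB; case: eqP => _; first by right.
by case: eqP => _; [right | left].
Qed.

(** The hypothesis puts w strictly between 0 and the value that gives the reflection of nu: inner
    points of a chord of a sphere are shorter than its ends. *)
Lemma interior_norm j w nu : (j <= n)%N ->
  w * ((lmul n j)%:Z * pairing j nu + w) < 0 ->
  dot (addz nu w (ldir n j)) (addz nu w (ldir n j)) < dot nu nu.
Proof.
move=> jn; have := ldir_sq n_ge2 jn.
rewrite !dot_addz !dot_addzl [dot nu (ldir n j)]dotC -/(pairing j nu).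
by case: (lmul_cases j) => [[-> _]|->]; move: (dot (ldir n j) _) (pairing j nu) => D l; nia.
Qed.

(** The coefficient of $s_j\nu$ in $T_j^{\pm1}t^\nu$. If $s_j$ fixes nu, $T_j$ acts by [kap^-1] and
    its inverse by [kap], hence the weak inequality for inverse letters. *)
Definition ldiag (p : nat * bool) (nu : vec) : F :=
  let l := pairing p.1 nu in
  lscal p.1 ^ (- ((lmul n p.1)%:Z * l)) *
  (if (if p.2 then 0 <= l else 0 < l) then kap p.1 else (kap p.1)^-1).

Hypotheses (k0_neq0 : k0 != 0) (k_neq0 : k != 0) (kn_neq0 : kn != 0).
Hypotheses (u0_neq0 : u0 != 0) (un_neq0 : un != 0).

Lemma kap_neq0 j : kap j != 0.
Proof. by rewrite /Defs.kap; case: ifP => // _; case: ifP. Qed.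

Lemma TX_mX_point j nu p : (j <= n)%N ->
  let y := lvar n q12 j (pt p) in let l := pairing j nu in
  TX j (mX nu) p = (kap j)^-1 * (y ^ (- ((lmul n j)%:Z * l)) * mX nu p) +
   (lA j + lB j * y) * (if l <= 0 then \sum_(i < `|l|) y ^ ((lmul n j)%:Z * i%:Z) * mX nu p
     else - \sum_(i < `|l|) y ^ ((lmul n j)%:Z * (i%:Z - l)) * mX nu p).
Proof.
move=> jn y l; have y0 : y != 0 by apply: lvar_neq0.
have y1 : 1 - y ^+ lmul n j != 0 by apply: lvar_neq1.
have ym0 : y ^+ lmul n j != 0 by rewrite expf_neq0.
have yE (z : int) : (y ^+ lmul n j) ^ z = y ^ ((lmul n j)%:Z * z) by rewrite exprnP exprz_exp.
have -> : (if l <= 0 then \sum_(i < `|l|) y ^ ((lmul n j)%:Z * i%:Z) * mX nu p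
     else - \sum_(i < `|l|) y ^ ((lmul n j)%:Z * (i%:Z - l)) * mX nu p) =
    (1 - y ^ (- ((lmul n j)%:Z * l))) / (1 - y ^+ lmul n j) * mX nu p.
  have := geometric_int l ym0 y1; rewrite yE mulrN => ->.
  case: ifP => _; rewrite ?mulNr mulr_suml; [|congr (- _)]; apply: eq_bigr => i _.
    by rewrite -yE exprnP.
  by rewrite -yE.
rewrite /TX /reflop ctildeE // {2 3}/mX pt_sG // mono_sj //; last exact: pt_torus.
rewrite -/y -/l -/(mX nu p); by field; rewrite y1 kap_neq0.
Qed.
Let scaleXE (c : F) (f : X) p : (c *: f) p = c * f p. Proof. by []. Qed.

Let addXE (f g : X) p : (f + g) p = f p + g p. Proof. by []. Qed.
Let oppXE (f : X) p : (- f) p = - f p. Proof. by []. Qed.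

Let shiftX j nu w : X := lscal j ^ w *: mX (addz nu w (ldir n j)).

Let shiftXE j nu w p : (j <= n)%N ->
  shiftX j nu w p = lvar n q12 j (pt p) ^ w * mX nu p.
Proof. by move=> jn; rewrite mX_shift. Qed.

Let shiftX_low j nu w c a b : (j <= n)%N -> dot b b = dot a a ->
  (c != 0 -> w * ((lmul n j)%:Z * pairing j nu + w) < 0) ->
  lowX b (level a nu) (c *: shiftX j nu w).
Proof.
move=> jn ab wi; have [->|c0] := eqVneq c 0; first by rewrite scale0r; apply: lowX0.
by do 2!apply: lowXZ; apply/lowX_mX/level_norm => //; apply: interior_norm (wi c0).
Qed.

Let below1 (m L i : nat) (l : int) : (0 < m)%N -> l <= 0 -> `|l|%N = L.+1 -> (i < L)%N ->
  m%:Z * i.+1%:Z * (m%:Z * l + m%:Z * i.+1%:Z) < 0.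
Proof.
move=> m0 l0 E iL; rewrite -mulrDr pmulr_rlt0 ?pmulr_rlt0 ?mulr_gt0 //; lia.
Qed.
Let below2 (L i : nat) (l : int) : l <= 0 -> `|l|%N = L.+1 -> (i < L.+1)%N ->
  (2%:Z * i%:Z + 1) * (2%:Z * l + (2%:Z * i%:Z + 1)) < 0.
Proof.
move=> l0 E iL; rewrite pmulr_rlt0; lia.
Qed.
Let above1 (m L i : nat) (l : int) : (0 < m)%N -> 0 < l -> `|l|%N = L.+1 -> (i < L)%N ->
  m%:Z * (i.+1%:Z - l) * (m%:Z * l + m%:Z * (i.+1%:Z - l)) < 0.
Proof.
move=> m0 l0 E iL; rewrite -mulrDr nmulr_rlt0 ?pmulr_rgt0 ?pmulr_rlt0 //; lia.
Qed.
Let above2 (L i : nat) (l : int) : 0 < l -> `|l|%N = L.+1 -> (i < L.+1)%N ->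
  (2%:Z * (i%:Z - l) + 1) * (2%:Z * l + (2%:Z * (i%:Z - l) + 1)) < 0.
Proof.
move=> l0 E iL; rewrite nmulr_rlt0; lia.
Qed.

(** The exponents of the divided difference run along the segment from nu to $s_j\nu$. The
    contributions of its two ends are displayed; everything in between is shorter, hence lower for
    any two directions of equal norm. *)
Lemma TX_mX j nu : (j <= n)%N -> exists r : X,
  TX j (mX nu) = ldiag (j, false) nu *: mX (iact j nu) +
     (if pairing j nu < 0 then lA j else 0) *: mX nu + r /\
  forall a b, dot b b = dot a a -> lowX b (level a nu) r.
Proof.
move=> jn; set l := pairing j nu; set m := lmul n j.
have m_cases : (m = 1 /\ lB j = 0) \/ m = 2 by apply: lmul_cases.
have mainE c : (lscal j ^ (- (m%:Z * l)) * c) *: mX (iact j nu) = c *: shiftX j nu (- (m%:Z * l)).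
  by rewrite /shiftX scalerA mulrC.
rewrite /ldiag /= -/l -/m mainE.
case: (lerP l 0) => l0.
  case E : `|l|%N => [|L].
    have E0 : l = 0 by lia.
    exists 0; split=> [|*]; last exact: lowX0.
    apply: funext => p; rewrite TX_mX_point // -/l -/m !E0 !lexx big_ord0 mulr0 addr0.
    by rewrite -[RHS]/(_ * _ + 0 * _) shiftXE // mulr0 mul0r.
  have -> : l < 0 by lia.
  exists (\sum_(i < L) lA j *: shiftX j nu (m%:Z * i.+1%:Z) +
          \sum_(i < L.+1) lB j *: shiftX j nu (m%:Z * i%:Z + 1)); split.
    apply: funext => p; rewrite TX_mX_point // -/l -/m E l0.
    rewrite !(addXE, oppXE, scaleXE) !fct_sumE mulrDl [in lA j * _]big_ord_recl mulr0 expr0z mul1r mulrDr.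
    rewrite [lA j * \sum_i _]mulr_sumr [lB j * _ * \sum_i _]mulr_sumr !addrA.
    congr (_ + _ + _ + _).
    + by rewrite shiftXE.
    + by apply: eq_bigr => i _; rewrite scaleXE shiftXE.
    + apply: eq_bigr => i _; rewrite scaleXE shiftXE // expfzDr ?expr1z; first by ring.
      exact: lvar_neq0.
  move=> a b ab; apply: lowXD; apply: lowX_sum => i; have iL := ltn_ord i;
    apply: shiftX_low => //; rewrite -/m -/l.
    by move=> _; apply: below1 l0 E iL; case: m_cases => [[-> _]|->].
  by move=> B0; case: m_cases B0 => [[_ ->]|->]; rewrite ?eqxx // => _; apply: below2 l0 E iL.
have -> : (l < 0) = false by lia.
case E : `|l|%N => [|L]; first by lia.
exists (- (\sum_(i < L) lA j *: shiftX j nu (m%:Z * (i.+1%:Z - l)) +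
        \sum_(i < L.+1) lB j *: shiftX j nu (m%:Z * (i%:Z - l) + 1))); split.
  apply: funext => p; rewrite TX_mX_point // -/l -/m E leNgt l0 /=.
  rewrite !(addXE, oppXE, scaleXE) !fct_sumE mulrN mulrDl [in lA j * _]big_ord_recl sub0r mulrN.
  rewrite mulrDr mul0r addr0 !opprD !addrA [lA j * \sum_i _]mulr_sumr [lB j * _ * \sum_i _]mulr_sumr.
  congr (_ - _ - _).
  (* For l > 0 one end of the sum is $s_j\nu$ itself and turns [kap^-1] into [kap^-1 - lA = kap]. *)
  + by rewrite shiftXE // -mulrBl /lA subKr.
  + by apply: eq_bigr => i _; rewrite scaleXE shiftXE.
  + apply: eq_bigr => i _; rewrite scaleXE shiftXE // expfzDr ?expr1z; first by ring.
    exact: lvar_neq0.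
move=> a b ab; rewrite -scaleN1r; apply: lowXZ.
apply: lowXD; apply: lowX_sum => i; have iL := ltn_ord i;
  apply: shiftX_low => //; rewrite -/m -/l.
  by move=> _; apply: above1 l0 E iL; case: m_cases => [[-> _]|->].
by move=> B0; case: m_cases B0 => [[_ ->]|->]; rewrite ?eqxx // => _; apply: above2 l0 E iL.
Qed.

Definition opX (p : nat * bool) (f : X) : X :=
  if p.2 then TX p.1 f - lA p.1 *: f else TX p.1 f.

(* The direction a is chosen so that the term left behind by a letter is of smaller level. *)
Definition letter_ok (p : nat * bool) (a : vec) : bool :=
  (p.1 <= n)%N && (if p.2 then pairing p.1 a < 0 else 0 < pairing p.1 a).

(** $T_j$ leaves nu behind when its pairing is negative, and $T_j^{-1}=T_j-lA$ when it is positive.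
    [letter_ok] puts a on the opposite side in both cases, so [level_behind] disposes of that
    term. *)
Lemma opX_mX p nu a : letter_ok p a -> exists r : X,
  opX p (mX nu) = ldiag p nu *: mX (iact p.1 nu) + r /\ lowX (iact p.1 a) (level a nu) r.
Proof.
case: p => j b /andP[/= jn ok].
have [r [Tr low]] := TX_mX nu jn; have jaa : dot (iact j a) (iact j a) = dot a a by rewrite dot_iact.
have {low} lowr := low _ _ jaa.
case: b ok => ok; rewrite /opX /= Tr; last first.
  exists ((if pairing j nu < 0 then lA j else 0) *: mX nu + r); split; first by rewrite addrA.
  apply: lowXD => //; case: ifP => h; last by rewrite scale0r; apply: lowX0.
  by apply: lowXZ; apply/lowX_mX/level_behind => //; nia.
exists ((if 0 < pairing j nu then - lA j else 0) *: mX nu + r); split; last first.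
  apply: lowXD => //; case: ifP => h; last by rewrite scale0r; apply: lowX0.
  by apply: lowXZ; apply/lowX_mX/level_behind => //; nia.
rewrite addrAC addrA; congr (_ + r).
rewrite /ldiag /=; case: (ltgtP (pairing j nu) 0) => [h|h|h].
- by rewrite addrK scale0r addr0.
- by rewrite scale0r addr0 scaleNr.
- have -> : iact j nu = nu.
    by apply/ffunP => i; rewrite ffunE h mulr0 oppr0 mul0r addr0.
  rewrite h mulr0 oppr0 expr0z !mul1r !scale0r !addr0 -scalerBl; congr (_ *: _).
  by rewrite /lA subKr.
Qed.
End Triangularity.

(** * Exponents and diagonal coefficients along the word of Y_i *)

Section Words.
Variables (F : fieldType) (n : nat) (q12 k0 k kn u0 un : F).
Hypothesis n_ge2 : (2 <= n)%N.
Local Notation vec := {ffun 'I_n -> int}.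
Local Notation ldiag := (@ldiag F n q12 k0 k kn).

Definition wact (w : seq (nat * bool)) (nu : vec) : vec := foldr (fun p => iact p.1) nu w.

(** A word acts from its right end, so a letter meets the vector produced by the letters after
    it. *)
Fixpoint run (P : nat * bool -> vec -> Prop) (w : seq (nat * bool)) (nu : vec) : Prop :=
  if w is p :: w' then run P w' nu /\ P p (wact w' nu) else True.

Fixpoint wdiag (w : seq (nat * bool)) (nu : vec) : F :=
  if w is p :: w' then ldiag p (wact w' nu) * wdiag w' nu else 1.

Lemma wact_cat w w' nu : wact (w ++ w') nu = wact w (wact w' nu).
Proof. exact: foldr_cat. Qed.

Lemma run_cat P w w' nu : run P w (wact w' nu) -> run P w' nu -> run P (w ++ w') nu.
Proof. by elim: w => //= p w IH [/IH h hp] /h; rewrite wact_cat. Qed.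

Lemma wdiag_cat w w' nu : wdiag (w ++ w') nu = wdiag w (wact w' nu) * wdiag w' nu.
Proof. by elim: w => [|p w IH] /=; rewrite ?mul1r // IH wact_cat mulrA. Qed.

Lemma wdiag_const c w nu : run (fun p mu => ldiag p mu = c) w nu -> wdiag w nu = c ^+ size w.
Proof. by elim: w => //= p w IH [/IH -> ->]; rewrite exprS. Qed.

(* [moving r v d] carries v at position r and the entries d elsewhere: the word of Y_i moves
   the entry i to the last position, negates it, moves it to the first position, negates it
   again and moves it back. *)
Definition moving (r : nat) (v : int) (d : nat -> int) : vec :=
  [ffun i : 'I_n => if (i < r)%N then d i else if (i : nat) == r then v else d i.-1].

Lemma at_ffun (g : nat -> int) a : (a < n)%N -> at_nat [ffun i : 'I_n => g i] a = g a.
Proof.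
move=> an; rewrite /at_nat (bigD1 (Ordinal an)) //= big1 ?ffunE ?addr0 // => i.
by case/andP => /eqP ia /eqP []; apply: val_inj.
Qed.

Lemma pairing_mid j (nu : vec) : (0 < j < n)%N -> pairing j nu = at_nat nu j.-1 - at_nat nu j.
Proof.
move=> jn; have [e1 e2] : (j == 0)%N = false /\ (j == n) = false by split; lia.
by rewrite /pairing /ldir e1 e2 dot_addzl !dot_uvec; lia.
Qed.

Lemma pairing_n (nu : vec) : pairing n nu = at_nat nu n.-1.
Proof.
have e1 : (n == 0)%N = false by lia.
by rewrite /pairing /ldir e1 eqxx dot_uvec //; lia.
Qed.

Lemma pairing_0 (nu : vec) : pairing 0 nu = - at_nat nu 0.
Proof. by rewrite /pairing /ldir /= dot_addzl dot0v dot_uvec ?add0r ?mulN1r //; lia. Qed.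

Lemma iact_mid j (nu : vec) (i : 'I_n) : (0 < j < n)%N -> iact j nu i =
  if (i : nat) == j.-1 then at_nat nu j else if (i : nat) == j then at_nat nu j.-1 else nu i.
Proof.
move=> jn; have [e1 e2] : (j == 0)%N = false /\ (j == n) = false by split; lia.
have atE a : (i : nat) == a -> nu i = at_nat nu a.
  move/eqP <-; rewrite /at_nat (bigD1 i) //= big1 ?addr0 // => i' /andP[/eqP ii /eqP []].
  exact: val_inj.
rewrite /iact ffunE pairing_mid // /lmul /ldir e1 e2 !ffunE /= mul1r.
case: eqP => [/eqP h|_]; last case: eqP => [/eqP h|_].
- by rewrite (atE _ h) (_ : (i : nat) == j = false); lia.
- by rewrite (atE _ h); lia.
- by lia.
Qed.

Lemma iact_n (nu : vec) (i : 'I_n) : iact n nu i = if (i : nat) == n.-1 then - nu i else nu i.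
Proof.
have e1 : (n == 0)%N = false by lia.
rewrite /iact ffunE pairing_n // /lmul /ldir e1 eqxx !ffunE /=.
case: eqP => [h|_]; last by lia.
rewrite -h /at_nat (bigD1 i) //= big1 ?addr0; first by lia.
by move=> i' /andP[/eqP ii /eqP []]; apply: val_inj.
Qed.

Lemma iact_0 (nu : vec) (i : 'I_n) : iact 0 nu i = if (i : nat) == 0%N then - nu i else nu i.
Proof.
rewrite /iact ffunE pairing_0 // /lmul /ldir !ffunE /=.
case: eqP => [h|_]; last by lia.
rewrite -h /at_nat (bigD1 i) //= big1 ?addr0; first by lia.
by move=> i' /andP[/eqP ii /eqP []]; apply: val_inj.
Qed.

Section Moving.
Variables (v : int) (d : nat -> int).

Lemma at_moving r a : (a < n)%N ->
  at_nat (moving r v d) a = if (a < r)%N then d a else if a == r then v else d a.-1.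
Proof.
move=> an; exact: (at_ffun (fun a => if (a < r)%N then d a else if a == r then v else d a.-1) an).
Qed.

Lemma moving_right r : (r.+1 < n)%N ->
  iact r.+1 (moving r v d) = moving r.+1 v d /\ pairing r.+1 (moving r v d) = v - d r.
Proof.
move=> rn; split; last first.
  rewrite pairing_mid ?at_moving //=; try lia.
  have [e1 e2] : (r.+1 < r)%N = false /\ (r.+1 == r)%N = false by split; lia.
  by rewrite ltnn eqxx e1 e2.
apply/ffunP => i; rewrite iact_mid // !at_moving ?ffunE; try lia.
have [e1 e2] : (r.+1 < r)%N = false /\ (r.+1 == r)%N = false by split; lia.
rewrite /= e1 e2 ltnn eqxx ltnS [(i <= r)%N]leq_eqVlt.
case: (eqVneq (i : nat) r) => [E|i1] /=; first by rewrite ?E.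
by case: (eqVneq (i : nat) r.+1) => [E|i2]; rewrite ?E ?e1.
Qed.

Lemma moving_left r : (0 < r < n)%N ->
  iact r (moving r v d) = moving r.-1 v d /\ pairing r (moving r v d) = d r.-1 - v.
Proof.
case: r => // r rn; split; last first.
  by rewrite pairing_mid ?at_moving /= ?ltnSn ?ltnn ?eqxx; lia.
apply/ffunP => i; rewrite iact_mid // !at_moving ?ffunE; try lia.
have [e1 e2] : (r.+1 < r)%N = false /\ (r.+1 == r)%N = false by split; lia.
rewrite /= ltnn eqxx ltnSn ltnS [(i <= r)%N]leq_eqVlt.
case: (eqVneq (i : nat) r) => [E|i1] /=; first by rewrite ?E ?ltnn.
by case: (eqVneq (i : nat) r.+1) => [E|i2]; rewrite ?E ?e1.
Qed.

Lemma moving_last : iact n (moving n.-1 v d) = moving n.-1 (- v) d /\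
  pairing n (moving n.-1 v d) = v.
Proof.
split; last by rewrite pairing_n ?at_moving ?ltnn ?eqxx; lia.
by apply/ffunP => i; rewrite iact_n !ffunE; case: eqP => [->|//]; rewrite ltnn.
Qed.

Lemma moving_first : iact 0 (moving 0 v d) = moving 0 (- v) d /\ pairing 0 (moving 0 v d) = - v.
Proof.
split; last by rewrite pairing_0 ?at_moving ?eqxx //; lia.
by apply/ffunP => i; rewrite iact_0 !ffunE; case: eqP => [->|//].
Qed.

Definition rightword (b : bool) (r l : nat) := [seq (j, b) | j <- rev (iota r.+1 l)].
Definition leftword (m l : nat) := [seq (j, false) | j <- iota m.+1 l].

Lemma rightwordS b r l : rightword b r l.+1 = ((r + l).+1, b) :: rightword b r l.
Proof. by rewrite /rightword -(addn1 l) iotaD rev_cat /= addSn. Qed.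

Lemma rightword_act b r l : (r + l < n)%N ->
  wact (rightword b r l) (moving r v d) = moving (r + l) v d.
Proof.
elim: l => [|l IH] rl; first by rewrite addn0.
rewrite rightwordS /= -/(wact _ _) IH; last lia.
by rewrite addnS; case: (@moving_right (r + l)) => //; lia.
Qed.

Lemma rightword_run (P : nat * bool -> vec -> Prop) b r l : (r + l < n)%N ->
  (forall r', (r <= r' < r + l)%N -> P (r'.+1, b) (moving r' v d)) ->
  run P (rightword b r l) (moving r v d).
Proof.
elim: l => [|l IH] // rl HP; rewrite rightwordS /= rightword_act; last lia.
by split; [apply: IH => [|r' h]; [lia | apply: HP; lia] | apply: HP; lia].
Qed.

Lemma leftword_act m l : (m + l < n)%N -> wact (leftword m l) (moving (m + l) v d) = moving m v d.
Proof.
elim: l m => [|l IH] m ml; first by rewrite addn0.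
rewrite /leftword /= -/(leftword _ _) -/(wact _ _) addnS -addSn IH; last lia.
by case: (@moving_left m.+1) => //; lia.
Qed.

Lemma leftword_run (P : nat * bool -> vec -> Prop) m l : (m + l < n)%N ->
  (forall r, (m < r <= m + l)%N -> P (r, false) (moving r v d)) ->
  run P (leftword m l) (moving (m + l) v d).
Proof.
elim: l m => [|l IH] m // ml HP; rewrite /leftword /= -/(leftword _ _) addnS -addSn.
rewrite leftword_act; last lia.
by split; [apply: IH => [|r h]; [lia | apply: HP; lia] | apply: HP; lia].
Qed.

End Moving.

Lemma YwordE i : (i < n)%N -> Yword n i.+1 =
  rightword true 0 i ++ (0%N, false) :: leftword 0 n.-1 ++ (n, false) :: rightword false i (n.-1 - i).
Proof.
move=> i_n; rewrite /Yword /rightword /leftword -[i.+1.-1]/i.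
have -> : (n - i.+1 = n.-1 - i)%N by lia.
have -> : iota 1 n = rcons (iota 1 n.-1) n.
  have nn : n = (n.-1 + 1)%N by lia.
  by rewrite {1}nn iotaD cats1; congr rcons; lia.
by rewrite map_rcons -cats1 -!catA.
Qed.

Section YwordRun.
Variables (v : int) (d : nat -> int) (i : nat).
Hypothesis i_n : (i < n)%N.

Let last_act u : wact ((n, false) :: rightword false i (n.-1 - i)) (moving i u d) = moving n.-1 (- u) d.
Proof.
rewrite /= -/(wact _ _) rightword_act; last lia.
by rewrite (_ : i + (n.-1 - i) = n.-1)%N; [case: (moving_last u d) | lia].
Qed.

Let first_act : wact ((0%N, false) :: leftword 0 n.-1 ++ (n, false) :: rightword false i (n.-1 - i))
  (moving i v d) = moving 0 v d.
Proof.
rewrite /= -/(wact _ _) wact_cat last_act -{2}(add0n n.-1) leftword_act; last lia.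
by case: (moving_first (- v) d); rewrite opprK.
Qed.

Lemma Yword_act : wact (Yword n i.+1) (moving i v d) = moving i v d.
Proof. by rewrite YwordE // wact_cat first_act rightword_act. Qed.

Lemma Yword_run (P : nat * bool -> vec -> Prop) :
  (forall r, (i <= r < n.-1)%N -> P (r.+1, false) (moving r v d)) ->
  P (n, false) (moving n.-1 v d) ->
  (forall r, (0 < r < n)%N -> P (r, false) (moving r (- v) d)) ->
  P (0%N, false) (moving 0 (- v) d) ->
  (forall r, (r < i)%N -> P (r.+1, true) (moving r v d)) ->
  run P (Yword n i.+1) (moving i v d).
Proof.
move=> H1 H2 H3 H4 H5; rewrite YwordE //; apply: run_cat.
  by rewrite first_act; apply: rightword_run => //; rewrite add0n => r /andP[_ ri]; apply: H5.
split; last by rewrite wact_cat last_act -{2}(add0n n.-1) leftword_act ?add0n //; lia.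
apply: run_cat.
  rewrite last_act -{2}(add0n n.-1); apply: leftword_run; first lia.
  by move=> r h; apply: H3; lia.
split; last by rewrite rightword_act ?subnKC //; lia.
by apply: rightword_run => [|r h]; [lia | apply: H1; lia].
Qed.

Lemma wdiag_Yword : wdiag (Yword n i.+1) (moving i v d) =
  wdiag (rightword true 0 i) (moving 0 v d) * (ldiag (0%N, false) (moving 0 (- v) d) *
   (wdiag (leftword 0 n.-1) (moving n.-1 (- v) d) * (ldiag (n, false) (moving n.-1 v d) *
     wdiag (rightword false i (n.-1 - i)) (moving i v d)))).
Proof.
rewrite YwordE // wdiag_cat first_act /= wdiag_cat last_act wact_cat last_act /=.
rewrite -{2}(add0n n.-1) leftword_act ?add0n; last lia.
by rewrite rightword_act ?subnKC //; lia.
Qed.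

End YwordRun.
End Words.

Section TriangularY.
Variables (F : fieldType) (n : nat) (q12 k0 k kn u0 un : F).
Hypothesis n_ge2 : (2 <= n)%N.
Hypothesis q12_neq0 : q12 != 0.
Hypotheses (k0_neq0 : k0 != 0) (k_neq0 : k != 0) (kn_neq0 : kn != 0).
Hypotheses (u0_neq0 : u0 != 0) (un_neq0 : un != 0).
Local Notation vec := {ffun 'I_n -> int}.
Local Notation kap := (kap n k0 k kn).
Local Notation gpt := (gpt n q12).
Local Notation X := (gpt -> F^o).
Local Notation op := (@opX F n q12 k0 k kn u0 un n_ge2 q12_neq0).
Local Notation mX := (@mX F n q12).
Local Notation ldiag := (@ldiag F n q12 k0 k kn).
Local Notation wdiag := (@wdiag F n q12 k0 k kn).

Lemma opX_linear p a f g : op p (a *: f + g) = a *: op p f + op p g.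
Proof.
rewrite /opX; case: p.2; rewrite TX_linear //.
by rewrite [_ *: (a *: f + g)]scalerDr scalerBr !scalerA (mulrC a) opprD addrACA.
Qed.

Lemma opX0 p : op p 0 = 0.
Proof. by have := opX_linear p (-1) 0 0; rewrite scaler0 addr0 scaleN1r addNr. Qed.

Lemma word_linear w a f g :
  apply_word op w (a *: f + g) = a *: apply_word op w f + apply_word op w g.
Proof. by elim: w => //= p w ->; rewrite opX_linear. Qed.

Let opX_mX' p nu a (ok : letter_ok p a) :=
  opX_mX n_ge2 q12_neq0 k0_neq0 k_neq0 kn_neq0 u0_neq0 un_neq0 nu ok.

Lemma opX_low p a M f : letter_ok p a -> lowX a M f -> lowX (iact p.1 a) M (op p f).
Proof.
move=> ok [s [-> sM]]; elim: s sM => [|[mu c] s IH] sM.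
  by rewrite levX_nil opX0; apply: lowX0.
rewrite levX_cons opX_linear; apply: lowXD; last first.
  by apply: IH => p' ps; apply: sM; rewrite inE ps orbT.
apply: lowXZ => /=.
have muM : level a mu < M by apply: (sM (mu, c)); rewrite inE eqxx.
have [r [-> rl]] := opX_mX' mu ok.
apply: lowXD; last by apply: lowX_le rl; apply: ltW.
by apply/lowXZ/lowX_mX; rewrite level_iact //; case/andP: ok.
Qed.

Lemma level_wact w (a nu : vec) : run (fun p b => letter_ok p b) w a ->
  level (wact w a) (wact w nu) = level a nu.
Proof.
by elim: w => //= p w IH [okw /andP[jn _]]; rewrite level_iact // IH.
Qed.

(** The direction travels with the word: each letter reflects it along with the exponent, which
    keeps the level of the leading term fixed while all other terms stay strictly below. *)
Lemma word_mX w (a nu : vec) : run (fun p b => letter_ok p b) w a -> exists r : X,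
  apply_word op w (mX nu) = wdiag w nu *: mX (wact w nu) + r /\ lowX (wact w a) (level a nu) r.
Proof.
elim: w => [|p w IH] /= => [_|[okw ok]].
  by exists 0; rewrite scale1r addr0; split=> //; apply: lowX0.
have [r [-> rl]] := IH okw.
have [r' [E rl']] := opX_mX' (wact w nu) ok.
exists (wdiag w nu *: r' + op p r).
rewrite opX_linear E scalerDr scalerA mulrC addrA; split=> //.
apply: lowXD; last exact: opX_low.
by apply: lowXZ; rewrite -(level_wact _ okw).
Qed.

(* (n, n-1, ..., 1): along the word of Y_i each letter then satisfies [letter_ok]. *)
Definition ydir : vec := [ffun i : 'I_n => (n - i)%:Z].

Lemma moving_at (i : 'I_n) (nu : vec) : nu =
  moving n i (nu i) (fun l => if (l < i)%N then at_nat nu l else at_nat nu l.+1).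
Proof.
have at_ord (j : 'I_n) : at_nat nu j = nu j.
  rewrite /at_nat (bigD1 j) //= big1 ?addr0 // => j' /andP[/eqP jj /eqP []]; exact: val_inj.
apply/ffunP => j; rewrite ffunE; case: (ltngtP (j : nat) i) => [ji|ij|ji]; first by rewrite at_ord.
  rewrite (_ : (j.-1 < i)%N = false) ?(ltn_predK ij) ?at_ord //; lia.
by congr (nu _); apply: val_inj.
Qed.

(** $Y_i$ belongs to a translation, whose linear part is trivial: exponent and direction both come
    back, which turns [word_mX] into triangularity. *)
Lemma Yword_wact (i : 'I_n) (nu : vec) : wact (Yword n i.+1) nu = nu.
Proof. by rewrite {1}(moving_at i nu) Yword_act // -moving_at. Qed.

Lemma at_ydir l : (l < n)%N -> at_nat ydir l = (n - l)%:Z.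
Proof. exact: (at_ffun (fun l => (n - l)%:Z)). Qed.

(** The moving entry n - i is positive, smaller than the entries that started on its left and larger
    than those on its right; this gives every stretch of the word the sign that its letters
    require. *)
Lemma Yword_ok (i : 'I_n) : run (fun p b => letter_ok p b) (Yword n i.+1) ydir.
Proof.
have i_n := ltn_ord i; rewrite (moving_at i ydir) ffunE.
set d := (X in moving _ _ _ X); have d1 l : (l < i)%N -> d l = (n - l)%:Z.
  by move=> li; rewrite /d li at_ydir //; lia.
have d2 l : (i <= l < n.-1)%N -> d l = (n - l.+1)%:Z.
  by move=> li; rewrite /d ltnNge (_ : (i <= l)%N) ?at_ydir //=; lia.
have d3 l : (l < n.-1)%N -> 0 < d l.
  by move=> ln; case: (ltnP l i) => h; [rewrite d1 | rewrite d2]; lia.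
apply: Yword_run => // [r h||r h||r h]; rewrite /letter_ok /=.
- have [|_ ->] := @moving_right n n_ge2 (n - i)%:Z d r; first lia.
  by rewrite d2; lia.
- have [_ ->] := @moving_last n n_ge2 (n - i)%:Z d; lia.
- have [|_ ->] := @moving_left n n_ge2 (- (n - i)%:Z) d r; first lia.
  have := d3 r.-1; lia.
- have [_ ->] := @moving_first n n_ge2 (- (n - i)%:Z) d; lia.
- have [|_ ->] := @moving_right n n_ge2 (n - i)%:Z d r; first lia.
  by rewrite d1; lia.
Qed.

Definition triangular (Op : X -> X) (g : vec -> F) : Prop :=
  forall nu, exists r, Op (mX nu) = g nu *: mX nu + r /\ lowX ydir (level ydir nu) r.

Definition YX (i : nat) : X -> X := apply_word op (Yword n i).

Lemma YX_triangular (i : 'I_n) : triangular (YX i.+1) (wdiag (Yword n i.+1)).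
Proof.
move=> nu; have [r [E rl]] := word_mX nu (Yword_ok i).
by exists r; rewrite /YX E !Yword_wact in rl *.
Qed.

(** Monomials in the parameters, graded by the exponent of q. Genericity makes this exponent well
    defined, and it recovers $\lambda_i$ from an eigenvalue. *)
Definition qmonomial (e : int) (x : F) : Prop :=
  exists b c d : int, x = (q q12) ^ e * k0 ^ b * kn ^ c * k ^ d.

Lemma qmonomialM e e' x y : qmonomial e x -> qmonomial e' y -> qmonomial (e + e') (x * y).
Proof.
have q0 : q q12 != 0 by rewrite expf_neq0.
move=> [b [c [d ->]]] [b' [c' [d' ->]]]; exists (b + b'), (c + c'), (d + d').
by rewrite !expfzDr //; ring.
Qed.

Lemma qmonomialMl e x y : qmonomial 0 x -> qmonomial e y -> qmonomial e (x * y).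
Proof. by move=> hx hy; have := qmonomialM hx hy; rewrite add0r. Qed.

Lemma qmonomialMr e x y : qmonomial e x -> qmonomial 0 y -> qmonomial e (x * y).
Proof. by move=> hx hy; have := qmonomialM hx hy; rewrite addr0. Qed.

Lemma qmonomial1 : qmonomial 0 1.
Proof. by exists 0, 0, 0; rewrite !expr0z !mulr1. Qed.

Lemma qmonomial_kap j (b : bool) : qmonomial 0 (if b then kap j else (kap j)^-1).
Proof.
have E : (if b then kap j else (kap j)^-1) = kap j ^ (if b then 1 else -1).
  by case: b; rewrite ?expr1z ?exprN1.
rewrite E /Defs.kap; case: ifP => _; last case: ifP => _.
- by exists (if b then 1 else -1), 0, 0; rewrite !expr0z !mulr1 mul1r.
- by exists 0, (if b then 1 else -1), 0; rewrite !expr0z !mulr1 !mul1r.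
- by exists 0, 0, (if b then 1 else -1); rewrite !expr0z !mul1r.
Qed.

Lemma qmonomial_ldiag p nu : p.1 != 0%N -> qmonomial 0 (ldiag p nu).
Proof.
move=> /negbTE p0; rewrite /ldiag /lscal p0 exp1rz mul1r; exact: qmonomial_kap.
Qed.

Lemma qmonomial_wdiag w nu : run (fun p mu => qmonomial 0 (ldiag p mu)) w nu ->
  qmonomial 0 (wdiag w nu).
Proof.
elim: w => [|p w IH] /=; first by move=> _; apply: qmonomial1.
by move=> [/IH h hp]; rewrite -[0]addr0; apply: qmonomialM.
Qed.

(** The letter 0 is the one that carries q, and it is met when the moving entry is $-\nu_i$. *)
Lemma Yeigen_qmonomial (i : 'I_n) (nu : vec) : qmonomial (- nu i) (wdiag (Yword n i.+1) nu).
Proof.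
have i_n := ltn_ord i; rewrite {2}(moving_at i nu); set d := (X in moving _ _ _ X).
rewrite wdiag_Yword //; apply: qmonomialMl.
  by apply: qmonomial_wdiag; apply: rightword_run => // r _; apply: qmonomial_ldiag.
apply: qmonomialMr; last first.
  apply: qmonomialMl.
    rewrite -{2}(add0n n.-1); apply: qmonomial_wdiag; apply: leftword_run => //; first lia.
    by move=> r h; apply: qmonomial_ldiag; rewrite /=; lia.
  apply: qmonomialMl; first by apply: qmonomial_ldiag; rewrite /=; lia.
  by apply: qmonomial_wdiag; apply: rightword_run => // [|r _]; [lia | apply: qmonomial_ldiag].
have [_ E] := @moving_first n n_ge2 (- nu i) d; rewrite /ldiag [(_, _).1]/= [(_, _).2]/= E opprK.
apply: qmonomialMr; last exact: qmonomial_kap.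
exists 0, 0, 0; rewrite !expr0z !mulr1 /lscal /lmul /= /q [in RHS]exprnP exprz_exp.
by congr (_ ^ _); ring.
Qed.

Lemma ldiag_mid j b nu : (0 < j < n)%N -> ldiag (j, b) nu =
  if (if b then 0 <= pairing j nu else 0 < pairing j nu) then k else k^-1.
Proof.
move=> jn; have [e1 e2] : (j == 0)%N = false /\ (j == n) = false by split; lia.
by rewrite /ldiag /lscal /Defs.kap /= e1 e2 exp1rz mul1r.
Qed.

Lemma prod_const_lt (i : 'I_n) (c : F) : \prod_(j < n | (j < i)%N) c = c ^+ i.
Proof.
by rewrite -(big_ord_widen n (fun _ => c)) ?prodr_const ?card_ord // ltnW.
Qed.

Lemma prod_const_gt (i : 'I_n) (c : F) : \prod_(j < n | (i < j)%N) c = c ^+ (n.-1 - i).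
Proof.
rewrite (reindex_inj rev_ord_inj) /= (eq_bigl (fun j : 'I_n => (j < rev_ord i)%N)).
  by rewrite prod_const_lt /=; congr (_ ^+ _); lia.
by move=> j /=; have := ltn_ord i; have := ltn_ord j; lia.
Qed.

Lemma gamma_const_prod m (i : 'I_n) : gamma q12 k0 k kn (constvec n m) i =
  q q12 ^ m * (k0 * kn) ^ (- eta_sgn m) * k^-1 ^+ i * k ^+ (n.-1 - i) * (k ^ (- eta_sgn m)) ^+ n.-1.
Proof.
have p1 : \prod_(j < n | (j < i)%N) k ^ eta_sgn (constvec n m j - constvec n m i) = k^-1 ^+ i.
  rewrite -prod_const_lt; apply: eq_bigr => j _.
  by rewrite !ffunE subrr /eta_sgn ltxx exprN1.
have p2 : \prod_(j < n | (i < j)%N) k ^ (- eta_sgn (constvec n m i - constvec n m j)) =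
    k ^+ (n.-1 - i).
  rewrite -prod_const_gt; apply: eq_bigr => j _.
  by rewrite !ffunE subrr /eta_sgn ltxx opprK expr1z.
have p3 : \prod_(j < n | j != i) k ^ (- eta_sgn (constvec n m i + constvec n m j)) =
    (k ^ (- eta_sgn m)) ^+ n.-1.
  have -> : n.-1 = #|predC1 i| by rewrite cardC1 card_ord.
  rewrite -prodr_const; apply: eq_big => // j _.
  rewrite !ffunE; congr (k ^ (- _)); rewrite /eta_sgn.
  by rewrite (_ : (0 < m + m) = (0 < m)) //; lia.
by rewrite /gamma p1 p2 p3 ffunE.
Qed.

Lemma gamma_const m (i : 'I_n) : gamma q12 k0 k kn (constvec n m) i =
  q q12 ^ m * (k0 * kn * k ^+ n.-1) ^ (- eta_sgn m) * k ^ (n%:Z - 1 - 2 * (i : nat)%:Z).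
Proof.
have -> : n%:Z - 1 - 2 * (i : nat)%:Z = (n.-1 - i)%N%:Z - i%:Z by have := ltn_ord i; lia.
have -> : k ^ ((n.-1 - i)%N%:Z - i%:Z) = k ^+ (n.-1 - i) * k^-1 ^+ i.
  by rewrite expfzDr // -invr_expz -!exprnP exprVn.
have e2 : (k ^ (- eta_sgn m)) ^+ n.-1 = (k ^+ n.-1) ^ (- eta_sgn m).
  by rewrite !exprnP !exprz_exp mulrC.
by rewrite gamma_const_prod (expfzMl (k0 * kn)) e2; ring.
Qed.

(** For a constant exponent all comparisons within a stretch are alike: the moving entry m gives
    pairing 0 with the others, and -m gives 2m, whose sign is that of m. *)
Lemma Yeigen_const m (i : 'I_n) :
  wdiag (Yword n i.+1) (constvec n m) = (gamma q12 k0 k kn (constvec n m) i)^-1.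
Proof.
have i_n := ltn_ord i.
rewrite gamma_const_prod; have -> : constvec n m = moving n i m (fun _ => m).
  by apply/ffunP => j; rewrite !ffunE; do 2?case: ifP.
pose d (_ : nat) := m; rewrite wdiag_Yword // -/d.
have -> : wdiag (rightword true 0 i) (moving n 0 m d) = k ^+ i.
  rewrite (wdiag_const (c := k)) ?size_map ?size_rev ?size_iota //.
  apply: rightword_run => // r h; rewrite ldiag_mid; last lia.
  by have [|_ ->] := @moving_right n n_ge2 m d r; [lia | rewrite subrr].
have -> : wdiag (leftword 0 n.-1) (moving n n.-1 (- m) d) = (k ^ eta_sgn m) ^+ n.-1.
  rewrite (wdiag_const (c := k ^ eta_sgn m)) ?size_map ?size_iota //.
  rewrite -{2}(add0n n.-1); apply: leftword_run => //; first lia.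
  move=> r h; rewrite ldiag_mid; last lia.
  have [|_ ->] := @moving_left n n_ge2 (- m) d r; first lia.
  by rewrite /d /eta_sgn opprK (_ : (0 < m + m) = (0 < m)); [case: ifP; rewrite ?exprN1 | lia].
have -> : wdiag (rightword false i (n.-1 - i)) (moving n i m d) = k^-1 ^+ (n.-1 - i).
  rewrite (wdiag_const (c := k^-1)) ?size_map ?size_rev ?size_iota //.
  apply: rightword_run => // [|r h]; first lia.
  rewrite ldiag_mid; last lia.
  by have [|_ ->] := @moving_right n n_ge2 m d r; [lia | rewrite subrr].
have -> : ldiag (n, false) (moving n n.-1 m d) = kn ^ eta_sgn m.
  have [_ E] := @moving_last n n_ge2 m d.
  rewrite /ldiag [(_, _).1]/= [(_, _).2]/= E /lscal /Defs.kap /eta_sgn.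
  have e1 : (n == 0)%N = false by lia.
  by rewrite e1 eqxx exp1rz mul1r; case: ifP; rewrite ?exprN1.
have -> : ldiag (0%N, false) (moving n 0 (- m) d) = q q12 ^ (- m) * k0 ^ eta_sgn m.
  have [_ E] := @moving_first n n_ge2 (- m) d.
  rewrite /ldiag [(_, _).1]/= [(_, _).2]/= E opprK /lscal /lmul /Defs.kap /eta_sgn /=.
  rewrite /q [_ ^+ 2]exprnP exprz_exp (_ : - (2%:Z * m) = 2%:Z * - m); last ring.
  by case: ifP; rewrite ?exprN1.
rewrite -!invr_expz !invfM !invrK !exprVn !invrK expfzMl.
by ring.
Qed.

End TriangularY.

(** * Joint eigenvectors *)

Section HeckeFunctions.
Variables (F : fieldType) (n : nat) (q12 k0 k kn u0 un : F).
Hypothesis n_ge2 : (2 <= n)%N.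
Hypothesis q12_neq0 : q12 != 0.
Local Notation gpt := (gpt n q12).
Local Notation X := (gpt -> F^o).

Lemma lvar_sG j (p : gpt) : (j <= n)%N ->
  lvar n q12 j (pt (sG n_ge2 q12_neq0 j p)) = (lvar n q12 j (pt p))^-1.
Proof.
move=> jn; rewrite pt_sG //; move: j jn; apply: (letter_cases n_ge2) => [||j jm].
- have t0 : pt p 0%N != 0 by apply: pt_neq0; lia.
  rewrite /lvar /= /sj /= /q; field; rewrite q12_neq0 t0 //.
- have e1 : (n == 0)%N = false by lia.
  by rewrite /lvar e1 eqxx sjn_last.
- have [e1 e2] : (j == 0)%N = false /\ (j == n) = false by split; lia.
  by rewrite /lvar e1 e2 sjm_l // sjm_r // invf_div.
Qed.

Hypotheses (k0_neq0 : k0 != 0) (k_neq0 : k != 0) (kn_neq0 : kn != 0).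
Hypotheses (u0_neq0 : u0 != 0) (un_neq0 : un != 0).
Local Notation TX := (@TX F n q12 k0 k kn u0 un n_ge2 q12_neq0).
Local Notation YX := (@YX F n q12 k0 k kn u0 un n_ge2 q12_neq0).
Local Notation lA := (lA n k0 k kn).
Local Notation kap := (kap n k0 k kn).

Lemma TX_quadratic j f : (j <= n)%N -> TX j (TX j f) = lA j *: TX j f + f.
Proof.
move=> jn; apply: funext => p; rewrite /TX /reflop !fctE sGK !ctildeE // lvar_sG //.
have := lvar_neq0 n_ge2 q12_neq0 p jn; have := lvar_neq1 n_ge2 q12_neq0 p jn.
have kj : kap j != 0 by rewrite /Defs.kap; case: ifP => // _; case: ifP.
have [m1|m2] := lmul_cases n u0 un j.
  case: m1 => -> ->; rewrite /GRing.scale /= expr1; move: (lvar _ _ _ _) => y y1 y0.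
  have y2 : y - 1 != 0 by rewrite -opprB oppr_eq0.
  by rewrite expr1 !mul0r !addr0 /lA; field; rewrite ?y0 ?y1 ?y2 ?kj.
rewrite m2 /GRing.scale /=; move: (lvar _ _ _ _) => y y1 y0.
have y2 : y ^+ 2 - 1 != 0 by rewrite -opprB oppr_eq0.
by rewrite /lA; field; rewrite ?y0 ?y1 ?y2 ?kj.
Qed.

Definition TX' (j : nat) (f : X) : X := TX j f - lA j *: f.

Lemma TXZ j a f : TX j (a *: f) = a *: TX j f.
Proof.
have := TX_linear k0 k kn u0 un n_ge2 q12_neq0 j a f 0.
have -> : TX j 0 = 0.
  by have := TX_linear k0 k kn u0 un n_ge2 q12_neq0 j (-1) 0 0; rewrite scaler0 addr0 scaleN1r addNr.
by rewrite !addr0.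
Qed.

Lemma TXB j f g : TX j (f - g) = TX j f - TX j g.
Proof. by rewrite addrC -scaleN1r TX_linear scaleN1r addrC. Qed.

Lemma TXK j : (j <= n)%N -> cancel (TX j) (TX' j).
Proof. by move=> jn f; rewrite /TX' TX_quadratic // addrC addKr. Qed.

Lemma TX'K j : (j <= n)%N -> cancel (TX' j) (TX j).
Proof. by move=> jn f; rewrite /TX' TXB TXZ TX_quadratic // addrC addKr. Qed.

Let brX := TX_braid n_ge2 q12_neq0 k0_neq0 k_neq0 kn_neq0 u0_neq0 un_neq0.

Lemma YXE i : YX i = Yop n TX TX' i.
Proof.
apply: funext => f; rewrite /YX /Yop; elim: (Yword n i) => //= p w ->.
by rewrite /opX; case: p.2.
Qed.

Lemma YX_comm (i j : 'I_n) f : YX i.+1 (YX j.+1 f) = YX j.+1 (YX i.+1 f).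
Proof.
have i_n : (0 < i.+1 <= n)%N by rewrite ltn_ord.
have j_n : (0 < j.+1 <= n)%N by rewrite ltn_ord.
rewrite !YXE; exact: (Yop_comm n_ge2 brX TXK TX'K i_n j_n f).
Qed.

Lemma YX_T (i : 'I_n) j f : (0 < j <= n)%N -> j != i.+1 -> j != i ->
  TX j (YX i.+1 f) = YX i.+1 (TX j f).
Proof.
have i_n : (0 < i.+1 <= n)%N by rewrite ltn_ord.
by move=> jn ji ji1; rewrite !YXE; exact: (Yop_T n_ge2 brX TXK TX'K i_n jn ji ji1 f).
Qed.

Lemma YX_rec j f : (0 < j < n)%N -> YX j f = TX j (YX j.+1 (TX j f)).
Proof. by move=> jn; rewrite !YXE; exact: (Yop_rec n_ge2 TX'K f jn). Qed.
End HeckeFunctions.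

(** * Eigenvectors of triangular operators *)

Section Spectral.
Variables (F : closedFieldType) (n : nat) (q12 : F).
Hypothesis uncountable : forall f : nat -> F, exists x : F, forall i, f i != x.
Hypothesis q12_neq0 : q12 != 0.
Local Notation vec := {ffun 'I_n -> int}.
Local Notation gpt := (gpt n q12).
Local Notation X := (gpt -> F^o).
Local Notation mX := (@mX F n q12).
Local Notation levX := (@levX F n q12).
Local Notation lev_ nu := (level (ydir n) nu).
Local Notation triangular := (@triangular F n q12).

Lemma levX_eq0 s : levX s = 0 -> forall lam, lcoef s lam = 0.
Proof.
move=> s0; apply: (lev_good_eq0 uncountable q12_neq0) => t gt.
exact: (congr1 (fun f : X => f (exist _ t gt)) s0).
Qed.

Lemma lcoef_cat (s s' : lpoly F n) lam : lcoef (s ++ s') lam = lcoef s lam + lcoef s' lam.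
Proof. by rewrite /lcoef big_cat. Qed.

Lemma lcoef_scale a (s : lpoly F n) lam :
  lcoef [seq (p.1, a * p.2) | p <- s] lam = a * lcoef s lam.
Proof. by rewrite /lcoef big_map mulr_sumr. Qed.

Lemma lcoef_cons p (s : lpoly F n) lam :
  lcoef (p :: s) lam = (if p.1 == lam then p.2 else 0) + lcoef s lam.
Proof. by rewrite /lcoef big_cons; case: ifP; rewrite ?add0r. Qed.

Lemma levX_lcoef s s' : levX s = levX s' -> lcoef s =1 lcoef s'.
Proof.
move=> E lam; have := @levX_eq0 (s ++ [seq (p.1, -1 * p.2) | p <- s']) _ lam.
rewrite levX_cat levX_scale E scaleN1r addrN lcoef_cat lcoef_scale mulN1r => /(_ erefl).
by move/subr0_eq.
Qed.

Lemma lreduce (s : lpoly F n) : exists s', levX s' = levX s /\ lcoef s' =1 lcoef s /\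
  forall p, p \in s' -> lcoef s p.1 != 0.
Proof.
pose u := [seq lam <- undup (map fst s) | lcoef s lam != 0].
have E : levX [seq (lam, lcoef s lam) | lam <- u] = levX s.
  apply: funext => p; rewrite /levX (@lev_lcoef _ _ s (undup (map fst s))) ?undup_uniq //; last first.
    by move=> x; rewrite mem_undup.
  rewrite /lev big_map big_filter big_mkcond; apply: eq_bigr => lam _ /=.
  by case: eqP => [->|//]; rewrite mul0r.
exists [seq (lam, lcoef s lam) | lam <- u]; split=> //; split; first exact: levX_lcoef.
by move=> p /mapP[lam]; rewrite mem_filter => /andP[l0 _] ->.
Qed.

(** Ties in the level are allowed: the terms created by a triangular operator are strictly lower and
    cannot reach an exponent of top level. *)
Definition is_top (s : lpoly F n) (lam : vec) : Prop :=
  lcoef s lam != 0 /\ forall mu, lcoef s mu != 0 -> lev_ mu <= lev_ lam.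

Lemma top_exists s : levX s != 0 -> exists lam, is_top s lam.
Proof.
move=> s0; have [lam0 l0] : lnz s.
  apply: contrapT => H; case/eqP: s0; apply: funext => p; apply/eqP; apply: contraT => /lnz_of_lev h.
  by case: H.
pose P v := has (fun mu => (lcoef s mu != 0) && (`|lev_ mu|%N == v)) (map fst s).
have ms mu : lcoef s mu != 0 -> mu \in map fst s by apply: contraR => /lcoef_out ->.
have exP : exists v, P v by exists `|lev_ lam0|%N; apply/hasP; exists lam0; rewrite ?ms ?l0 /=.
have bP v : P v -> (v <= \sum_(mu <- map fst s) `|lev_ mu|)%N.
  by case/hasP => mu mus /andP[_ /eqP <-]; rewrite (big_rem mu) //= leq_addr.
case: (ex_maxnP exP bP) => v /hasP[lam _ /andP[l1 /eqP lv]] vmax; exists lam; split=> // mu m0.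
have : (`|lev_ mu| <= v)%N by apply: vmax; apply/hasP; exists mu; rewrite ?ms ?m0 /=.
by rewrite -lv -lez_nat !gez0_abs ?level_ge0.
Qed.

Definition linX (Op : X -> X) := forall a f g, Op (a *: f + g) = a *: Op f + Op g.

Lemma linX0 Op : linX Op -> Op 0 = 0.
Proof. by move=> OpL; have := OpL (-1) 0 0; rewrite scaler0 addr0 scaleN1r addNr. Qed.

Lemma triangular_lcoef Op g s lam : linX Op -> triangular Op g ->
  (forall p, p \in s -> lev_ p.1 <= lev_ lam) ->
  exists s', Op (levX s) = levX s' /\ lcoef s' lam = g lam * lcoef s lam.
Proof.
move=> OpL Otri; elim: s => [|[mu c] s IH] sl.
  by exists [::]; rewrite levX_nil linX0 // /lcoef !big_nil mulr0.
have [s' [E c']] := IH (fun p ps => sl p (mem_behead (s := (mu, c) :: s) ps)).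
have [r0 [Em [r [Er rl]]]] := Otri mu; rewrite {}Er in Em.
exists ((mu, c * g mu) :: [seq (p.1, c * p.2) | p <- r] ++ s'); split.
  rewrite !levX_cons OpL Em E scalerDr scalerA levX_cat levX_scale -addrA //.
rewrite !lcoef_cons lcoef_cat lcoef_scale c' (@lcoef_out _ _ r) ?mulr0 ?add0r /=.
  by case: eqP => [->|_]; rewrite mulrDr ?mulr0 ?add0r // mulrC.
apply/mapP => -[p pr El]; have := rl p pr; rewrite -El ltNge.
by have := sl (mu, c) (mem_head _ _) => /= ->.
Qed.

Lemma triangular_levX Op g s : linX Op -> triangular Op g -> exists s', Op (levX s) = levX s'.
Proof.
move=> OpL Otri; elim: s => [|[mu c] s [s' E]].
  by exists [::]; rewrite levX_nil linX0.
have [r0 [Em [r [Er _]]]] := Otri mu; rewrite {}Er in Em.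
exists ((mu, c * g mu) :: [seq (p.1, c * p.2) | p <- r] ++ s').
by rewrite !levX_cons OpL Em E scalerDr scalerA levX_cat levX_scale -addrA.
Qed.

Lemma eigen_top Op g s lam c : linX Op -> triangular Op g -> is_top s lam ->
  Op (levX s) = c *: levX s -> g lam = c.
Proof.
move=> OpL Otri [l0 lmax] E; have [s2 [E2 [c2 h2]]] := lreduce s.
have [s' [E' c']] := triangular_lcoef OpL Otri (fun p ps => lmax _ (h2 p ps)).
have : lcoef s' lam = c * lcoef s2 lam.
  by rewrite -lcoef_scale; apply: levX_lcoef; rewrite -E' E2 E -E2 -levX_scale.
by rewrite c' c2 => /(mulIf l0).
Qed.

(** The difference is again a joint eigenvector. Its top exponent would be m by separation, yet its
    coefficient at m vanishes. *)
Lemma joint_eigen_unique (I : Type) (Op : I -> X -> X) (g : I -> vec -> F) (c : I -> F) m P s :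
  (forall i, linX (Op i)) -> (forall i, triangular (Op i) (g i)) ->
  (forall lam, (forall i, g i lam = c i) -> lam = m) ->
  lcoef P m = 1 -> (forall i, Op i (levX P) = c i *: levX P) ->
  (forall i, Op i (levX s) = c i *: levX s) -> levX s = lcoef s m *: levX P.
Proof.
move=> OpL Otri sep P1 EP Es.
pose s' := s ++ [seq (p.1, - lcoef s m * p.2) | p <- P].
have E' : levX s' = levX s - lcoef s m *: levX P by rewrite /s' levX_cat levX_scale scaleNr.
apply/eqP; rewrite -subr_eq0 -E'; apply: contraT => /top_exists[lam lt].
have lm : lam = m.
  apply: sep => i; apply: (eigen_top (OpL i) (Otri i) lt).
  rewrite E' addrC -scaleNr OpL EP Es scalerDr !scalerA mulrC.
  by [].
case: lt => /eqP []; rewrite lm /s' lcoef_cat lcoef_scale P1 mulr1 subrr //.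
Qed.

Lemma solve_lower (D : X -> X) M (s : lpoly F n) : linX D ->
  (forall p, p \in s -> exists u, lowX (ydir n) M u /\ D u = mX p.1) ->
  exists u, lowX (ydir n) M u /\ D u = levX s.
Proof.
move=> DL; elim: s => [|[mu c] s IH] H.
  by exists 0; rewrite levX_nil linX0 //; split=> //; apply: lowX0.
have [u [ul Du]] := IH (fun p ps => H p (mem_behead (s := (mu, c) :: s) ps)).
have [v [vl Dv]] := H _ (mem_head _ _).
by exists (c *: v + u); rewrite levX_cons DL Du Dv; split=> //; apply: lowXD => //; apply: lowXZ.
Qed.

Lemma lowX_lcoef s M lam : lowX (ydir n) M (levX s) -> M <= lev_ lam -> lcoef s lam = 0.
Proof.
move=> [s' [/levX_lcoef -> sM]] Ml; apply: lcoef_out; apply/mapP => -[p /sM ps El].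
by move: ps; rewrite -El ltNge Ml.
Qed.

Lemma eigenvector_exists Op g m : linX Op -> triangular Op g ->
  (forall mu, mu <> m -> g mu != g m) ->
  exists s, lcoef s m = 1 /\ Op (levX s) = g m *: levX s /\
    exists r, levX s = mX m + r /\ lowX (ydir n) (lev_ m) r.
Proof.
move=> OpL Otri sep; pose D u := Op u - g m *: u.
have DL : linX D.
  by move=> a f h; rewrite /D OpL [_ *: (a *: f + h)]scalerDr scalerBr !scalerA (mulrC a) opprD addrACA.
(* Levels are nonnegative integers, so the recursion can run on a bound N for the level. *)
have solve (N : nat) mu : (`|lev_ mu| < N)%N -> lev_ mu < lev_ m ->
    exists u, lowX (ydir n) (lev_ mu + 1) u /\ D u = mX mu.
  elim: N mu => // N IH mu muN mum; have [r0 [Em [r [Er rl]]]] := Otri mu; rewrite {}Er in Em.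
  have [|u [ul Du]] := @solve_lower D (lev_ mu) r DL.
    move=> p pr; have pmu := rl p pr; have [||u [ul Du]] := IH p.1.
    - by have := level_ge0 (ydir n) p.1; lia.
    - exact: lt_trans mum.
    - by exists u; split=> //; apply: lowX_le ul; rewrite addrC lez1D.
  have z0 : g mu - g m != 0.
    by rewrite subr_eq0; apply: sep => E; rewrite E ltxx in mum.
  exists ((g mu - g m)^-1 *: (-1 *: u + mX mu) + 0); split.
    rewrite addr0; apply: lowXZ; apply: lowXD; last by apply: lowX_mX; lia.
    by apply: lowXZ; apply: lowX_le ul; lia.
  have DE : D (mX mu) = (g mu - g m) *: mX mu + levX r by rewrite /D Em addrAC -scalerBl.
  rewrite DL linX0 // addr0 DL Du DE scaleN1r [- levX r + _]addrC addrK.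
  by rewrite scalerA mulVf ?scale1r.
have [r0 [Em [r [Er rl]]]] := Otri m; rewrite {}Er in Em.
have [|u [ul Du]] := @solve_lower D (lev_ m) r DL.
  move=> p pr; have pmu := rl p pr; have [|u [ul Du]] := solve `|lev_ p.1|.+1 p.1 (leqnn _).
    exact: pmu.
  by exists u; split=> //; apply: lowX_le ul; rewrite addrC lez1D.
have [us [Eu usl]] := ul.
pose s := (m, 1) :: [seq (p.1, -1 * p.2) | p <- us].
have Es : levX s = mX m - u by rewrite levX_cons scale1r levX_scale scaleN1r -Eu.
exists s; split; first last.
  split; last by exists (- u); rewrite Es; split=> //; rewrite -scaleN1r; apply: lowXZ.
  apply/eqP; rewrite -subr_eq0; apply/eqP; rewrite -/(D _) Es addrC -scaleN1r DL Du.
  by rewrite /D Em addrAC addrN add0r scaleN1r addNr.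
rewrite lcoef_cons eqxx lcoef_scale (@lowX_lcoef us (lev_ m)) ?mulr0 ?addr0 //.
by rewrite -Eu.
Qed.

End Spectral.

Section Koornwinder.
Variables (F : closedFieldType) (n : nat) (q12 k0 k kn u0 un : F).
Hypothesis uncountable : forall f : nat -> F, exists x : F, forall i, f i != x.
Hypothesis n_ge2 : (2 <= n)%N.
Hypothesis q12_neq0 : q12 != 0.
Hypotheses (k0_neq0 : k0 != 0) (k_neq0 : k != 0) (kn_neq0 : kn != 0).
Hypotheses (u0_neq0 : u0 != 0) (un_neq0 : un != 0).
Hypothesis generic : forall a b c d : int,
  (q q12) ^ a * k0 ^ b * kn ^ c * k ^ d = 1 -> a = 0 /\ d = 0.
Local Notation vec := {ffun 'I_n -> int}.
Local Notation gpt := (gpt n q12).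
Local Notation X := (gpt -> F^o).
Local Notation TX := (@TX F n q12 k0 k kn u0 un n_ge2 q12_neq0).
Local Notation YX := (@YX F n q12 k0 k kn u0 un n_ge2 q12_neq0).
Local Notation mX := (@mX F n q12).
Local Notation levX := (@levX F n q12).
Local Notation eigY i := (@wdiag F n q12 k0 k kn (Yword n (@nat_of_ord n i).+1)).
Local Notation qmonomial := (qmonomial q12 k0 k kn).
Local Notation triangular := (@triangular F n q12).

Let q0 : q q12 != 0. Proof. by rewrite expf_neq0. Qed.

Lemma qmonomial_inj e e' x : qmonomial e x -> qmonomial e' x -> e = e'.
Proof.
move=> [b [c [d ->]]] [b' [c' [d' E]]].
have [|/eqP] := generic (a := e - e') (b := b - b') (c := c - c') (d := d - d'); last by rewrite subr_eq0 => /eqP.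
rewrite !expfzDr // -!invr_expz.
have -> : q q12 ^ e / q q12 ^ e' * (k0 ^ b / k0 ^ b') * (kn ^ c / kn ^ c') * (k ^ d / k ^ d') =
  (q q12 ^ e * k0 ^ b * kn ^ c * k ^ d) / (q q12 ^ e' * k0 ^ b' * kn ^ c' * k ^ d').
  by field; rewrite !expfz_neq0.
by rewrite E mulfV // !mulf_neq0 ?expfz_neq0.
Qed.

Lemma eigY_qmonomial i (nu : vec) : qmonomial (- nu i) (eigY i nu).
Proof. exact: Yeigen_qmonomial. Qed.

Lemma eigY_inj (lam mu : vec) : (forall i, eigY i lam = eigY i mu) -> lam = mu.
Proof.
move=> E; apply/ffunP => i; apply/oppr_inj/(qmonomial_inj (eigY_qmonomial i lam)).
by rewrite E; apply: eigY_qmonomial.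
Qed.

Lemma YX_lin i : linX (YX i).
Proof. by move=> a f g; apply: word_linear. Qed.

Lemma YXZ i a f : YX i (a *: f) = a *: YX i f.
Proof. by have := @YX_lin i a f 0; rewrite !addr0 linX0 ?addr0 //; apply: YX_lin. Qed.

Lemma YXB i f g : YX i (f - g) = YX i f - YX i g.
Proof. by rewrite addrC -scaleN1r YX_lin scaleN1r addrC. Qed.

Lemma YX_tri (i : 'I_n) : triangular (YX i.+1) (eigY i).
Proof. exact: YX_triangular. Qed.

(** One operator in place of the commuting family. For each $\mu\ne m$ a coincidence of diagonal
    entries makes x a root of a nonzero polynomial, so some x separates m from all other
    exponents. *)
Let mixY (x : F) (f : X) : X := \sum_(i < n) x ^+ i *: YX i.+1 f.

Let mixY_lin x : linX (mixY x).
Proof.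
move=> a f g; rewrite /mixY scaler_sumr -big_split; apply: eq_bigr => i _ /=.
by rewrite YX_lin scalerDr !scalerA mulrC.
Qed.

Let mixY_tri x : triangular (mixY x) (fun nu => \sum_(i < n) x ^+ i * eigY i nu).
Proof.
move=> nu; rewrite /mixY; elim/big_ind2: _ => [|f c g d [r [-> rl]] [r' [-> rl']]|i _].
- by exists 0; rewrite scale0r addr0; split=> //; apply: lowX0.
- by exists (r + r'); rewrite scalerDl addrACA; split=> //; apply: lowXD.
- have [r [-> rl]] := YX_tri i nu; exists (x ^+ i *: r); rewrite scalerDr scalerA.
  by split=> //; apply: lowXZ.
Qed.

Let mixY_sep m : exists x, forall mu, mu <> m ->
  \sum_(i < n) x ^+ i * eigY i mu != \sum_(i < n) x ^+ i * eigY i m.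
Proof.
pose P N : {poly F} := if @unpickle vec N is Some mu then
  \sum_(i < n) (eigY i mu - eigY i m) *: 'X^i else 0.
have [x xP] := avoid_roots uncountable P; exists x => mu mum.
have := xP (pickle mu); rewrite /P pickleK => H; rewrite -subr_eq0 -sumrB.
have -> : \sum_(i < n) (x ^+ i * eigY i mu - x ^+ i * eigY i m) =
  (\sum_(i < n) (eigY i mu - eigY i m) *: 'X^i).[x].
  by rewrite horner_sum; apply: eq_bigr => i _; rewrite hornerZ hornerXn -mulrBr mulrC.
apply: H; apply/eqP => P0; apply: mum; apply: eigY_inj => i.
have := congr1 (fun p : {poly F} => p`_i) P0; rewrite /= coef0 coef_sum (bigD1 i) //=.
rewrite coefZ coefXn eqxx mulr1 big1 => [|j ji]; first by rewrite addr0 => /subr0_eq.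
by rewrite coefZ coefXn eq_sym (inj_eq val_inj) (negbTE ji) mulr0.
Qed.

(** Among Laurent polynomials the eigenspace of [mixY] at m is a line; each $Y_i$ commutes with
    [mixY], hence preserves it, and its eigenvalue is read off at the top exponent. *)
Lemma joint_eigenvector m : exists P, lcoef P m = 1 /\
  forall i : 'I_n, YX i.+1 (levX P) = eigY i m *: levX P.
Proof.
have [x sep] := mixY_sep m.
have [P [P1 [EP [r [Pr [s [rs sl]]]]]]] := eigenvector_exists uncountable q12_neq0 (mixY_lin x) (mixY_tri x) sep.
have top : is_top P m.
  rewrite /is_top P1 oner_neq0; split=> // mu; apply: contraR; rewrite -ltNge => lt.
  have -> : lcoef P mu = lcoef ((m, 1) :: s) mu.
    by apply: (levX_lcoef uncountable q12_neq0); rewrite Pr rs levX_cons scale1r.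
  rewrite lcoef_cons /= lcoef_out ?addr0.
    by have [E|_] := eqVneq m mu; [rewrite E ltxx in lt | rewrite eqxx].
  by apply/mapP => -[p /sl ps El]; rewrite -El in ps; have := lt_trans ps lt; rewrite ltxx.
exists P; split=> // i; have [s' Es'] := triangular_levX P (@YX_lin i.+1) (YX_tri i).
have E : YX i.+1 (levX P) = lcoef s' m *: levX P.
  rewrite Es'; apply: (joint_eigen_unique uncountable q12_neq0 (I := unit) (fun _ => mixY_lin x)
    (fun _ => mixY_tri x) (c := fun _ => \sum_(i < n) x ^+ i * eigY i m)) => //.
    move=> lam /(_ tt) El; apply: contrapT => /sep; rewrite El eqxx //.
  move=> _; rewrite -Es' -YXZ -EP /mixY; rewrite (big_morph (YX i.+1) (op1 := +%R) (id1 := 0)).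
  - by apply: eq_bigr => j _; rewrite YXZ YX_comm.
  - by move=> f g; have := @YX_lin i.+1 1 f g; rewrite !scale1r.
  - exact: linX0 (@YX_lin _).
by rewrite E (eigen_top uncountable q12_neq0 (@YX_lin i.+1) (YX_tri i) top E).
Qed.

Lemma eigenvector_unique m P s : lcoef P m = 1 ->
  (forall i : 'I_n, YX i.+1 (levX P) = eigY i m *: levX P) ->
  (forall i : 'I_n, YX i.+1 (levX s) = eigY i m *: levX s) -> levX s = lcoef s m *: levX P.
Proof.
move=> P1 EP Es; apply: (joint_eigen_unique uncountable q12_neq0 (I := 'I_n)
  (fun i => @YX_lin i.+1) YX_tri (c := fun i => eigY i m)) => //.
by move=> lam; apply: eigY_inj.
Qed.

Lemma eigenvector_weight s (c : 'I_n -> F) : levX s != 0 ->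
  (forall i : 'I_n, YX i.+1 (levX s) = c i *: levX s) -> exists lam, forall i, eigY i lam = c i.
Proof.
move=> /top_exists [lam lt] E; exists lam => i.
exact: (eigen_top uncountable q12_neq0 (@YX_lin i.+1) (YX_tri i) lt).
Qed.

Lemma TX_levX j s : (j <= n)%N -> exists s', TX j (levX s) = levX s'.
Proof.
move=> jn; elim: s => [|[mu c] s [s' E]].
  by exists [::]; rewrite levX_nil -(scale0r (0 : X)) TXZ !scale0r.
have [r0 [Em low]] := TX_mX n_ge2 q12_neq0 k0_neq0 k_neq0 kn_neq0 u0_neq0 un_neq0 mu jn.
have [r [Er _]] := low mu mu erefl; rewrite Er in Em.
have [s1 E1] : exists s1, TX j (mX mu) = levX s1.
  by eexists ((_, _) :: (_, _) :: r); rewrite Em !levX_cons /= addrA.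
exists ([seq (p.1, c * p.2) | p <- s1] ++ s').
by rewrite levX_cons TX_linear E1 E levX_cat levX_scale.
Qed.

Lemma eigY_const m (i : 'I_n) : eigY i (constvec n m) =
  q q12 ^ (- m) * (k0 * kn * k ^+ n.-1) ^ eta_sgn m * k ^ (2 * (i : nat)%:Z - (n%:Z - 1)).
Proof.
rewrite /= Yeigen_const // gamma_const // !invfM !invr_expz opprK; congr (_ * _ ^ _); ring.
Qed.

End Koornwinder.

(** * Symmetric eigenvectors and the affine relation *)

Section SymmetricEigenvectors.
Variables (F : closedFieldType) (n : nat) (q12 k0 k kn u0 un : F).
Hypothesis uncountable : forall f : nat -> F, exists x : F, forall i, f i != x.
Hypothesis n_ge2 : (2 <= n)%N.
Hypothesis q12_neq0 : q12 != 0.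
Hypotheses (k0_neq0 : k0 != 0) (k_neq0 : k != 0) (kn_neq0 : kn != 0).
Hypotheses (u0_neq0 : u0 != 0) (un_neq0 : un != 0).
Hypothesis generic : forall a b c d : int,
  (q q12) ^ a * k0 ^ b * kn ^ c * k ^ d = 1 -> a = 0 /\ d = 0.
Local Notation gpt := (gpt n q12).
Local Notation X := (gpt -> F^o).
Local Notation TX := (@TX F n q12 k0 k kn u0 un n_ge2 q12_neq0).
Local Notation YX := (@YX F n q12 k0 k kn u0 un n_ge2 q12_neq0).
Local Notation levX := (@levX F n q12).
Local Notation eigY i := (@wdiag F n q12 k0 k kn (Yword n (@nat_of_ord n i).+1)).
Local Notation qmonom := (@qmonomial F q12 k0 k kn).

Let q0 : q q12 != 0. Proof. by rewrite expf_neq0. Qed.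
Let TXs := TXZ k0 k kn u0 un n_ge2 q12_neq0.
Let TXK' := TXK n_ge2 q12_neq0 k0_neq0 k_neq0 kn_neq0 u0_neq0 un_neq0.

Definition symX (u : X) := forall j, (0 < j < n)%N -> TX j u = k^-1 *: u.
Definition affX (psi : F) (u : X) := TX 0 (tailop n TX 1 u) = psi *: u.

Lemma apply_plain w f :
  apply_word (@opX F n q12 k0 k kn u0 un n_ge2 q12_neq0) (plain w) f = foldr TX f w.
Proof. by elim: w => //= j w ->. Qed.

Lemma YX1_sym u : symX u -> YX 1 u = k^-1 ^+ n.-1 *: TX 0 (tailop n TX 1 u).
Proof.
move=> us; rewrite /YX /Yword /= /opX /= -TXs; congr (TX 0 _).
rewrite /apply_word foldr_cat -!/(apply_word _ _ _) -![[seq (j, false) | j <- _]]/(plain _) !apply_plain.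
rewrite /tailop !subn1 /=.
have -> : foldr TX u (rev (iota 1 n.-1)) = k^-1 ^+ n.-1 *: u.
  have H w : all (fun j => (0 < j < n)%N) w -> foldr TX u w = k^-1 ^+ size w *: u.
    elim: w => [|j w IH] /=; first by rewrite expr0 scale1r.
    by case/andP => jn /IH ->; rewrite TXs us // scalerA exprSr.
  rewrite H ?size_rev ?size_iota //.
  by apply/allP => j; rewrite mem_rev mem_iota; lia.
by elim: (iota 1 n) => //= j w ->; rewrite TXs.
Qed.

(** On symmetric vectors $Y_1$ is $k^{1-n}T_0T_1\cdots T_n$, and each step
    $Y_{i+1}=T_i^{-1}Y_iT_i^{-1}$ multiplies the eigenvalue by $k^2$. *)
Lemma sym_YX psi u (i : 'I_n) : symX u -> affX psi u ->
  YX i.+1 u = (psi * k ^ (2 * (i : nat)%:Z - (n%:Z - 1))) *: u.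
Proof.
move=> us ua; case: i => i /=; elim: i => [|i IH] i_n.
  rewrite YX1_sym // ua scalerA mulrC; congr (_ * _ *: _).
  by rewrite exprVn exprnP invr_expz; congr (_ ^ _); lia.
have i_m : (0 < i.+1 < n)%N by lia.
have := YX_rec n_ge2 q12_neq0 k0_neq0 k_neq0 kn_neq0 u0_neq0 un_neq0 u i_m.
rewrite IH; last lia.
move/(congr1 (TX' k0 k kn u0 un n_ge2 q12_neq0 i.+1)); rewrite TXK' 1?ltnW // us // YXZ.
move/(congr1 ( *:%R k)); rewrite scalerA mulfV // scale1r => <-.
have [e1 e2] : (i.+1 == 0)%N = false /\ (i.+1 == n) = false by split; lia.
rewrite /TX' TXs us // !scalerA -scalerBl scalerA; congr (_ *: _).
rewrite /lA /kap e1 e2.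
set e := 2 * i%:Z - (n%:Z - 1).
have -> : 2 * (i.+1)%:Z - (n%:Z - 1) = e + 2%:Z by rewrite /e; lia.
by rewrite (expfzDr e) // -exprnP; field; exact: k_neq0.
Qed.

Lemma eigY_step m (i j : 'I_n) : j = i.+1 :> nat ->
  eigY j (constvec n m) = k ^+ 2 * eigY i (constvec n m).
Proof.
move=> ji; rewrite /= !eigY_const // ji.
have -> : 2 * (i.+1)%:Z - (n%:Z - 1) = 2%:Z + (2 * (i : nat)%:Z - (n%:Z - 1)) by lia.
by rewrite expfzDr // -exprnP; ring.
Qed.

(** The affine Hecke intertwiner $T_j-(k^{-1}-k)/(1-e_{i_2}/e_{i_1})$ exchanges two eigenvalues; for
    the ratio $k^2$ its scalar is $k^{-1}$. *)
Lemma intertwine (e : 'I_n -> F) u j (i1 i2 i : 'I_n) : (0 < j < n)%N ->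
  i1.+1 = j :> nat -> i2 = j :> nat -> (forall i, YX (nat_of_ord i).+1 u = e i *: u) ->
  e i2 = k ^+ 2 * e i1 ->
  YX i.+1 (TX j u - k^-1 *: u) =
  (if i == i1 then e i2 else if i == i2 then e i1 else e i) *: (TX j u - k^-1 *: u).
Proof.
move=> jn i1j i2j EP step; have jn' : (j <= n)%N by lia.
rewrite YXB YXZ EP; set v := TX j u.
have rec f := YX_rec n_ge2 q12_neq0 k0_neq0 k_neq0 kn_neq0 u0_neq0 un_neq0 f jn.
have lAE : lA n k0 k kn j = k^-1 - k.
  have [e1 e2] : (j == 0)%N = false /\ (j == n) = false by split; lia.
  by rewrite /lA /kap e1 e2.
have E1 : YX j u = e i1 *: u by rewrite -i1j EP.
have E2 : YX j.+1 u = e i2 *: u by rewrite -i2j EP.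
case: eqP => [->|ne1].
  have Y1 : YX j u = TX j (YX j.+1 v) by rewrite rec.
  have Y2 : YX j v = lA n k0 k kn j *: YX j u + e i2 *: v.
    by rewrite rec /v TX_quadratic // YX_lin TX_linear -/v -Y1 E2 TXs.
  rewrite i1j Y2 E1 scalerBr addrC addrA [RHS]addrC; congr (_ + _).
  by rewrite !scalerA -!scaleNr -scalerDl; congr (_ *: _); rewrite lAE step; field; exact: k_neq0.
case: eqP => [->|ne2].
  have Y1 : YX j.+1 v = TX' k0 k kn u0 un n_ge2 q12_neq0 j (YX j u) by rewrite rec TXK'.
  rewrite i2j Y1 E1 /TX' TXs -/v scalerBr -addrA; congr (_ + _).
  by rewrite !scalerA -!scaleNr -scalerDl; congr (_ *: _); rewrite lAE step; field; exact: k_neq0.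
rewrite -YX_T //; last first.
- by apply/eqP => E; apply: ne2; apply: val_inj; rewrite /= i2j.
- by apply/eqP => E; apply: ne1; apply: val_inj => /=; apply: succn_inj; rewrite i1j.
- by lia.
by rewrite EP TXs scalerBr !scalerA mulrC.
Qed.

(** After the exchange all eigenvalues still have q-exponent -m, so they could only belong to (m,
    ..., m) itself; comparing them there gives $k^2=1$, which genericity excludes. *)
Lemma eigenvector_sym m P :
  (forall i : 'I_n, YX i.+1 (levX P) = eigY i (constvec n m) *: levX P) -> symX (levX P).
Proof.
move=> EP j jn; apply/eqP; rewrite -subr_eq0; apply: contraT => Q0.
have jn' : (j <= n)%N by lia.
have [sT ET] := TX_levX n_ge2 q12_neq0 k0_neq0 k_neq0 kn_neq0 u0_neq0 un_neq0 P jn'.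
have [s Es] : exists s, TX j (levX P) - k^-1 *: levX P = levX s.
  exists (sT ++ [seq (p.1, - k^-1 * p.2) | p <- P]).
  by rewrite levX_cat levX_scale scaleNr ET.
have [i1 i1j] : exists i : 'I_n, i.+1 = j :> nat.
  have h : (j.-1 < n)%N by lia.
  by exists (Ordinal h) => /=; lia.
have [i2 i2j] : exists i : 'I_n, i = j :> nat.
  have h : (j < n)%N by lia.
  by exists (Ordinal h).
have step : eigY i2 (constvec n m) = k ^+ 2 * eigY i1 (constvec n m).
  by apply: eigY_step; rewrite i1j.
pose c (i : 'I_n) := if i == i1 then eigY i2 (constvec n m)
   else if i == i2 then eigY i1 (constvec n m) else eigY i (constvec n m).
have Ec (i : 'I_n) : YX i.+1 (levX s) = c i *: levX s.
  by rewrite -Es; apply: (@intertwine (fun i => eigY i (constvec n m))).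
have [lam El] : exists lam, forall i, eigY i lam = c i.
  by apply: (eigenvector_weight uncountable k0_neq0 k_neq0 kn_neq0 u0_neq0 un_neq0 _ Ec); rewrite -Es.
have lm : lam = constvec n m.
  apply/ffunP => i; rewrite [RHS]ffunE; apply/oppr_inj/(qmonomial_inj q12_neq0 k0_neq0 k_neq0 kn_neq0 generic).
    exact: (eigY_qmonomial un n_ge2 q12_neq0 k0_neq0 k_neq0 kn_neq0 i lam).
  rewrite El /c.
  have cm (i' : 'I_n) : qmonom (- m) (eigY i' (constvec n m)).
    have : qmonom (- constvec n m i') (eigY i' (constvec n m)) by apply: eigY_qmonomial.
    by rewrite ffunE.
  by do 2?case: ifP => _; apply: cm.
have := El i1; rewrite /c eqxx lm step => E.
have [|_ //] := generic (a := 0) (b := 0) (c := 0) (d := 2%:Z).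
rewrite !expr0z !mul1r -exprnP; apply: (mulIf (x := eigY i1 (constvec n m))).
  by rewrite /= eigY_const // !mulf_neq0 ?expfz_neq0 ?mulf_neq0 ?expf_neq0.
by rewrite -E mul1r.
Qed.

Lemma eigenvector_aff m P :
  (forall i : 'I_n, YX i.+1 (levX P) = eigY i (constvec n m) *: levX P) ->
  affX (q q12 ^ (- m) * (k0 * kn * k ^+ n.-1) ^ eta_sgn m) (levX P).
Proof.
move=> EP; have us := eigenvector_sym EP; rewrite /affX.
have n0 : (0 < n)%N by lia.
have E : YX 1 (levX P) = eigY (Ordinal n0) (constvec n m) *: levX P := EP (Ordinal n0).
move: E; rewrite (YX1_sym us) eigY_const //=.
move/(congr1 ( *:%R (k ^+ n.-1))); rewrite !scalerA -exprMn mulfV // expr1n scale1r => ->.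
congr (_ *: _); rewrite mulrCA -[RHS]mulr1; congr (_ * _).
by rewrite exprnP -expfzDr // (_ : _ + _ = 0) ?expr0z //; lia.
Qed.

(** By [sym_YX] the eigenvalues differ by powers of k, so their q-exponents agree, and with them all
    entries of lambda. *)
Lemma sym_aff_weight psi s : levX s != 0 -> symX (levX s) -> affX psi (levX s) ->
  exists m, psi = q q12 ^ (- m) * (k0 * kn * k ^+ n.-1) ^ eta_sgn m.
Proof.
move=> s0 us ua; have n0 : (0 < n)%N by lia.
pose i0 := Ordinal n0.
have [lam El] := eigenvector_weight uncountable k0_neq0 k_neq0 kn_neq0 u0_neq0 un_neq0 s0 (fun i => sym_YX i us ua).
have lm : lam = constvec n (lam i0).
  apply/ffunP => i; rewrite [RHS]ffunE; apply: oppr_inj.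
  apply: (qmonomial_inj q12_neq0 k0_neq0 k_neq0 kn_neq0 generic
    (eigY_qmonomial un n_ge2 q12_neq0 k0_neq0 k_neq0 kn_neq0 i lam)).
  have -> : eigY i lam = eigY i0 lam * k ^ (2 * (i : nat)%:Z).
    rewrite !El -mulrA -expfzDr //; congr (_ * k ^ _); rewrite /=; lia.
  apply: qmonomialMr => //; first exact: (eigY_qmonomial un n_ge2 q12_neq0 k0_neq0 k_neq0 kn_neq0).
  by exists 0, 0, (2 * (i : nat)%:Z); rewrite !expr0z !mul1r.
exists (lam i0); have := El i0.
have -> : eigY i0 lam = eigY i0 (constvec n (lam i0)) by rewrite -lm.
rewrite eigY_const //.
by move/(mulIf (expfz_neq0 _ k_neq0)).
Qed.

End SymmetricEigenvectors.

(** * Minimal coset representatives and sign patterns *)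

Section SignedPermutations.
Variable n : nat.
Hypothesis n_ge2 : (2 <= n)%N.
Local Notation vec := {ffun 'I_n -> int}.
Local Notation flip := (flipsign n).

Definition wvec (s : seq nat) (x : vec) : vec := foldr (@sact n) x s.
Definition wsign (s : seq nat) (d : nat -> bool) : nat -> bool := foldr flip d s.
Definition plus : nat -> bool := fun _ => false.
Definition same_sign (d d' : nat -> bool) : Prop := forall i, (i < n)%N -> d i = d' i.

Lemma at_nat_ord (nu : vec) (i : 'I_n) : at_nat nu i = nu i.
Proof.
rewrite /at_nat (bigD1 i) //= big1 ?addr0 // => j' /andP[/eqP jj /eqP []]; exact: val_inj.
Qed.

Lemma sactE j (nu : vec) : (0 < j <= n)%N -> sact j nu = iact j nu.
Proof.
move=> jn; apply/ffunP => i; have [E|jn'] := eqVneq j n.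
  by subst j; rewrite iact_n // ffunE eqxx.
by rewrite iact_mid ?ffunE ?(negbTE jn') //; lia.
Qed.

Definition letter_perm (j : nat) (i : 'I_n) : 'I_n :=
  if j == n then i else if (i : nat) == j.-1 then insubd i j
  else if (i : nat) == j then insubd i j.-1 else i.

Lemma letter_permE j (i : 'I_n) : (0 < j <= n)%N -> letter_perm j i =
  (if j == n then i : nat else if (i : nat) == j.-1 then j
  else if (i : nat) == j then j.-1 else i) :> nat.
Proof.
move=> jn; rewrite /letter_perm; case: eqVneq => // jn'; case: eqVneq => [E|_].
  by rewrite val_insubd (_ : (j < n)%N) //; lia.
by case: eqVneq => // E; rewrite val_insubd (_ : (j.-1 < n)%N) //; lia.
Qed.

Lemma letter_permK j : (0 < j <= n)%N -> involutive (letter_perm j).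
Proof.
move=> jn i; apply: ord_inj; rewrite letter_permE //.
have := letter_permE i jn; move: (letter_perm j i) => i' ->.
case: (eqVneq j n) => // jn'; have e : j == j.-1 = false by lia.
case: (eqVneq (i : nat) j.-1) => [->|h1]; first by rewrite e eqxx.
case: (eqVneq (i : nat) j) => [->|h2]; first by rewrite eqxx.
by rewrite (negbTE h1) (negbTE h2).
Qed.

Lemma sact_perm j (x : vec) (i : 'I_n) : (0 < j <= n)%N ->
  sact j x i = if (j == n) && ((i : nat) == n.-1) then - x (letter_perm j i) else x (letter_perm j i).
Proof.
move=> jn; have := letter_permE i jn; rewrite ffunE /letter_perm; case: eqVneq => //= jn'.
case: eqVneq => [ij E|_]; first by rewrite -{1}E at_nat_ord.
by case: eqVneq => [ij E|//]; rewrite -{1}E at_nat_ord.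
Qed.

Lemma wvec_perm s : legal n s -> exists (sg : 'I_n -> 'I_n) (e : 'I_n -> bool),
  injective sg /\ forall x i, wvec s x i = if e i then - x (sg i) else x (sg i).
Proof.
elim: s => [|j s IH] /=.
  by move=> _; exists id, (fun _ => false); split; first exact: inj_id.
case/andP => jn /IH [sg [e [sgI H]]].
exists (sg \o letter_perm j),
  (fun i : 'I_n => ((j == n) && ((i : nat) == n.-1)) (+) e (letter_perm j i)); split.
  exact: inj_comp sgI (inv_inj (letter_permK jn)).
move=> x i; rewrite sact_perm // -/(wvec s x) H /=.
by case: (_ && _); case: (e _) => //=; rewrite opprK.
Qed.

(** Such a vector has trivial stabiliser in the hyperoctahedral group, so its image determines the
    element. *)
Definition regular (x : vec) : Prop := injective x /\ forall i, 0 < x i.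

Lemma wvec_faithful x s s' : regular x -> legal n s -> legal n s' -> wvec s x = wvec s' x ->
  forall y, wvec s y = wvec s' y.
Proof.
move=> [xI x0] /wvec_perm [sg [e [_ H]]] /wvec_perm [sg' [e' [_ H']]] E y; apply/ffunP => i.
have := congr1 (fun f : vec => f i) E; rewrite H H' (H y) (H' y).
have := x0 (sg i); have := x0 (sg' i).
by case: (e i); case: (e' i) => a b; [move/oppr_inj/xI->| lia | lia | move/xI->].
Qed.

Lemma wvecN s x : legal n s -> wvec s (- x) = - wvec s x.
Proof.
move=> /wvec_perm [sg [e [_ H]]]; apply/ffunP => i; rewrite [RHS]ffunE !H ffunE.
by case: ifP.
Qed.

Lemma wvec_cat s s' x : wvec (s ++ s') x = wvec s (wvec s' x).
Proof. exact: foldr_cat. Qed.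

Lemma sactK j : (0 < j <= n)%N -> involutive (@sact n j).
Proof.
move=> jn x; apply/ffunP => i; rewrite !sact_perm // letter_permK // letter_permE //.
case: (eqVneq j n) => //= _.
by case: (eqVneq (i : nat) n.-1) => //; rewrite opprK.
Qed.

Lemma wvec_revK s x : legal n s -> wvec (rev s) (wvec s x) = x.
Proof.
elim: s x => //= j s IH x /andP[jn ls].
by rewrite rev_cons -cats1 wvec_cat /= sactK // IH.
Qed.

Lemma legal_cat s s' : legal n (s ++ s') = legal n s && legal n s'.
Proof. exact: all_cat. Qed.

Lemma legal_rev s : legal n (rev s) = legal n s.
Proof. exact: all_rev. Qed.

Lemma wsign_cat s s' d : wsign (s ++ s') d = wsign s (wsign s' d).
Proof. exact: foldr_cat. Qed.

Lemma flipsign_ext j d d' : (0 < j <= n)%N -> same_sign d d' -> same_sign (flip j d) (flip j d').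
Proof.
move=> jn H i i_n; rewrite /flipsign.
have [e1 e2 e3] : [/\ (j == 0)%N = false, (j.-1 < n)%N & (n.-1 < n)%N] by split; lia.
rewrite e1; case: eqP => [_|jn']; first by rewrite H.
rewrite !H //; lia.
Qed.

Lemma wsign_ext s d d' : legal n s -> same_sign d d' -> same_sign (wsign s d) (wsign s d').
Proof.
by move=> + H; elim: s => //= j s IH /andP[jn /IH h]; apply: flipsign_ext.
Qed.

Lemma flipsignK j d : (0 < j <= n)%N -> flip j (flip j d) =1 d.
Proof.
move=> jn i; rewrite /flipsign; have -> : (j == 0)%N = false by lia.
case: (eqVneq j n) => [_|jn'].
  by case: (eqVneq i n.-1) => // _; rewrite negbK.
have [e1 e2] : (j == j.-1 = false) /\ (j.-1 == j = false) by split; lia.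
rewrite !eqxx ?e1 ?e2; case: (eqVneq i j.-1) => [E|_]; first by rewrite ?E ?e1 ?e2 ?eqxx.
by case: (eqVneq i j) => [E|//]; rewrite E.
Qed.

Lemma wsign_revK s d : legal n s -> same_sign (wsign (rev s) (wsign s d)) d.
Proof.
elim: s d => //= j s IH d /andP[jn ls] i i_n.
rewrite rev_cons -cats1 wsign_cat.
rewrite (@wsign_ext (rev s) _ (wsign s d)) ?legal_rev ?IH // => l ln; exact: flipsignK.
Qed.

Lemma flipsignN j d i : flip j (fun l => ~~ d l) i = ~~ flip j d i.
Proof. by rewrite /flipsign; do ![case: ifP => // _]. Qed.

Lemma wvec_sign s (x : vec) : legal n s -> (forall i, 0 < x i) ->
  (forall i, wvec s x i != 0) /\ forall i : 'I_n, (wvec s x i < 0) = wsign s plus i.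
Proof.
move=> ls x0; elim: s ls => [|j s IH] /=.
  move=> _; split=> i; have h := x0 i; first exact: lt0r_neq0.
  by rewrite ltNge (ltW h).
case/andP => jn /IH [H0 H]; split=> i; rewrite sact_perm // -/(wvec s x).
  by case: ifP; rewrite ?oppr_eq0.
have := letter_permE i jn; rewrite /flipsign; have -> : (j == 0)%N = false by lia.
case: eqVneq => /= [_|jn'] E.
  have -> : letter_perm j i = i by apply: ord_inj.
  case: eqP => _ //; rewrite -?H //.
  by rewrite oppr_lt0 -leNgt le_eqVlt eq_sym (negbTE (H0 i)).
by rewrite H E; case: eqVneq => // _; case: eqVneq.
Qed.

(* Heights: a word of size h(d) leading from the all-plus pattern to d is made of raising letters. *)

Definition height (d : nat -> bool) : nat := \sum_(i < n) (if d i then n - i else 0).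

Lemma height_ext d d' : same_sign d d' -> height d = height d'.
Proof. by move=> H; apply: eq_bigr => i _; rewrite H. Qed.

Lemma height_flip j d : (0 < j <= n)%N ->
  (height (flip j d) <= (height d).+1)%N /\
  ((height (flip j d) == (height d).+1) = raises n j d).
Proof.
move=> jn; have n1 : (n.-1 < n)%N by lia.
rewrite /height /flipsign /raises; have -> : (j == 0)%N = false by lia.
have [E|jn'] := eqVneq j n.
  rewrite (bigD1 (Ordinal n1)) //= eqxx [in X in (_ <= X.+1)%N /\ _](bigD1 (Ordinal n1)) //=.
  rewrite [in X in _ /\ (_ == X.+1) = _](bigD1 (Ordinal n1)) //=.
  set S := \sum_(i < n | _) (if d i then _ else _).
  have -> : \sum_(i < n | i != Ordinal n1) (if if (i : nat) == n.-1 then ~~ d i else d i then (n - i)%N else 0%N) = S.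
    apply: eq_bigr => i ni; case: eqP => // h; case/eqP: ni; exact: ord_inj.
  by case: (d n.-1) => /=; split; lia.
have j1n : (j.-1 < n)%N by lia.
have jjn : (j < n)%N by lia.
have ne : Ordinal jjn != Ordinal j1n by rewrite -val_eqE /=; lia.
pose S := (\sum_(i < n | (i != Ordinal j1n) && (i != Ordinal jjn)) (if d i then n - i else 0))%N.
have E f : \sum_(i < n) f i = (f (Ordinal j1n) + (f (Ordinal jjn) +
   \sum_(i < n | (i != Ordinal j1n) && (i != Ordinal jjn)) f i))%N :> nat.
  by rewrite (bigD1 (Ordinal j1n)) //= (bigD1 (Ordinal jjn)).
rewrite !E /= eqxx.
have -> : \sum_(i < n | (i != Ordinal j1n) && (i != Ordinal jjn))
   (if if (i : nat) == j.-1 then d j else if (i : nat) == j then d j.-1 else d i then (n - i)%N else 0%N) = S.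
  apply: eq_bigr => i /andP[]; rewrite -!val_eqE /= => h1 h2.
  by rewrite (negbTE h1) (negbTE h2).
have e : j == j.-1 = false by lia.
rewrite e eqxx -/S jjn; have -> : (0 < j)%N by lia.
by case: (d j.-1); case: (d j) => /=; split; lia.
Qed.

Fixpoint allraise (s : seq nat) (d : nat -> bool) : bool :=
  if s is j :: s' then allraise s' d && raises n j (wsign s' d) else true.

Lemma height_plus : height plus = 0%N.
Proof. by rewrite /height big1. Qed.

Lemma height_word s : legal n s -> (height (wsign s plus) <= size s)%N /\
  ((height (wsign s plus) == size s) = allraise s plus).
Proof.
elim: s => [|j s IH] /=; first by rewrite height_plus.
case/andP => jn /IH [H1 H2]; have [H3 H4] := height_flip (wsign s plus) jn.
by split; first lia; rewrite -H2 -H4; apply/idP/idP => [|/andP[]]; lia.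
Qed.

Lemma raises_legal j d : raises n j d -> (0 < j <= n)%N.
Proof. by rewrite /raises; case: eqVneq => [->|_ /and3P[]]; lia. Qed.

Lemma allraise_legal s d : allraise s d -> legal n s.
Proof. by elim: s => //= j s IH /andP[/IH -> /raises_legal ->]. Qed.

(** The last minus sign, at place i, is undone by the letter i + 1: it moves one place to the right,
    or disappears when i is the last place. Either way the height drops by one. *)
Lemma raising_word d : exists s, allraise s plus /\ same_sign (wsign s plus) d.
Proof.
have [N] := ubnP (height d); elim: N d => // N IH d dN.
have [/existsP [i0 di0]|/existsPn H] := boolP [exists i : 'I_n, d i]; last first.
  by exists [::]; split=> // i i_n; rewrite (negbTE (H (Ordinal i_n))).
have [i [i_n di imax]] : exists i, [/\ (i < n)%N, d i & forall l, (i < l < n)%N -> ~~ d l].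
  have ex : exists i, (i < n)%N && d i by exists i0; rewrite ltn_ord.
  have ub i : (i < n)%N && d i -> (i <= n)%N by case/andP => /ltnW.
  case: (ex_maxnP ex ub) => i /andP[i_n di] imax; exists i; split=> // l /andP[il ln].
  by apply: contraL il => dl; rewrite -leqNgt imax // ln.
have jn : (0 < i.+1 <= n)%N by [].
have r : raises n i.+1 (flip i.+1 d).
  rewrite /raises /flipsign /=; case: eqVneq => [E|ne]; first by rewrite -E eqxx di.
  rewrite !eqxx [i.+1 == i]gtn_eqF // di andbT /= andbC; apply/andP; split; last by lia.
  by apply: imax; lia.
have [_ h] := height_flip (flip i.+1 d) jn; rewrite r in h.
have hK : height (flip i.+1 (flip i.+1 d)) = height d.
  by apply: height_ext => l _; apply: flipsignK.
have [|s [sr sd]] := IH (flip i.+1 d); first by move: h; rewrite hK; lia.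
exists (i.+1 :: s); split=> /=.
  rewrite sr /=; have ls := allraise_legal sr.
  have [_ <-] := height_flip (wsign s plus) jn.
  have -> : height (flip i.+1 (wsign s plus)) = height (flip i.+1 (flip i.+1 d)).
    by apply: height_ext; apply: flipsign_ext.
  by rewrite (height_ext sd).
by move=> l ln; rewrite (flipsign_ext jn sd) // flipsignK.
Qed.
End SignedPermutations.

(** * Values of raising words *)

Section Coset.
Variable n : nat.
Hypothesis n_ge2 : (2 <= n)%N.
Local Notation vec := {ffun 'I_n -> int}.
Local Notation flip := (flipsign n).
Local Notation wsign := (wsign n).

Definition count_minus (d : nat -> bool) (i : nat) : nat := \sum_(0 <= l < i) d l.

(* The value at the pattern d of any raising word applied to rho = (1, ..., n). *)
Definition canon (d : nat -> bool) : vec := [ffun i : 'I_n =>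
  if d i then (count_minus d i)%:Z - n%:Z else (i.+1)%:Z - (count_minus d i)%:Z].

(** The dominant base point for counting inversions, and the image of [rho] under the longest
    element of the parabolic subgroup. *)
Definition rhov : vec := [ffun i : 'I_n => (n - i)%:Z].

Lemma count_minusS d i : count_minus d i.+1 = (count_minus d i + d i)%N.
Proof. by rewrite /count_minus big_nat_recr. Qed.

Lemma count_minus_ext d d' i : (forall l, (l < i)%N -> d l = d' l) ->
  count_minus d i = count_minus d' i.
Proof. by move=> H; apply: eq_big_nat => l /andP[_ li]; rewrite H. Qed.

Lemma canon_ext d d' : same_sign n d d' -> canon d = canon d'.
Proof.
move=> H; apply/ffunP => i; rewrite !ffunE H // (@count_minus_ext d d') // => l li.
by apply: H; apply: ltn_trans (ltn_ord i).
Qed.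

Lemma canon_flip j d : raises n j d -> canon (flip j d) = sact j (canon d).
Proof.
move=> r; have jn := raises_legal n_ge2 r; have j0 : (j == 0)%N = false by lia.
move: r; rewrite /raises; case: (eqVneq j n) => [E|jn' /and3P[jm d1 d2]].
  subst j => dn; have cE (i : 'I_n) : count_minus (flip n d) i = count_minus d i.
    apply: count_minus_ext => l li; rewrite /flipsign j0 eqxx; case: eqP => // h.
    by have := ltn_ord i; lia.
  apply/ffunP => i; rewrite sactE // iact_n // !ffunE cE /flipsign j0 eqxx.
  by case: eqP => // h; rewrite h dn (negbTE dn); lia.
have cE l : count_minus (flip j d) l = if l == j then (count_minus d l).+1 else count_minus d l.
  have low i : (i <= j.-1)%N -> count_minus (flip j d) i = count_minus d i.
    move=> ij; apply: count_minus_ext => l' li; rewrite /flipsign j0 (negbTE jn').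
    by case: eqP => [|_]; [lia | case: eqP => //; lia].
  have [jj e] : j = j.-1.+1 /\ (j == j.-1) = false by split; lia.
  have cj : count_minus (flip j d) j = (count_minus d j).+1.
    rewrite jj !count_minusS -jj low // /flipsign j0 (negbTE jn') eqxx d2 (negbTE d1); lia.
  case: eqVneq => [->//|lj]; have [h|h] := leqP l j.-1; first exact: low.
  have {h} : (j.+1 <= l)%N by lia.
  elim: l {lj} => // l IH; rewrite leq_eqVlt ltnS => /orP[/eqP [<-]|jl].
    rewrite !count_minusS cj /flipsign j0 (negbTE jn') e eqxx d2 (negbTE d1); lia.
  rewrite !count_minusS (IH jl) /flipsign j0 (negbTE jn').
  have [e1 e2] : (l == j.-1) = false /\ (l == j) = false by split; lia.
  by rewrite e1 e2.
have at_canon e l : (l < n)%N -> at_nat (canon e) l =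
    if e l then (count_minus e l)%:Z - n%:Z else (l.+1)%:Z - (count_minus e l)%:Z.
  exact: (at_ffun (fun l => if e l then (count_minus e l)%:Z - n%:Z else (l.+1)%:Z - (count_minus e l)%:Z)).
have jm' : (0 < j < n)%N by lia.
have jj : j = j.-1.+1 by lia.
have cj : count_minus d j = count_minus d j.-1 by rewrite {1}jj count_minusS (negbTE d1) addn0.
apply/ffunP => i; rewrite sactE // iact_mid // !at_canon; try lia.
rewrite !ffunE cE /flipsign j0 (negbTE jn') d2 (negbTE d1).
have e1 : (j.-1 == j) = false by lia.
case: (eqVneq (i : nat) j.-1) => [h|_]; first by rewrite ?h e1 cj.
by case: (eqVneq (i : nat) j) => [h|//]; rewrite h cj; lia.
Qed.

Lemma sactN j (x : vec) : (0 < j <= n)%N -> sact j (- x) = - sact j x.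
Proof. by move=> jn; apply: (@wvecN n n_ge2 [:: j]); rewrite /= jn. Qed.

(** Complementing all signs turns a raising step around: the same letter raises the complement of
    the new pattern to that of the old one. *)
Lemma canon_neg_flip j d : raises n j d ->
  canon (fun l => ~~ flip j d l) = sact j (canon (fun l => ~~ d l)).
Proof.
move=> r; have jn := raises_legal n_ge2 r; set e := fun l => ~~ flip j d l.
have Ed : flip j e =1 fun l => ~~ d l.
  by move=> l; rewrite /e flipsignN flipsignK.
have re : raises n j e.
  move: r; rewrite /raises /e /flipsign; have j0 : (j == 0)%N = false by lia.
  rewrite j0; case: eqVneq => [_|jn']; first by rewrite eqxx negbK.
  have e1 : (j == j.-1) = false by lia.
  by rewrite !eqxx e1 negbK => /and3P[-> -> ->].
have <- : canon (flip j e) = canon (fun l => ~~ d l) by apply: canon_ext => l _; apply: Ed.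
by rewrite canon_flip // sactK.
Qed.

(** The element of a raising word thus depends on its sign pattern alone. The second identity serves
    the words of $w(w_0^J)^{-1}$, where [rho] is first negated and reversed. *)
Lemma canon_word s : allraise n s plus -> wvec s (rho n) = canon (wsign s plus) /\
  wvec s rhov = - canon (fun l => ~~ wsign s plus l).
Proof.
elim: s => [_|j s IH] /=.
  have c0 d i : d =1 plus -> count_minus d i = 0%N.
    by move=> dp; rewrite /count_minus big1_seq // => l _; rewrite dp.
  have c1 i : count_minus (fun l => ~~ plus l) i = i.
    by elim: i => [|i IH]; rewrite ?count_minusS ?IH ?addn1 // /count_minus big_nil.
  split; apply/ffunP => i; rewrite !ffunE; first by rewrite c0 //= subr0.
  by rewrite c1 /= opprB; have := ltn_ord i; lia.
case/andP => /IH [E1 E2] r; have jn := raises_legal n_ge2 r.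
split; first by rewrite canon_flip // -E1.
by rewrite canon_neg_flip // -sactN // -E2.
Qed.

Lemma rho_regular : regular (rho n).
Proof. by split=> [i j|i]; rewrite !ffunE // => -[e]; apply: ord_inj. Qed.

Lemma rhov_regular : regular rhov.
Proof.
split=> [i j|i]; rewrite !ffunE; last by have := ltn_ord i; lia.
by move=> e; apply: ord_inj; have := ltn_ord i; have := ltn_ord j; lia.
Qed.

End Coset.

(** * Length as the number of inversions *)

Section Length.
Variable n : nat.
Hypothesis n_ge2 : (2 <= n)%N.
Local Notation vec := {ffun 'I_n -> int}.

Lemma at_natE (nu : vec) l (ln : (l < n)%N) : at_nat nu l = nu (Ordinal ln).
Proof. exact: (at_nat_ord nu (Ordinal ln)). Qed.

Definition negpairs (nu : vec) : nat :=
  \sum_(p : 'I_n * 'I_n | (p.1 < p.2)%N) ((nu p.1 < nu p.2)%R + (nu p.1 + nu p.2 < 0)%R).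

(* The number of positive roots made negative, positive roots being e_a - e_b and e_a + e_b
   (a < b) and e_a. *)
Definition wlen (nu : vec) : nat := (\sum_(i < n) (nu i < 0)%R + negpairs nu)%N.

(** $s_j$ permutes the positive roots other than its own, and that one becomes negative on nu. *)
Lemma wlen_up j nu : (0 < j <= n)%N -> 0 < pairing j nu -> wlen (sact j nu) = (wlen nu).+1.
Proof.
move=> jn; rewrite /wlen /negpairs; have [E|jn'] := eqVneq j n.
  subst j; rewrite pairing_n // => nu0; have n1 : (n.-1 < n)%N by lia.
  have sE (i : 'I_n) : sact n nu i = if (i : nat) == n.-1 then - nu i else nu i.
    by rewrite sactE // iact_n.
  have nuE : nu (Ordinal n1) = at_nat nu n.-1 by rewrite -at_nat_ord.
  rewrite (bigD1 (Ordinal n1)) //= [in RHS](bigD1 (Ordinal n1)) //= sE /= eqxx nuE.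
  have -> : (- at_nat nu n.-1 < 0) = true by lia.
  have -> : (at_nat nu n.-1 < 0) = false by lia.
  rewrite add0n -add1n -!addnA; congr (_ + (_ + _))%N.
    by apply: eq_bigr => i ni; rewrite sE; case: eqP => // h; case/eqP: ni; apply: ord_inj.
  apply: eq_bigr => -[a b] /= ab; rewrite !sE.
  have -> : (a == n.-1 :> nat) = false by have := ltn_ord b; lia.
  case: eqP => // _; have -> : (nu a < - nu b) = (nu a + nu b < 0) by lia.
  have -> : (nu a - nu b < 0) = (nu a < nu b) by lia.
  by rewrite addnC.
have jm : (0 < j < n)%N by lia.
rewrite pairing_mid // => nu0.
have [n1 n2] : (j.-1 < n)%N /\ (j < n)%N by lia.
pose i1 := Ordinal n1; pose i2 := Ordinal n2; pose t := @letter_perm n j.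
have nu1 : nu i1 = at_nat nu j.-1 by rewrite -at_nat_ord.
have nu2 : nu i2 = at_nat nu j by rewrite -at_nat_ord.
have tE i : t i = (if (i : nat) == j.-1 then j else if (i : nat) == j then j.-1 else i) :> nat.
  by have := letter_permE n_ge2 i jn; rewrite (negbTE jn').
have tK : involutive t by apply: letter_permK.
have t1 : t i1 = i2 by apply: ord_inj; rewrite tE /= eqxx.
have t2 : t i2 = i1 by rewrite -t1 tK.
have sE i : sact j nu i = nu (t i) by rewrite sact_perm // (negbTE jn').
rewrite -addnS; congr (_ + _)%N.
  by rewrite [RHS](reindex_inj (inv_inj tK)) /=; apply: eq_bigr => i _; rewrite sE.
pose tt (p : 'I_n * 'I_n) := (t p.1, t p.2).
have ttK : involutive tt by move=> [a b]; rewrite /tt /= !tK.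
(* The reindexing preserves the order of a pair except for the two places exchanged by $s_j$; that
   pair is split off on both sides. *)
rewrite [in RHS](reindex_inj (inv_inj ttK)) /=.
rewrite (bigD1 (i1, i2)) /=; last lia.
rewrite [in RHS](bigD1 (i2, i1)) /=; last by rewrite t1 t2 /=; lia.
rewrite !sE t1 t2 nu1 nu2 -addSn; congr (_ + _)%N.
  have -> : (at_nat nu j < at_nat nu j.-1) = true by lia.
  have -> : (at_nat nu j.-1 < at_nat nu j) = false by lia.
  by rewrite add0n add1n addrC.
apply: eq_big => [[a b]|[a b] _] /=; last by rewrite !sE.
rewrite !xpair_eqE -!val_eqE /= !tE.
case: (eqVneq (a : nat) j.-1) => [ha|ha]; case: (eqVneq (b : nat) j.-1) => [hb|hb];
case: (eqVneq (a : nat) j) => [ha'|ha']; case: (eqVneq (b : nat) j) => [hb'|hb']; lia.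
Qed.

Lemma pairing_sact j (nu : vec) : (0 < j <= n)%N -> pairing j (sact j nu) = - pairing j nu.
Proof.
move=> jn; have jn' : (j <= n)%N by lia.
rewrite sactE // /pairing /iact dot_addz -/(pairing j nu).
have := ldir_sq n_ge2 jn'; move: (dot _ (ldir n j)) (pairing j nu) => D l h.
by rewrite mulNr mulrAC h; ring.
Qed.

Lemma wlen_down j nu : (0 < j <= n)%N -> pairing j nu < 0 -> wlen nu = (wlen (sact j nu)).+1.
Proof. by move=> jn h; rewrite -(wlen_up jn) ?sactK // pairing_sact // oppr_gt0. Qed.

Lemma wlen_le j nu : (0 < j <= n)%N -> (wlen (sact j nu) <= (wlen nu).+1)%N.
Proof.
move=> jn; case: (ltgtP (pairing j nu) 0) => h; last 2 first.
- by rewrite wlen_up.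
- suff -> : sact j nu = nu by [].
  rewrite sactE //; apply/ffunP => i; rewrite ffunE h mulr0 oppr0 mul0r addr0 //.
by rewrite [in X in (_ <= X)%N](wlen_down jn h); lia.
Qed.

(** n strictly increasing integers in a window of n consecutive ones fill it. *)
Lemma increasing_vec (g : nat -> int) (lo : int) :
  (forall l, (l.+1 < n)%N -> g l < g l.+1) -> (forall l, (l < n)%N -> lo <= g l < lo + n%:Z) ->
  forall l, (l < n)%N -> g l = lo + l%:Z.
Proof.
move=> gi gb l ln.
have up r : (r < n)%N -> lo + r%:Z <= g r.
  elim: r => [|r IH] rn; first by have := gb 0%N rn; lia.
  by have := IH (ltnW rn); have := gi r rn; lia.
have dn r : (r < n)%N -> g (n.-1 - r)%N <= lo + (n.-1 - r)%N%:Z.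
  elim: r => [|r IH] rn; first by have := gb (n.-1 - 0)%N; lia.
  have e : (n.-1 - r = (n.-1 - r.+1).+1)%N by lia.
  have := IH (ltnW rn); have := gi (n.-1 - r.+1)%N; rewrite -e; lia.
have := up l ln; have := dn (n.-1 - l)%N; rewrite (_ : n.-1 - (n.-1 - l) = l)%N; lia.
Qed.

Local Notation rhov := (rhov n).

Lemma orbit_bound s i : legal n s -> 0 < `|wvec s rhov i| <= n%:Z.
Proof.
move=> /(wvec_perm n_ge2) [sg [e [_ ->]]]; have := ltn_ord (sg i); rewrite ffunE.
by case: ifP => _; rewrite ?normrN; lia.
Qed.

Lemma wlen_rhov : wlen rhov = 0%N.
Proof.
rewrite /wlen /negpairs big1 ?big1 // => [[a b] /= ab|i _]; rewrite !ffunE.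
  by have := ltn_ord b; lia.
by have := ltn_ord i; lia.
Qed.

Lemma wlen_word s : legal n s -> (wlen (wvec s rhov) <= size s)%N.
Proof.
elim: s => [|j s IH] /=; first by rewrite wlen_rhov.
by case/andP => jn /IH h; apply: leq_trans (wlen_le _ jn) _.
Qed.

Lemma at_wvec s l : legal n s -> (l < n)%N -> 0 < `|at_nat (wvec s rhov) l| <= n%:Z.
Proof. by move=> ls ln; rewrite (at_natE _ ln); apply: orbit_bound. Qed.

(* Two coordinates of an orbit vector never agree, so each pairing is nonzero. *)
Lemma pairing_neq0 s j : legal n s -> (0 < j <= n)%N -> pairing j (wvec s rhov) != 0.
Proof.
move=> ls jn; have [E|jn'] := eqVneq j n.
  by rewrite E pairing_n //; have := @at_wvec s n.-1 ls; lia.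
have [jm n1 n2] : [/\ (0 < j < n)%N, (j.-1 < n)%N & (j < n)%N] by split; lia.
rewrite pairing_mid // (at_natE _ n1) (at_natE _ n2) subr_eq0.
have [sg [e [sgI H]]] := wvec_perm n_ge2 ls; rewrite !H !ffunE; apply/eqP => E.
have : sg (Ordinal n1) = sg (Ordinal n2).
  apply: ord_inj; have := ltn_ord (sg (Ordinal n1)); have := ltn_ord (sg (Ordinal n2)).
  by move: E; case: (e _); case: (e _); lia.
by move/sgI => [] ; lia.
Qed.

(** Sorting: while some simple pairing is negative, its letter removes an inversion. A vector of the
    orbit without such a letter is decreasing and positive, hence [rhov]. With positive entries the
    letter n never occurs. *)
Lemma shortest_word s : legal n s -> exists s', [/\ legal n s', wvec s' rhov = wvec s rhov,
  size s' = wlen (wvec s rhov) & (forall i, 0 < wvec s rhov i) -> all (Jletter n) s'].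
Proof.
have [N] := ubnP (wlen (wvec s rhov)); elim: N s => // N IH s sN ls.
set nu := wvec s rhov in sN *.
have [[j jn h]|H] := pselect (exists2 j, (0 < j <= n)%N & pairing j nu < 0).
  have ls' : legal n (j :: s) by rewrite /= jn.
  have E := wlen_down jn h.
  have [|s' [ls1 E1 z1 J1]] := IH (j :: s) _ ls'; first by rewrite /= -/nu; lia.
  exists (j :: s'); split=> //=; first by rewrite jn.
  - by rewrite E1 /= -/(wvec _ _) sactK.
  - by rewrite z1 E.
  move=> nu0; have jm : (0 < j < n)%N.
    suff : j != n by lia.
    have n1 : (n.-1 < n)%N by lia.
    by apply/eqP => En; move: h; rewrite En pairing_n // (at_natE _ n1) ltNge ltW.
  rewrite /Jletter jm /=; apply: J1 => i; rewrite sact_perm // ltn_eqF ?nu0 //; lia.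
have desc j : (0 < j <= n)%N -> 0 < pairing j nu.
  move=> jn; rewrite lt_neqAle eq_sym pairing_neq0 //= leNgt; apply/negP => h.
  by case: H; exists j.
have E : nu = rhov.
  have lastp : 0 < at_nat nu n.-1 by rewrite -pairing_n //; apply: desc; lia.
  have dec l : (l.+1 < n)%N -> - at_nat nu l < - at_nat nu l.+1.
    move=> ln; have := desc l.+1; rewrite pairing_mid //=; lia.
  have pos r : (r < n)%N -> 0 < at_nat nu (n.-1 - r)%N.
    elim: r => [|r IHr] rn; first by rewrite subn0.
    have e : (n.-1 - r = (n.-1 - r.+1).+1)%N by lia.
    have := IHr (ltnW rn); have := dec (n.-1 - r.+1)%N; rewrite -e; lia.
  apply/ffunP => i; rewrite ffunE -at_nat_ord.
  have := @increasing_vec (fun l => - at_nat nu l) (- n%:Z) dec _ i (ltn_ord i).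
  have b l : (l < n)%N -> - n%:Z <= - at_nat nu l < - n%:Z + n%:Z.
    move=> ln; have := at_wvec ls ln; rewrite -/nu; have := pos (n.-1 - l)%N.
    by rewrite (_ : n.-1 - (n.-1 - l) = l)%N; lia.
  by move/(_ b); have := ltn_ord i; lia.
by exists [::]; rewrite E wlen_rhov.
Qed.

Lemma elt_wvec s : elt n s = wvec s (rho n). Proof. by []. Qed.

Lemma elt_rhov s s' : legal n s -> legal n s' -> (elt n s' = elt n s <-> wvec s' rhov = wvec s rhov).
Proof.
move=> ls ls'; rewrite !elt_wvec; split=> E.
  exact: (wvec_faithful n_ge2 (rho_regular n) ls' ls E rhov).
exact: (wvec_faithful n_ge2 (rhov_regular n_ge2) ls' ls E (rho n)).
Qed.

Lemma reduced_wlen s : legal n s -> (reduced n s <-> size s = wlen (wvec s rhov)).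
Proof.
move=> ls; split=> [[_ H]|E].
  have [s' [ls' E' z' _]] := shortest_word ls.
  apply/eqP; rewrite eqn_leq wlen_word // andbT -z'; apply: H => //.
  by apply/elt_rhov.
by split=> // s' ls' /elt_rhov -/(_ ls ls') E'; rewrite E -E'; apply: wlen_word.
Qed.

End Length.

Lemma uniq_map_inj (T1 T2 : eqType) (f : T1 -> T2) l : uniq (map f l) -> {in l &, injective f}.
Proof.
elim: l => //= a l IH /andP[na ul] x y; rewrite !inE.
move=> /predU1P[->|xl] /predU1P[->|yl] // E; last exact: IH.
  by rewrite E map_f in na.
by rewrite -E map_f in na.
Qed.

(** * Minimal representatives are the raising words *)

Section CosetRepresentatives.
Variable n : nat.
Hypothesis n_ge2 : (2 <= n)%N.
Local Notation vec := {ffun 'I_n -> int}.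
Local Notation wsign := (wsign n).
Local Notation rhov := (rhov n).
Local Notation wvec := (@wvec n).

(** Otherwise prefixing j would give a longer reduced word in the same letters. *)
Lemma longest_stuck (L : pred nat) s j : (forall l, L l -> (0 < l <= n)%N) -> longest_in n L s ->
  L j -> pairing j (wvec s rhov) < 0.
Proof.
move=> LJ [allL [red longest]] Lj; have jn := LJ j Lj.
have ls : legal n s by apply: sub_all allL.
rewrite lt_neqAle pairing_neq0 //= leNgt; apply/negP => h.
have ljs : legal n (j :: s) by rewrite /= jn.
have : reduced n (j :: s).
  by apply/reduced_wlen => //=; rewrite -/(wvec _ _) wlen_up // ((reduced_wlen n_ge2 ls).1 red).
by move/(longest (j :: s)); rewrite /= Lj allL ltnn => /(_ isT).
Qed.

(** All simple pairings are negative at the longest element, so the image of [rhov] increases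
    through negative entries and must be [- rhov]. *)
Lemma longest_all s : longest_in n (fun j => (0 < j <= n)%N) s -> forall x, wvec s x = - x.
Proof.
move=> sL; have desc j : (0 < j <= n)%N -> pairing j (wvec s rhov) < 0.
  by move=> jn; apply: longest_stuck sL jn.
have ls : legal n s by case: sL.
set nu := wvec s rhov in desc.
have lastn : at_nat nu n.-1 < 0 by rewrite -pairing_n //; apply: desc; lia.
have inc l : (l.+1 < n)%N -> at_nat nu l < at_nat nu l.+1.
  by move=> ln; have := desc l.+1; rewrite pairing_mid //=; lia.
have neg r : (r < n)%N -> at_nat nu (n.-1 - r)%N < 0.
  elim: r => [|r IHr] rn; first by rewrite subn0.
  have e : (n.-1 - r = (n.-1 - r.+1).+1)%N by lia.
  have := IHr (ltnW rn); have := inc (n.-1 - r.+1)%N; rewrite -e; lia.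
have E : nu = - rhov.
  apply/ffunP => i; rewrite !ffunE -at_nat_ord.
  have b l : (l < n)%N -> - n%:Z <= at_nat nu l < - n%:Z + n%:Z.
    move=> ln; have := at_wvec n_ge2 ls ln; rewrite -/nu; have := neg (n.-1 - l)%N.
    by rewrite (_ : n.-1 - (n.-1 - l) = l)%N; lia.
  by have := increasing_vec n_ge2 inc b (ltn_ord i); have := ltn_ord i; lia.
have [sg [e [_ H]]] := wvec_perm n_ge2 ls; move=> x; apply/ffunP => i; rewrite H [RHS]ffunE.
have := congr1 (fun f : vec => f i) E; rewrite /nu H !ffunE.
have := ltn_ord (sg i); have := ltn_ord i; case: (e i) => a b; last by lia.
by move=> h; congr (- x _); apply: ord_inj; lia.
Qed.

Lemma Jlegal s : all (Jletter n) s -> legal n s.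
Proof. by apply: sub_all => j; rewrite /Jletter; lia. Qed.

Lemma Jword_pos s (x : vec) : all (Jletter n) s -> (forall i, 0 < x i) -> forall i, 0 < wvec s x i.
Proof.
elim: s => //= j s IH /andP[jJ sJ] x0 i; have jn : (0 < j <= n)%N by move: jJ; rewrite /Jletter; lia.
rewrite sact_perm // (_ : j == n = false) ?IH //; move: jJ; rewrite /Jletter; lia.
Qed.

Lemma Jword_sign s : all (Jletter n) s -> same_sign n (wsign s plus) plus.
Proof.
move=> sJ i i_n; have x0 j : 0 < rhov j by rewrite ffunE; have := ltn_ord j; lia.
have [_ H] := wvec_sign n_ge2 (Jlegal sJ) x0.
by rewrite -(H (Ordinal i_n)) ltNge ltW // Jword_pos.
Qed.

(** Here the entries increase and stay positive, so [rhov] goes to [rho]; the order reversal is its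
    own inverse. *)
Lemma longest_J s : longest_in n (Jletter n) s -> wvec s (rho n) = rhov.
Proof.
move=> sL; have desc j : (0 < j < n)%N -> pairing j (wvec s rhov) < 0.
  by move=> jn; apply: longest_stuck sL jn => l; rewrite /Jletter; lia.
have sJ : all (Jletter n) s by case: sL.
have ls := Jlegal sJ.
set nu := wvec s rhov in desc.
have x0 j : 0 < rhov j by rewrite ffunE; have := ltn_ord j; lia.
have inc l : (l.+1 < n)%N -> at_nat nu l < at_nat nu l.+1.
  by move=> ln; have := desc l.+1; rewrite pairing_mid //=; lia.
have E : nu = rho n.
  apply/ffunP => i; rewrite !ffunE -at_nat_ord.
  have b l : (l < n)%N -> 1 <= at_nat nu l < 1 + n%:Z.
    move=> ln; have := at_wvec n_ge2 ls ln; rewrite -/nu; have := Jword_pos sJ x0 (Ordinal ln).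
    by rewrite -at_natE -/nu; lia.
  by have := increasing_vec n_ge2 inc b (ltn_ord i); lia.
have [sg [e [_ H]]] := wvec_perm n_ge2 ls; apply/ffunP => i; rewrite H !ffunE.
have := congr1 (fun f : vec => f i) E; rewrite /nu H !ffunE.
by have := ltn_ord (sg i); have := ltn_ord i; case: (e i) => a b; lia.
Qed.

Lemma elt_sign s : legal n s -> forall i : 'I_n, (elt n s i < 0) = wsign s plus i.
Proof.
by move=> ls; apply: (wvec_sign n_ge2 ls _).2 => i; rewrite ffunE.
Qed.

Lemma elt_same_sign s s' : legal n s -> legal n s' -> elt n s = elt n s' ->
  same_sign n (wsign s plus) (wsign s' plus).
Proof.
move=> ls ls' E i i_n.
by rewrite -(elt_sign ls (Ordinal i_n)) -(elt_sign ls' (Ordinal i_n)) E.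
Qed.

(** Let r be a raising word with the sign pattern of s. Then $s^{-1}r$ keeps entries positive, hence
    is a word in J, so r lies in the coset of s and minimality gives |s| <= |r|. As |r| is the
    height of the pattern, the bound of [height_word] is attained by s. *)
Lemma minrep_raise s : minrep n s -> allraise n s plus.
Proof.
move=> [[ls _] H]; have [r [rr rs]] := raising_word n_ge2 (wsign s plus).
have lr := allraise_legal n_ge2 rr.
have lt : legal n (rev s ++ r) by rewrite legal_cat legal_rev ls.
have x0 j : 0 < rhov j by rewrite ffunE; have := ltn_ord j; lia.
have tplus : same_sign n (wsign (rev s ++ r) plus) plus.
  move=> i i_n; rewrite wsign_cat (@wsign_ext n n_ge2 (rev s) _ (wsign s plus)) ?legal_rev //.
  exact: wsign_revK.
have tpos i : 0 < wvec (rev s ++ r) rhov i.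
  have [nz sg] := wvec_sign n_ge2 lt x0.
  by rewrite lt_neqAle eq_sym nz leNgt sg tplus.
have [u [lu Eu _ uJ]] := shortest_word n_ge2 lt.
have Eu' : wvec u (rho n) = wvec (rev s ++ r) (rho n).
  exact: (wvec_faithful n_ge2 (rhov_regular n_ge2) lu lt Eu).
have [h1 h2] := height_word n_ge2 ls; have [_ h3] := height_word n_ge2 lr.
rewrite -h2 eqn_leq h1 /= -(height_ext rs) (eqP (_ : height n (wsign r plus) == size r)) ?h3 //.
apply: (H u) => //; first exact: uJ.
rewrite !elt_wvec wvec_cat Eu' wvec_cat.
by rewrite -{1}(revK s) wvec_revK ?legal_rev.
Qed.

(** Multiplying by J on the right keeps the sign pattern, whose height bounds the length of every
    word from below. *)
Lemma raise_minrep s : allraise n s plus -> minrep n s.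
Proof.
move=> sr; have ls := allraise_legal n_ge2 sr.
have [_ h] := height_word n_ge2 ls; have hs : height n (wsign s plus) = size s.
  by apply/eqP; rewrite h.
have key s' : legal n s' -> same_sign n (wsign s' plus) (wsign s plus) -> (size s <= size s')%N.
  move=> ls' E; rewrite -hs -(height_ext E); exact: (height_word n_ge2 ls').1.
split; first by split=> // s' ls' E; apply: key => //; apply: elt_same_sign.
move=> u s' uJ ls' E; apply: key => // i i_n; have lu := Jlegal uJ.
have lsu : legal n (s ++ u) by rewrite legal_cat ls.
rewrite (elt_same_sign ls' lsu E) // wsign_cat.
exact: (wsign_ext n_ge2 ls (Jword_sign uJ)).
Qed.

Variables (red : seq nat -> seq nat) (ws : seq (seq nat)) (w0 w0J : seq nat).
Hypothesis W : W0data n red ws w0 w0J.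

Lemma ws_raise s : s \in ws -> allraise n s plus.
Proof. by case: W => _ [_ [_ [H _]]] /H; apply: minrep_raise. Qed.

Lemma ws_sign_inj s s' : s \in ws -> s' \in ws ->
  same_sign n (wsign s plus) (wsign s' plus) -> s = s'.
Proof.
case: W => _ [_ [_ [_ [uq _]]]] sw sw' E.
have eE : elt n s = elt n s'.
  rewrite !elt_wvec (canon_word n_ge2 (ws_raise sw)).1 (canon_word n_ge2 (ws_raise sw')).1.
  exact: canon_ext.
exact: (uniq_map_inj uq).
Qed.

Lemma ws_sign_surj d : exists2 s, s \in ws & same_sign n (wsign s plus) d.
Proof.
case: W => _ [_ [_ [_ [_ H]]]]; have [r [rr rd]] := raising_word n_ge2 d.
have /mapP[s sw E] := H r (raise_minrep rr); exists s => // i i_n.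
have ls := allraise_legal n_ge2 (ws_raise sw); have lr := allraise_legal n_ge2 rr.
by rewrite (elt_same_sign ls lr) ?rd.
Qed.

(** The coefficient of $v_w^J$ in the candidate is thus P raised to the pattern opposite to that of
    w. By [canon_word] the element is that of a raising word, and reducedness then forces every
    letter to raise. *)
Lemma red_raise s : s \in ws -> let r := red (s ++ w0J ++ rev w0) in
  allraise n r plus /\ same_sign n (wsign r plus) (fun i => ~~ wsign s plus i).
Proof.
move=> sw r; have sr := ws_raise sw; have ls := allraise_legal n_ge2 sr.
case: W => redP [w0L [w0JL _]].
have lw0 : legal n w0 by case: w0L.
have lw0J : legal n w0J by case: w0JL => /Jlegal.
have lall : legal n (s ++ w0J ++ rev w0) by rewrite !legal_cat legal_rev ls lw0J.
have [[lr rmin] rE] := redP _ lall.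
have [r0 [r0r r0d]] := raising_word n_ge2 (fun i => ~~ wsign s plus i).
have lr0 := allraise_legal n_ge2 r0r.
have E : elt n r = elt n r0.
  rewrite rE !elt_wvec !wvec_cat (canon_word n_ge2 r0r).1 (canon_ext r0d).
  have -> : wvec (rev w0) (rho n) = - rho n.
    by have := wvec_revK n_ge2 (- rho n) lw0; rewrite (longest_all w0L) opprK.
  rewrite wvecN // (longest_J w0JL) wvecN // (canon_word n_ge2 sr).2 opprK //.
have Es := elt_same_sign lr lr0 E.
have [h1 h2] := height_word n_ge2 lr; have [_ h3] := height_word n_ge2 lr0.
split; last by move=> i i_n; rewrite Es ?r0d.
rewrite -h2 eqn_leq h1 /= (height_ext Es) (eqP (_ : height n (wsign r0 plus) == size r0)) ?h3 //.
by apply: rmin.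
Qed.

End CosetRepresentatives.

(** * Genericity *)

Section GenericParameters.
Variable F : closedFieldType.

Fixpoint mvar (m i : nat) : mpoly F m :=
  match m return mpoly F m with
  | 0 => 0
  | m'.+1 => if i == m' then 'X else (mvar m' i)%:P
  end.

Lemma meval_rmorphism m (x : nat -> F) : exists phi : {rmorphism mpoly F m -> F},
  (fun p => meval p x) =1 phi.
Proof.
elim: m => [|m [phi IH]]; first by exists idfun.
exists (horner_eval (x m) \o map_poly phi) => p /=.
by rewrite /horner_eval (eq_map_poly IH).
Qed.

Lemma meval_mvar m i x : (i < m)%N -> meval (mvar m i) x = x i.
Proof.
elim: m => // m IH im; have [phi E] := meval_rmorphism m x.
rewrite /= (eq_map_poly E); case: eqVneq => [->|ni]; first by rewrite map_polyX hornerX.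
rewrite map_polyC hornerC -IH; last lia.
by symmetry; apply: E.
Qed.

(** The positive parts of z and -z split a relation between integer powers into two polynomial
    sides. *)
Definition posp (z : int) : nat := if 0 <= z then `|z|%N else 0.
(** The first exponent is doubled because the variable is $q^{1/2}$ while the relation concerns
    q. *)
Definition monom4 (R : nzRingType) (x y z t : R) (e : int -> nat) (a : int * int * int * int) : R :=
  let: (a1, a2, a3, a4) := a in x ^+ (2 * e a1) * y ^+ e a2 * z ^+ e a3 * t ^+ e a4.

(** In [params6] the variables 0, 1, 2, 3 are q12, k0, k, kn; the relation lists kn before k. *)
Definition genpoly (a : int * int * int * int) : mpoly F 6 :=
  monom4 (mvar 6 0) (mvar 6 1) (mvar 6 3) (mvar 6 2) posp a -
  monom4 (mvar 6 0) (mvar 6 1) (mvar 6 3) (mvar 6 2) (fun z => posp (- z)) a.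

Definition generic_family (N : nat) : mpoly F 6 :=
  if @unpickle (int * int * int * int)%type N is Some a then
    (if a == (0, 0, 0, 0) then 1 else genpoly a) else 1.

Lemma rmorph_monom4 (A B : nzRingType) (phi : {rmorphism A -> B}) x y z t e a :
  phi (monom4 x y z t e a) = monom4 (phi x) (phi y) (phi z) (phi t) e a.
Proof. by case: a => [[[a b] c] d]; rewrite /monom4 !rmorphM !rmorphXn. Qed.

Lemma meval_genpoly a (x : nat -> F) : meval (genpoly a) x =
  monom4 (x 0%N) (x 1%N) (x 3) (x 2) posp a - monom4 (x 0%N) (x 1%N) (x 3) (x 2) (fun z => posp (- z)) a.
Proof.
have [phi E] := meval_rmorphism 6 x; rewrite [LHS]E /genpoly rmorphB !rmorph_monom4.
have Ev i : (i < 6)%N -> phi (mvar 6 i) = x i.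
  by move=> i6; rewrite -(meval_mvar x i6); symmetry; apply: E.
by congr (monom4 _ _ _ _ _ _ - monom4 _ _ _ _ _ _); apply: Ev.
Qed.

Hypothesis char0 : [pchar F] =i pred0.

(** In characteristic zero 2 has infinite multiplicative order, which makes it a test value. *)
Lemma pow2_inj : injective (fun m : nat => (2 : F) ^+ m).
Proof.
move=> m m' /eqP; rewrite -!natrX => /eqP E; apply/eqP; rewrite -(@eqn_exp2l 2) //.
have H := (pcharf0P F).1 char0; wlog le : m m' E / (2 ^ m <= 2 ^ m')%N.
  by case: (leqP (2 ^ m) (2 ^ m')) => [h|/ltnW h] W; [apply: W | rewrite eq_sym; apply: W].
by rewrite eqn_leq le /= -subn_eq0 -H natrB // E subrr.
Qed.

Lemma posp_neq z : z != 0 -> posp z != posp (- z).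
Proof. by rewrite /posp; case: (lerP 0 z); case: (lerP 0 (- z)); lia. Qed.

(** Test point: 2 at one variable with nonzero exponent, 1 at all others. *)
Lemma generic_family_neq0 N : generic_family N != 0.
Proof.
rewrite /generic_family; have one0 : (1 : mpoly F 6) != 0 by apply: (@oner_neq0 (mpoly F 6)).
case: (unpickle N) => [a|//]; case: (eqVneq a (0, 0, 0, 0)) => [_ //|].
case: a => [[[a b] c] d] ne.
suff [x H] : exists x, meval (genpoly (a, b, c, d)) x != 0.
  apply: contra H => /eqP ->; have [phi E] := meval_rmorphism 6 x; by rewrite [X in X == 0]E rmorph0.
have mk (v : nat) (w : int) : w != 0 -> (2 : F) ^+ (posp w) - 2 ^+ (posp (- w)) != 0.
  by move=> w0; rewrite subr_eq0; apply/eqP => /pow2_inj /eqP; apply/negP/posp_neq.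
have [a0|a0] := eqVneq a 0; last first.
  exists (fun v => if v == 0%N then 2 else 1); rewrite meval_genpoly /= !expr1n !mulr1.
  rewrite subr_eq0; apply/eqP => /pow2_inj; have := posp_neq a0.
  by move=> /eqP ne2 e2; apply: ne2; move: e2; rewrite !mul2n => /double_inj.
have [b0|b0] := eqVneq b 0; last first.
  by exists (fun v => if v == 1%N then 2 else 1); rewrite meval_genpoly /= !expr1n !mul1r !mulr1 mk.
have [c0|c0] := eqVneq c 0; last first.
  by exists (fun v => if v == 3 then 2 else 1); rewrite meval_genpoly /= !expr1n !mul1r !mulr1 mk.
have [d0|d0] := eqVneq d 0; first by rewrite a0 b0 c0 d0 eqxx in ne.
by exists (fun v => if v == 2 then 2 else 1); rewrite meval_genpoly /= !expr1n !mul1r mk.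
Qed.

Lemma expz_posp (x : F) z : x != 0 -> x ^ z = x ^+ posp z / x ^+ posp (- z).
Proof.
move=> x0; rewrite /posp; case: (lerP 0 z) => h; case: (lerP 0 (- z)) => h'.
- by rewrite (_ : z = 0); [rewrite expr0z /= expr0 divr1 | lia].
- by rewrite expr0 divr1 exprnP gez0_abs.
- by rewrite expr0 div1r exprnP invr_expz gez0_abs // opprK.
- by lia.
Qed.

Lemma generic_familyP q12 k0 k kn u0 un : q12 != 0 -> k0 != 0 -> k != 0 -> kn != 0 ->
  (forall i, meval (generic_family i) (params6 q12 k0 k kn u0 un) != 0) ->
  forall a b c d : int, (q q12) ^ a * k0 ^ b * kn ^ c * k ^ d = 1 -> a = 0 /\ d = 0.
Proof.
move=> q0 k00 kk0 kn0 H a b c d E; have := H (pickle (a, b, c, d)).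
rewrite /generic_family pickleK; case: (eqVneq (a, b, c, d) (0, 0, 0, 0)) => [[-> _ _ ->] //|_].
rewrite meval_genpoly /= subr_eq0 => /eqP [].
have := E; rewrite !expz_posp ?expf_neq0 // -!exprM => E'.
have -> : q12 ^+ (2 * posp a) * k0 ^+ posp b * kn ^+ posp c * k ^+ posp d =
  (q12 ^+ (2 * posp a) / q12 ^+ (2 * posp (- a)) * (k0 ^+ posp b / k0 ^+ posp (- b)) *
  (kn ^+ posp c / kn ^+ posp (- c)) * (k ^+ posp d / k ^+ posp (- d))) *
  (q12 ^+ (2 * posp (- a)) * k0 ^+ posp (- b) * kn ^+ posp (- c) * k ^+ posp (- d)).
  by field; rewrite !expf_neq0.
by rewrite E' mul1r.
Qed.

End GenericParameters.

(** * Equality of meromorphic functions *)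

Section LaurentCalculus.
Variables (F : closedFieldType) (n : nat) (q12 k0 k kn u0 un : F).
Hypothesis uncountable : forall f : nat -> F, exists x : F, forall i, f i != x.
Hypothesis n_ge2 : (2 <= n)%N.
Hypothesis q12_neq0 : q12 != 0.
Hypotheses (k0_neq0 : k0 != 0) (k_neq0 : k != 0) (kn_neq0 : kn != 0).
Hypotheses (u0_neq0 : u0 != 0) (un_neq0 : un != 0).
Local Notation vec := {ffun 'I_n -> int}.
Local Notation gpt := (gpt n q12).
Local Notation sj := (sj n q12).
Local Notation laurent := (@laurent F n).
Local Notation lvar := (lvar n q12).

Lemma laurent_ext (f g : (nat -> F) -> F) :
  (forall t, torus n t -> f t = g t) -> laurent g -> laurent f.
Proof. by move=> fg [s gs]; exists s => t tt; rewrite fg ?gs. Qed.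

Lemma laurent_lev (s : lpoly F n) : laurent (lev s).
Proof. by exists s. Qed.

Lemma laurent_cmono a (nu : vec) : laurent (fun t => a * mono nu t).
Proof. by exists [:: (nu, a)] => t tt; rewrite big_seq1. Qed.

Lemma laurent_const a : laurent (fun _ => a).
Proof. by apply: laurent_ext (laurent_cmono a 0) => t _; rewrite mono0 mulr1. Qed.

Lemma laurentD f g : laurent f -> laurent g -> laurent (fun t => f t + g t).
Proof.
by move=> [s fs] [s' gs]; exists (s ++ s') => t tt; rewrite big_cat /= fs ?gs.
Qed.

Lemma laurent_sum (I : Type) (r : seq I) (f : I -> (nat -> F) -> F) :
  (forall i, laurent (f i)) -> laurent (fun t => \sum_(i <- r) f i t).
Proof.
move=> fl; elim: r => [|i r IH].
  by apply: laurent_ext (laurent_const 0) => t _; rewrite big_nil.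
by apply: laurent_ext (laurentD (fl i) IH) => t _; rewrite big_cons.
Qed.

Lemma laurentM f g : laurent f -> laurent g -> laurent (fun t => f t * g t).
Proof.
move=> [s fs] [s' gs].
apply: (@laurent_ext _ (fun t => \sum_(p <- s) \sum_(r <- s') (p.2 * r.2) * mono (addz p.1 1 r.1) t)).
  move=> t tt; rewrite fs ?gs // mulr_suml; apply: eq_bigr => p _; rewrite mulr_sumr.
  by apply: eq_bigr => r _; rewrite mono_addz // expr1z; ring.
by do 2![apply: laurent_sum => ?]; apply: laurent_cmono.
Qed.

Lemma laurentZ a f : laurent f -> laurent (fun t => a * f t).
Proof. by move=> fl; apply: laurentM fl; apply: laurent_const. Qed.

Lemma laurentB f g : laurent f -> laurent g -> laurent (fun t => f t - g t).
Proof.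
move=> fl gl; apply: laurent_ext (laurentD fl (laurentZ (-1) gl)) => t _.
by rewrite mulN1r.
Qed.

Lemma laurentX m f : laurent f -> laurent (fun t => f t ^+ m).
Proof.
move=> fl; elim: m => [|m IH]; first exact: laurent_const.
by apply: laurent_ext (laurentM fl IH) => t _; rewrite exprS.
Qed.

Lemma laurent_lvar j : (j <= n)%N -> laurent (lvar j).
Proof.
by move=> jn; apply: laurent_ext (laurent_cmono _ _) => t tt; rewrite lvarE.
Qed.

Lemma laurent_sj j f : (j <= n)%N -> laurent f -> laurent (fun t => f (sj j t)).
Proof.
move=> jn [s fs]; apply: (@laurent_ext _ (fun t => \sum_(p <- s) p.2 * mono p.1 (sj j t))).
  by move=> t tt; rewrite fs //; apply: torus_sj.
apply: laurent_sum => p.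
apply: (@laurent_ext _ (fun t => p.2 * lscal q12 j ^ (- ((lmul n j)%:Z * pairing j p.1)) * mono (iact j p.1) t)).
  move=> t tt; rewrite mono_sj // lvarE // expfzMl /iact mono_addz //.
  set e := - (_ * _); rewrite -!mulrA; congr (_ * _).
  by rewrite mulrCA mulrC.
exact: laurent_cmono.
Qed.

Definition lnonzero (h : (nat -> F) -> F) := laurent h /\ exists t, torus n t /\ h t != 0.

(** This stands for the integral domain property of Laurent polynomials: exceptional sets can be
    united, which makes [aeq] transitive. *)
Lemma lnonzero_pair h h' : lnonzero h -> lnonzero h' ->
  exists p : gpt, h (pt p) != 0 /\ h' (pt p) != 0.
Proof.
move=> [[s hs] [t [tt ht]]] [[s' hs'] [t' [tt' ht']]].
have [r [rg rP]] : exists t, good_pt n q12 t /\ forall x, x \in [:: s; s'] -> lev x t != 0.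
  apply: (good_dense uncountable q12_neq0) => x; rewrite !inE => /orP[]/eqP->.
    by apply: (@lnz_of_lev _ _ _ t); rewrite /lev -hs.
  by apply: (@lnz_of_lev _ _ _ t'); rewrite /lev -hs'.
exists (exist _ r rg); have tr := pt_torus (exist _ r rg : gpt).
by rewrite hs // hs' //; split; apply: rP; rewrite !inE eqxx ?orbT.
Qed.

Lemma lnonzeroM h h' : lnonzero h -> lnonzero h' -> lnonzero (fun t => h t * h' t).
Proof.
move=> hn hn'; split; first by apply: laurentM; [case: hn | case: hn'].
have [p [h1 h2]] := lnonzero_pair hn hn'.
by exists (pt p); split; [apply: pt_torus | rewrite mulf_neq0].
Qed.

Lemma lnonzero1 : lnonzero (fun _ => 1).
Proof.
split; first exact: laurent_const.
by exists (fun _ => 1); split=> [i _|]; rewrite oner_neq0.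
Qed.

Lemma lnonzero_sj j h : (j <= n)%N -> lnonzero h -> lnonzero (fun t => h (sj j t)).
Proof.
move=> jn hn; split; first by apply: laurent_sj => //; case: hn.
have [p [hp _]] := lnonzero_pair hn hn; exists (pt (sG n_ge2 q12_neq0 j p)).
by split; [apply: pt_torus | rewrite -pt_sG // sGK].
Qed.

Lemma laurent_vanish h g : lnonzero h -> laurent g ->
  (forall p : gpt, h (pt p) != 0 -> g (pt p) = 0) -> forall t, torus n t -> g t = 0.
Proof.
move=> hn gl H t tt; apply/eqP; apply: contraT => gt.
have [p [h1 /eqP h2]] := lnonzero_pair hn (conj gl (ex_intro _ t (conj tt gt))).
by case: h2; apply: H.
Qed.

Lemma laurent_good_eq f g : laurent f -> laurent g ->
  (forall p : gpt, f (pt p) = g (pt p)) -> forall t, torus n t -> f t = g t.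
Proof.
move=> fl gl fg t tt; apply/eqP; rewrite -subr_eq0; apply/eqP.
apply: (laurent_vanish lnonzero1 (laurentB fl gl)) => // p _; by rewrite fg subrr.
Qed.

Lemma aeq_intro (Y : Type) h (f g : (nat -> F) -> Y) : lnonzero h ->
  (forall t, torus n t -> h t != 0 -> f t = g t) -> aeq n f g.
Proof. by move=> [hl ht] H; exists h. Qed.

Lemma aeq_elim (Y : Type) (f g : (nat -> F) -> Y) : aeq n f g ->
  exists h, lnonzero h /\ forall t, torus n t -> h t != 0 -> f t = g t.
Proof. by move=> [h [hl [ht H]]]; exists h. Qed.

Lemma aeq_sym (Y : Type) (f g : (nat -> F) -> Y) : aeq n f g -> aeq n g f.
Proof. by move=> [h [hl [ht H]]]; exists h; do 2!split => //; move=> t tt /H ->. Qed.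

Lemma aeq_trans (Y : Type) (g f l : (nat -> F) -> Y) : aeq n f g -> aeq n g l -> aeq n f l.
Proof.
move=> /aeq_elim [h [hn H]] /aeq_elim [h' [hn' H']].
apply: aeq_intro (lnonzeroM hn hn') _ => t tt; rewrite mulf_eq0 negb_or => /andP[h1 h2].
by rewrite H ?H'.
Qed.

Lemma aeq_eq (Y : Type) (f g : (nat -> F) -> Y) : (forall t, torus n t -> f t = g t) -> aeq n f g.
Proof. by move=> fg; apply: aeq_intro lnonzero1 _ => t tt _; apply: fg. Qed.

Lemma aeq_laurent f g : laurent f -> laurent g -> aeq n f g ->
  forall t, torus n t -> f t = g t.
Proof.
move=> fl gl /aeq_elim [h [hn H]] t tt; apply/eqP; rewrite -subr_eq0; apply/eqP.
apply: (laurent_vanish hn (laurentB fl gl)) => // p hp; rewrite H ?subrr //; exact: pt_torus.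
Qed.

(* The value at [lvar j t], which is an arbitrary nonzero element of [F], of a nonzero polynomial. *)
Lemma lnonzero_lvar j a b c : (j <= n)%N -> a != 0 ->
  lnonzero (fun t => a + b * lvar j t + c * lvar j t ^+ lmul n j).
Proof.
move=> jn a0; split.
  apply: laurentD; last by apply/laurentZ/laurentX/laurent_lvar.
  by apply: laurentD; [apply: laurent_const | apply/laurentZ/laurent_lvar].
pose P := a%:P + b *: 'X + c *: 'X^(lmul n j).
have m0 : (0 < lmul n j)%N by rewrite /lmul; case: ifP.
have Pn : P != 0.
  apply: contra a0 => /eqP /(congr1 (fun p : {poly F} => p.[0])).
  by rewrite !hornerE expr0n (gtn_eqF m0) !mulr0 !addr0 => ->.
have [x H] := avoid_roots uncountable (fun i => if i == 0%N then P else 'X).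
have {H}[Px x0] : P.[x] != 0 /\ x != 0.
  by have := H 1%N; have := H 0%N; rewrite /= hornerX polyX_eq0 => h1 h2; split; [apply: h1 | apply: h2].
suff [t [tt tx]] : exists t, torus n t /\ lvar j t = x.
  by exists t; split=> //; move: Px; rewrite /P !hornerE tx.
have n0 : (n == 0)%N = false by apply: gtn_eqF; apply: ltnW.
rewrite /lvar; case: (eqVneq j 0%N) => [_|j0].
  exists (fun _ => q12 / x); split=> [i _|]; first by rewrite mulf_neq0 ?invr_eq0.
  by rewrite invf_div mulrC divfK.
case: (eqVneq j n) => [_|j1]; first by exists (fun _ => x); split=> // i _.
exists (fun i => if i == j then 1 else x); split=> [i _|]; first by case: ifP; rewrite ?oner_neq0.
by rewrite eqxx divr1 (_ : (j.-1 == j) = false) //; apply: ltn_eqF; rewrite prednK // lt0n.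
Qed.

Lemma lnonzero_lvar1 j : (j <= n)%N -> lnonzero (fun t => 1 - lvar j t ^+ lmul n j).
Proof.
move=> jn; have [H [t [tt th]]] := lnonzero_lvar 0 (-1) jn (oner_neq0 F).
split; last by exists t; split=> //; move: th; rewrite mul0r addr0 mulN1r.
by apply: laurent_ext H => r _; rewrite mul0r addr0 mulN1r.
Qed.

End LaurentCalculus.

(** * Words in varpi(T_j) applied to Laurent polynomials *)

Section VarpiWords.
Variables (F : closedFieldType) (n : nat) (q12 k0 k kn u0 un : F).
Hypothesis uncountable : forall f : nat -> F, exists x : F, forall i, f i != x.
Hypothesis n_ge2 : (2 <= n)%N.
Hypothesis q12_neq0 : q12 != 0.
Hypotheses (k0_neq0 : k0 != 0) (k_neq0 : k != 0) (kn_neq0 : kn != 0).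
Hypotheses (u0_neq0 : u0 != 0) (un_neq0 : un != 0).
Local Notation gpt := (gpt n q12).
Local Notation X := (gpt -> F^o).
Local Notation sj := (sj n q12).
Local Notation kap := (kap n k0 k kn).
Local Notation TX := (@TX F n q12 k0 k kn u0 un n_ge2 q12_neq0).
Local Notation opX := (@opX F n q12 k0 k kn u0 un n_ge2 q12_neq0).
Local Notation levX := (@levX F n q12).
Local Notation laurent := (@laurent F n).
Local Notation lA := (lA n k0 k kn).
Local Notation lB := (lB n u0 un).
Local Notation lvar := (lvar n q12).
Local Notation ctilde := (ctilde n q12 k0 k kn u0 un).
Local Notation varpiT := (varpiT n q12 k0 k kn u0 un).
Local Notation varpiop := (varpiop n q12 k0 k kn u0 un).

Definition ctnum j (t : nat -> F) : F := kap j + - lB j * lvar j t + - (kap j)^-1 * lvar j t ^+ lmul n j.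

Lemma ctilde_num j t : (j <= n)%N -> torus n t -> 1 - lvar j t ^+ lmul n j != 0 ->
  (1 - lvar j t ^+ lmul n j) * ctilde j t = ctnum j t.
Proof.
have n0 : (n == 0)%N = false by apply: gtn_eqF; apply: ltnW.
move=> + tt; rewrite /ctnum; elim/(letter_cases n_ge2) => [||{}j jm];
  rewrite /lvar /lmul /lB /kap /ctilde ?eqxx ?n0 ?orbT /=.
- have t0 : t 0%N != 0 by apply: tt; lia.
  rewrite /q => h; have h' : t 0%N ^+ 2 - q12 ^+ 2 != 0.
    apply: contra h; rewrite subr_eq0 => /eqP e.
    by rewrite expr_div_n -e divff ?subrr ?expf_neq0.
  by field; rewrite k0_neq0 u0_neq0 t0 h'.
- by move=> h; field; rewrite kn_neq0 un_neq0 h.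
- have [-> ->] : (j == 0%N) = false /\ (j == n) = false by split; lia.
  have tj : t j != 0 by apply: tt; lia.
  rewrite expr1 => h; have h' : t j - t j.-1 != 0.
    by apply: contra h; rewrite !subr_eq0 => /eqP <-; rewrite divff.
  by field; rewrite k_neq0 tj h'.
Qed.

Lemma laurent_ctnum j : (j <= n)%N -> laurent (ctnum j).
Proof.
move=> jn; apply: laurentD; last by apply/laurentZ/laurentX/laurent_lvar.
by apply: laurentD; [apply: laurent_const | apply/laurentZ/laurent_lvar].
Qed.

Lemma varpiT_pt j P p : (j <= n)%N -> varpiT j P (pt p) = TX j (fun r => P (pt r)) p.
Proof. by move=> jn; rewrite /varpiT /TX /reflop pt_sG. Qed.

Lemma varpiT_laurent j L : (j <= n)%N -> laurent L -> exists2 L', laurent L' &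
  forall t, torus n t -> 1 - lvar j t ^+ lmul n j != 0 -> (1 - lvar j t ^+ lmul n j) * varpiT j L t = L' t.
Proof.
move=> jn lL; exists (fun t => (kap j)^-1 * ((1 - lvar j t ^+ lmul n j) * L t) + ctnum j t * (L (sj j t) - L t)).
  apply: laurentD; last first.
    by apply: laurentM; [apply: laurent_ctnum | apply: laurentB => //; apply: laurent_sj].
  apply/laurentZ/laurentM => //; apply: laurentB; first exact: laurent_const.
  by apply/laurentX/laurent_lvar.
by move=> t tt h; rewrite -(ctilde_num jn tt h) /varpiT; ring.
Qed.

(** [varpiT] takes meaningless values where a denominator vanishes, and later letters carry these to
    other points. By [TX_levX] the operators at good points preserve Laurent polynomials, so off a
    hypersurface the word agrees with a true Laurent polynomial. *)
Lemma varpi_word_laurent w P : all (fun a => a.1 <= n)%N w -> laurent P ->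
  exists L, [/\ laurent L, aeq n (apply_word varpiop w P) L &
    forall p, L (pt p) = apply_word opX w (fun r => P (pt r)) p].
Proof.
elim: w => [|[j b] w IH] /=; first by move=> _ lP; exists P; split=> //; apply: aeq_eq.
move=> /andP[jn wn] /(IH wn) [L [lL /aeq_elim [h [hn H]] Lp]].
have [L' lL' HL'] := varpiT_laurent jn lL.
have [s Ls] := lL.
have [s' E] := TX_levX n_ge2 q12_neq0 k0_neq0 k_neq0 kn_neq0 u0_neq0 un_neq0 s jn.
have LX : (fun r : gpt => L (pt r)) = levX s.
  by apply: funext => r; rewrite Ls //; apply: pt_torus.
have E' t : torus n t -> (1 - lvar j t ^+ lmul n j) * lev s' t = L' t.
  apply: (@laurent_good_eq _ _ _ uncountable q12_neq0 (fun t => (1 - lvar j t ^+ lmul n j) * lev s' t)) => //.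
    apply: laurentM; last exact: laurent_lev.
    apply: laurentB; first exact: laurent_const.
    by apply/laurentX/laurent_lvar.
  move=> p; rewrite -HL' ?varpiT_pt ?lvar_neq1 //; last exact: pt_torus.
  by rewrite LX E.
have lv : aeq n (varpiT j (apply_word varpiop w P)) (lev s').
  (* The new exceptional set contains the zeros of the denominator, the old set and its reflection,
     since [varpiT] also reads the value at $s_jt$. *)
  apply: (aeq_intro (lnonzeroM uncountable q12_neq0 (lnonzero_lvar1 uncountable n_ge2 q12_neq0 jn)
    (lnonzeroM uncountable q12_neq0 hn (lnonzero_sj uncountable n_ge2 q12_neq0 jn hn)))).
  move=> t tt; rewrite !mulf_eq0 !negb_or => /and3P[h1 h2 h3].
  apply: (mulfI h1); rewrite E' // -HL' // /varpiT !H //; exact: torus_sj.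
have LpX : (fun r : gpt => L (pt r)) = apply_word opX w (fun r => P (pt r)) by apply: funext.
have s'p p : lev s' (pt p) = TX j (apply_word opX w (fun r => P (pt r))) p.
  by rewrite -LpX LX E.
rewrite /varpiop /opX /=; case: b; last by exists (lev s'); split=> //; apply: laurent_lev.
exists (fun t => lev s' t - lA j * L t); split; last by move=> p; rewrite s'p Lp.
  by apply: laurentB; [apply: laurent_lev | apply: laurentZ].
have [h' [hn' H']] := aeq_elim lv.
apply: (aeq_intro (lnonzeroM uncountable q12_neq0 hn hn')) => t tt.
by rewrite mulf_eq0 negb_or => /andP[h1 h2]; rewrite H' // H.
Qed.

Lemma varpi_word_aeq w P g : all (fun a => a.1 <= n)%N w -> laurent P -> laurent g ->
  aeq n (apply_word varpiop w P) g <-> apply_word opX w (fun r => P (pt r)) = (fun r => g (pt r)).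
Proof.
move=> wn lP lg; have [L [lL aL Lp]] := varpi_word_laurent wn lP.
split=> [ag | E].
  have LG := aeq_laurent uncountable q12_neq0 lL lg (aeq_trans uncountable q12_neq0 (aeq_sym aL) ag).
  by apply: funext => p; rewrite -Lp LG //; apply: pt_torus.
apply: (aeq_trans uncountable q12_neq0 aL); apply: aeq_eq.
apply: (laurent_good_eq uncountable q12_neq0) => // p.
by rewrite Lp E.
Qed.

End VarpiWords.

(** * The module and the KZ equations *)

Lemma spinvec_word (F : fieldType) (n : nat) (X : lmodType F) (T : nat -> X -> X) (x0 : X) s d :
  (2 <= n)%N -> affine_braid n T -> (forall j a v, T j (a *: v) = a *: T j v) ->
  allraise n s d -> foldr T (spinvec n T x0 d) s = spinvec n T x0 (wsign n s d).
Proof.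
move=> n2 Tb Ts; elim: s => //= j s IH /andP[/IH -> r].
exact: (spinvec_raise n2 Tb Ts).
Qed.

Section SpinModule.
Variables (F : fieldType) (n : nat) (k0 k kn psi0 psin : F).
Hypothesis n_ge2 : (2 <= n)%N.
Hypotheses (k0_neq0 : k0 != 0) (k_neq0 : k != 0) (kn_neq0 : kn != 0).
Hypotheses (psi0_neq0 : psi0 != 0) (psin_neq0 : psin != 0).
Variables (V : lmodType F) (pi : 'I_n.+1 -> {linear V -> V}) (v0 : V).
Variables (red : seq nat -> seq nat) (ws : seq (seq nat)) (w0 w0J : seq nat).
Hypothesis W : W0data n red ws w0 w0J.
Hypothesis M : is_MJ k0 k kn pi psi0 psin ws v0.
Local Notation kap := (kap n k0 k kn).
Local Notation A := (piT pi).
Local Notation psi := (psi0 * psin).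
Local Notation flip := (flipsign n).
Local Notation raises := (raises n).
Local Notation wsign := (wsign n).
Local Notation c j := (kap j - (kap j)^-1).

Lemma piTD j x y : A j (x + y) = A j x + A j y. Proof. exact: linearD. Qed.
Lemma piTZ j a x : A j (a *: x) = a *: A j x. Proof. exact: linearZ. Qed.

Lemma piT_braid : affine_braid n A.
Proof. by case: M => -[_ [h1 [h2 [h3 h4]]]] _. Qed.

Lemma piT_quadratic j x : (j <= n)%N -> A j (A j x) = c j *: A j x + x.
Proof. by case: M => -[h _] _; apply: h. Qed.

Lemma piT_v0 j : (0 < j < n)%N -> A j v0 = k *: v0.
Proof. by case: M => _ [h _]; apply: h. Qed.

Lemma foldr_scale (T : nat -> V -> V) w a x : (forall j b y, T j (b *: y) = b *: T j y) ->
  foldr T (a *: x) w = a *: foldr T x w.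
Proof. by move=> Ts; elim: w => //= j w ->. Qed.

Lemma piop_plain w x : apply_word (piop k0 k kn pi) (plain w) x = foldr A x w.
Proof. by elim: w => //= j w ->. Qed.

(** In $Y_1=T_0T_1\cdots T_nT_{n-1}\cdots T_1$ the last n - 1 letters act on [v0] by $k^{n-1}$, and
    $\zeta_1=\psi_0\psi_nk^{n-1}$. *)
Lemma piT_affine_v0 : A 0 (tailop n A 1 v0) = psi *: v0.
Proof.
have n0 : (0 < n)%N by apply: ltnW.
case: M => _ [_ [Y _]]; have := Y (Ordinal n0).
rewrite /Yword /= /zeta mulr0 subr0 /apply_word foldr_cat -!/(apply_word _ _ _).
rewrite -![[seq (j, false) | j <- _]]/(plain _) !piop_plain subn1 {1}/piop /=.
have -> : foldr A v0 (rev (iota 1 n.-1)) = k ^+ n.-1 *: v0.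
  have H w : all (fun j => (0 < j < n)%N) w -> foldr A v0 w = k ^+ size w *: v0.
    elim: w => [|j w IH] /=; first by rewrite expr0 scale1r.
    by case/andP => jn /IH ->; rewrite piTZ piT_v0 // scalerA exprSr.
  rewrite H ?size_rev ?size_iota //.
  by apply/allP => j; rewrite mem_rev mem_iota; lia.
rewrite foldr_scale; last by move=> j b y; exact: piTZ.
rewrite piTZ /tailop subn1 /= => E; apply: (scalerI (expf_neq0 n.-1 k_neq0)).
rewrite E scalerA; congr (_ *: _); rewrite mulrC exprnP; congr (k ^ _ * _); lia.
Qed.

Definition vb (d : nat -> bool) : V := spinvec n A v0 d.

Lemma vb_ext d e : same_sign n d e -> vb d = vb e.
Proof. exact: spinpart_ext. Qed.

Lemma vb_raise j d : raises j d -> A j (vb d) = vb (flip j d).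
Proof. exact: (spinvec_raise n_ge2 piT_braid piTZ). Qed.

Lemma vb_fix j d : (0 < j < n)%N -> d j.-1 = d j -> A j (vb d) = k *: vb d.
Proof. exact: (spinvec_fix n_ge2 piT_braid piTZ piT_v0). Qed.

Lemma vb_0 (d : nat -> bool) : d 0%N -> A 0 (vb d) = psi *: vb (flip 0 d).
Proof. exact: (spinvec_0 n_ge2 piT_braid piTZ piT_affine_v0). Qed.

Lemma flip0K d : flip 0 (flip 0 d) =1 d.
Proof. by move=> [|i]; rewrite /flipsign //= negbK. Qed.

Lemma flipK j d : (j <= n)%N -> same_sign n (flip j (flip j d)) d.
Proof.
by move=> jn i _; case: j jn => [|j] jn; [rewrite flip0K | rewrite flipsignK].
Qed.

Lemma vb_lower j d : (0 < j <= n)%N -> raises j (flip j d) -> A j (vb d) = c j *: vb d + vb (flip j d).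
Proof.
move=> /andP[j0 jn] r; have e : vb d = A j (vb (flip j d)).
  by rewrite vb_raise //; apply: vb_ext => i i_n; rewrite flipK.
by rewrite {1}e piT_quadratic // -e.
Qed.

Lemma vb_0' (d : nat -> bool) : ~~ d 0%N -> A 0 (vb d) = c 0%N *: vb d + psi^-1 *: vb (flip 0 d).
Proof.
move=> d0; have e : vb d = psi^-1 *: A 0 (vb (flip 0 d)).
  rewrite vb_0 // scalerA mulVf ?mulf_neq0 // scale1r; apply: vb_ext => i i_n; by rewrite flip0K.
by rewrite {1}e piTZ piT_quadratic // scalerDr [psi^-1 *: (_ *: _)]scalerA mulrC -scalerA -e.
Qed.

Lemma Tw_vb s : s \in ws -> Tw k0 k kn pi s v0 = vb (wsign s plus).
Proof.
move=> sw; rewrite /Tw piop_plain /vb -(spinvec_word _ n_ge2 piT_braid piTZ (ws_raise n_ge2 W sw)).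
by congr foldr; rewrite spinvec_plus.
Qed.

Definition eqsign (d e : nat -> bool) : bool := all (fun i => d i == e i) (iota 0 n).

Lemma eqsignP d e : reflect (same_sign n d e) (eqsign d e).
Proof.
apply: (iffP allP) => [H i i_n | H i]; first by apply/eqP/H; rewrite mem_iota.
by rewrite mem_iota => /andP[_ i_n]; apply/eqP/H.
Qed.

Lemma ws_uniq : uniq ws.
Proof. by case: W => _ [_ [_ [_ [u _]]]]; apply: map_uniq u. Qed.

Lemma ws_expand x : exists f : seq nat -> F, x = \sum_(s <- ws) f s *: vb (wsign s plus).
Proof.
case: M => _ [_ [_ [H _]]]; have [cs [sz ->]] := H x.
exists (fun s => cs`_(index s ws)); rewrite (big_nth [::]) big_mkord; apply: eq_bigr => i _.
by rewrite index_uniq ?ws_uniq // Tw_vb // mem_nth.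
Qed.

Lemma ws_free (f : seq nat -> F) : \sum_(s <- ws) f s *: vb (wsign s plus) = 0 ->
  forall s, s \in ws -> f s = 0.
Proof.
move=> E s sw; case: M => _ [_ [_ [_ H]]].
have := H (map f ws); rewrite size_map => /(_ erefl) H'.
have <- : (map f ws)`_(index s ws) = f s.
  by rewrite (nth_map [::]) ?index_mem // nth_index.
apply: H'; last by rewrite index_mem.
rewrite -[RHS]E (big_nth [::]) big_mkord; apply: eq_bigr => i _.
by rewrite (nth_map [::]) // Tw_vb // mem_nth.
Qed.

Lemma ws_of d : exists s, s \in ws /\ same_sign n (wsign s plus) d.
Proof. by have [s] := ws_sign_surj n_ge2 W d; exists s. Qed.

(* [co x d] is the coefficient of [vb d] in [x]. *)
Definition co (x : V) (d : nat -> bool) : F := sval (cid (ws_expand x)) (sval (cid (ws_of d))).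

(** Freeness makes [co] independent of the chosen expansion and of the word chosen for d. *)
Lemma co_val x d (f : seq nat -> F) s : s \in ws -> same_sign n (wsign s plus) d ->
  x = \sum_(r <- ws) f r *: vb (wsign r plus) -> co x d = f s.
Proof.
move=> sw sd xE; rewrite /co; case: cid => g /= gE; case: cid => r [rw rd] /=.
have <- : s = r by apply: (ws_sign_inj n_ge2 W) => // i i_n; rewrite sd ?rd.
apply/eqP; rewrite -subr_eq0; apply/eqP; apply: (ws_free (f := fun s => g s - f s)) => //.
under eq_bigr do rewrite scalerBl.
by rewrite sumrB -gE -xE subrr.
Qed.

Lemma co_ext x d e : same_sign n d e -> co x d = co x e.
Proof.
move=> de; have [f xE] := ws_expand x; have [s [sw sd]] := ws_of d.
by rewrite (co_val sw sd xE) (co_val sw _ xE) // => i i_n; rewrite sd // de.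
Qed.

Lemma co_linear d a x y : co (a *: x + y) d = a * co x d + co y d.
Proof.
have [[f xE] [g yE]] := (ws_expand x, ws_expand y); have [s [sw sd]] := ws_of d.
rewrite (co_val sw sd xE) (co_val sw sd yE); apply: (@co_val _ _ (fun s => a * f s + g s)) => //.
rewrite xE yE scaler_sumr -big_split; apply: eq_bigr => r _ /=.
by rewrite scalerDl scalerA.
Qed.

Lemma coD d x y : co (x + y) d = co x d + co y d.
Proof. by have := co_linear d 1 x y; rewrite scale1r mul1r. Qed.
Lemma co0 d : co 0 d = 0.
Proof. by apply: (addrI (co 0 d)); rewrite -coD !addr0. Qed.
Lemma coZ d a x : co (a *: x) d = a * co x d.
Proof. by have := co_linear d a x 0; rewrite co0 !addr0. Qed.
Lemma coN d x : co (- x) d = - co x d.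
Proof. by rewrite -scaleN1r coZ mulN1r. Qed.
Lemma coB d x y : co (x - y) d = co x d - co y d.
Proof. by rewrite coD coN. Qed.

Lemma co_vb d e : co (vb e) d = (eqsign d e)%:R.
Proof.
have [s [sw sd]] := ws_of d; have [r [rw re]] := ws_of e.
rewrite (co_val (f := fun s => (s == r)%:R) sw sd); last first.
  rewrite (bigD1_seq r) ?ws_uniq //= eqxx scale1r big1 ?addr0 => [|x /negbTE ->].
    by apply: vb_ext => i i_n; rewrite re.
  by rewrite scale0r.
congr (nat_of_bool _)%:R; apply/eqP/eqsignP => [E i i_n | E].
  by rewrite -sd // -re // E.
by apply: (ws_sign_inj n_ge2 W) => // i i_n; rewrite sd ?re ?E.
Qed.

Lemma co_expand x : x = \sum_(s <- ws) co x (wsign s plus) *: vb (wsign s plus).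
Proof.
have [f xE] := ws_expand x; rewrite {1}xE big_seq [RHS]big_seq; apply: eq_bigr => s sw.
by rewrite (co_val sw _ xE).
Qed.

Lemma co_inj x y : (forall d, co x d = co y d) -> x = y.
Proof.
by move=> xy; rewrite (co_expand x) (co_expand y); apply: eq_bigr => s _; rewrite xy.
Qed.

Lemma co_sum d (I : Type) (r : seq I) (f : I -> V) : co (\sum_(i <- r) f i) d = \sum_(i <- r) co (f i) d.
Proof. exact: (big_morph (co^~ d) (coD d) (co0 d)). Qed.

Lemma linear_basis (f g : V -> F) : (forall a x y, f (a *: x + y) = a * f x + f y) ->
  (forall a x y, g (a *: x + y) = a * g x + g y) -> (forall d, f (vb d) = g (vb d)) -> f =1 g.
Proof.
move=> fl gl fg x; rewrite (co_expand x); elim: ws => [|s r IH]; last by rewrite !big_cons fl gl fg IH.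
rewrite !big_nil; have := fl 0 0 0; have := gl 0 0 0.
rewrite scale0r addr0 !mul0r !add0r => _ _.
have z (h : V -> F) : (forall a x y, h (a *: x + y) = a * h x + h y) -> h 0 = 0.
  by move=> hl; have /eqP := hl 1 0 0; rewrite scale1r addr0 mul1r -subr_eq subrr eq_sym => /eqP.
by rewrite !z.
Qed.

Lemma flip_ext j d e : (j <= n)%N -> same_sign n d e -> same_sign n (flip j d) (flip j e).
Proof.
case: j => [_ H i i_n|j jn]; last exact: flipsign_ext.
by rewrite /flipsign /=; case: eqP => _; rewrite H.
Qed.

Lemma eqsign_flip j d e : (j <= n)%N -> eqsign (flip j d) (flip j e) = eqsign d e.
Proof.
move=> jn; apply/eqsignP/eqsignP => H; last exact: flip_ext.
by move=> i i_n; rewrite -(@flipK j d) // -(@flipK j e) //; apply: flip_ext.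
Qed.

Lemma raises_ext j d e : (0 < j <= n)%N -> same_sign n d e -> raises j d = raises j e.
Proof.
move=> jn H; rewrite /raises; case: eqP => jn'; rewrite !H //; lia.
Qed.

Lemma raises_flip j d : (0 < j <= n)%N -> raises j d -> ~~ raises j (flip j d).
Proof.
move=> /andP[j0 jn]; rewrite /raises /flipsign (gtn_eqF j0); case: (eqVneq j n) => [_ h|nj].
  by rewrite eqxx negbK.
case/and3P => _ h1 h2; rewrite !eqxx (_ : (j == j.-1) = false) ?h1 ?h2 /= ?andbF //.
by apply: gtn_eqF; rewrite prednK.
Qed.

Lemma raises_cases j e : (0 < j <= n)%N ->
  [\/ raises j e, raises j (flip j e) | (0 < j < n)%N /\ e j.-1 = e j].
Proof.
move=> /andP[j0 jn]; rewrite /raises /flipsign (gtn_eqF j0); case: (eqVneq j n) => [_|nj].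
  by rewrite eqxx negbK; case: (e n.-1); [apply: Or32 | apply: Or31].
have jm : (0 < j < n)%N by rewrite j0 ltn_neqAle nj.
rewrite !eqxx (_ : (j == j.-1) = false) ?jm /=; last by apply: gtn_eqF; rewrite prednK.
by case: (e j.-1); case: (e j); [apply: Or33 | apply: Or32 | apply: Or31 | apply: Or33].
Qed.

Lemma kap_mid j : (0 < j < n)%N -> kap j = k.
Proof. by case/andP => j0 jn; rewrite /kap (gtn_eqF j0) (ltn_eqF jn). Qed.

Lemma neq_raises j d e : (0 < j <= n)%N -> raises j d != raises j e -> eqsign d e = false.
Proof. by move=> jn; apply: contraNF => /eqsignP H; rewrite (raises_ext jn H). Qed.

(** The transpose of the action on basis vectors: the pattern [flip j d] receives d by raising, and
    itself through the quadratic relation. *)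
Lemma co_raise j d x : (0 < j <= n)%N -> raises j d ->
  co (A j x) (flip j d) = co x d + c j * co x (flip j d).
Proof.
move=> jn rd; have jn' : (j <= n)%N by case/andP: jn.
have nrd := raises_flip jn rd.
apply: (@linear_basis (fun x => co (A j x) (flip j d)) (fun x => co x d + c j * co x (flip j d))).
- by move=> a y z; rewrite piTD piTZ co_linear.
- by move=> a y z; rewrite !co_linear; ring.
move=> e; case: (raises_cases e jn) => [re|re|[jm se]].
- rewrite vb_raise // !co_vb eqsign_flip // (@neq_raises j (flip j d) e) ?mulr0 ?addr0 //.
  by rewrite re (negbTE nrd).
- by rewrite vb_lower // coD coZ !co_vb eqsign_flip // addrC.
rewrite vb_fix // coZ !co_vb.
have nr e' : e' j.-1 = e' j -> raises j e' = false.
  by rewrite /raises => h; rewrite (ltn_eqF (andP jm).2) jm h andNb.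
rewrite (@neq_raises j d e) ?rd ?nr // add0r (_ : eqsign (flip j d) e = false) ?mulr0 //.
apply/negbTE/negP => /eqsignP E; case/andP: (jm) => j0 j1.
move: rd; rewrite /raises (ltn_eqF j1) jm /= => /andP[d1 d2].
have := E j j1; have := E j.-1 (leq_ltn_trans (leq_pred _) j1).
rewrite /flipsign (gtn_eqF j0) (ltn_eqF j1) !eqxx (_ : (j == j.-1) = false); last first.
  by apply: gtn_eqF; rewrite prednK.
by rewrite se d2 (negbTE d1) => <-.
Qed.

Lemma co_lower j d x : (0 < j <= n)%N -> raises j d -> co (A j x) d = co x (flip j d).
Proof.
move=> jn rd; have := co_raise (A j x) jn rd; rewrite piT_quadratic ?coD ?coZ; last by case/andP: jn.
by rewrite addrC => /addIr.
Qed.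

Lemma co_fix j d x : (0 < j < n)%N -> d j.-1 = d j -> co (A j x) d = k * co x d.
Proof.
move=> jm sd; have jn : (0 < j <= n)%N by case/andP: jm => -> /ltnW.
have jn' : (j <= n)%N by case/andP: jn.
apply: (@linear_basis (fun x => co (A j x) d) (fun x => k * co x d)).
- by move=> a y z; rewrite piTD piTZ co_linear.
- by move=> a y z; rewrite !co_linear; ring.
have nr e' : e' j.-1 = e' j -> raises j e' = false.
  by rewrite /raises => h; rewrite (ltn_eqF (andP jm).2) jm h andNb.
have nfd : raises j (flip j d) = false.
  case/andP: (jm) => j0 j1; apply: nr; rewrite /flipsign (gtn_eqF j0) (ltn_eqF j1) !eqxx.
  by case: eqP => [->|_]; rewrite ?sd.
have ff e : eqsign d (flip j e) = eqsign (flip j d) e.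
  by rewrite -(eqsign_flip (flip j d) e jn'); apply/eqsignP/eqsignP => H i i_n; rewrite -H // flipK.
move=> e; case: (raises_cases e jn) => [re|re|[_ se]].
- by rewrite vb_raise // !co_vb ff !(@neq_raises j _ e) ?mulr0 // re ?nfd ?nr.
- rewrite vb_lower // coD coZ !co_vb kap_mid // (@neq_raises j d (flip j e)) ?re ?nr //.
  rewrite -(eqsign_flip d e jn') (@neq_raises j (flip j d) (flip j e)) ?re ?nfd //.
  by rewrite !mulr0 addr0.
- by rewrite vb_fix // coZ.
Qed.

Lemma co_0 (d : nat -> bool) x : d 0%N ->
  co (A 0 x) (flip 0 d) = psi * co x d + c 0%N * co x (flip 0 d).
Proof.
move=> d0; have n0 : (0 < n)%N by apply: ltnW.
apply: (@linear_basis (fun x => co (A 0 x) (flip 0 d)) (fun x => psi * co x d + c 0%N * co x (flip 0 d))).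
- by move=> a y z; rewrite piTD piTZ co_linear.
- by move=> a y z; rewrite !co_linear; ring.
have ne d' e' : d' 0%N != e' 0%N -> eqsign d' e' = false.
  by apply: contraNF => /eqsignP ->.
move=> e; have [e0|e0] := boolP (e 0%N).
  rewrite vb_0 // coZ !co_vb eqsign_flip // (ne (flip 0 d) e) ?mulr0 ?addr0 //.
  by rewrite /flipsign /= d0 e0.
rewrite vb_0' // coD !coZ !co_vb eqsign_flip // (ne d e) ?mulr0 ?add0r ?addr0 //.
by rewrite d0 (negbTE e0).
Qed.

Lemma co_0' (d : nat -> bool) x : d 0%N -> psi * co (A 0 x) d = co x (flip 0 d).
Proof.
move=> d0; have := co_0 (A 0 x) d0; rewrite piT_quadratic // coD coZ.
by rewrite addrC => /addIr.
Qed.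

End SpinModule.

(** * The KZ equations in coordinates *)

Section KZEquations.
Variables (F : closedFieldType) (n : nat) (q12 k0 k kn u0 un psi0 psin : F).
Hypothesis uncountable : forall f : nat -> F, exists x : F, forall i, f i != x.
Hypothesis n_ge2 : (2 <= n)%N.
Hypothesis q12_neq0 : q12 != 0.
Hypotheses (k0_neq0 : k0 != 0) (k_neq0 : k != 0) (kn_neq0 : kn != 0).
Hypotheses (u0_neq0 : u0 != 0) (un_neq0 : un != 0).
Hypotheses (psi0_neq0 : psi0 != 0) (psin_neq0 : psin != 0).
Variables (V : lmodType F) (pi : 'I_n.+1 -> {linear V -> V}) (v0 : V).
Variables (red : seq nat -> seq nat) (ws : seq (seq nat)) (w0 w0J : seq nat).
Hypothesis W : W0data n red ws w0 w0J.
Hypothesis M : is_MJ k0 k kn pi psi0 psin ws v0.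
Local Notation gpt := (gpt n q12).
Local Notation X := (gpt -> F^o).
Local Notation sj := (sj n q12).
Local Notation kap := (kap n k0 k kn).
Local Notation TX := (@TX F n q12 k0 k kn u0 un n_ge2 q12_neq0).
Local Notation symX := (@symX F n q12 k0 k kn u0 un n_ge2 q12_neq0).
Local Notation affX := (@affX F n q12 k0 k kn u0 un n_ge2 q12_neq0).
Local Notation laurent := (@laurent F n).
Local Notation lnonzero := (@lnonzero F n).
Local Notation lB := (lB n u0 un).
Local Notation lvar := (lvar n q12).
Local Notation ctnum := (ctnum n q12 k0 k kn u0 un).
Local Notation KZsol := (KZsol q12 k0 k kn u0 un pi).
Local Notation A := (piT pi).
Local Notation psi := (psi0 * psin).
Local Notation flip := (flipsign n).
Local Notation raises := (raises n).
Local Notation wsign := (wsign n).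
Local Notation co := (co n_ge2 W M).
Local Notation vb := (vb pi v0).
Local Notation c j := (kap j - (kap j)^-1).
Local Notation TXs := (TXZ k0 k kn u0 un n_ge2 q12_neq0).
Local Notation TXbr := (TX_braid n_ge2 q12_neq0 k0_neq0 k_neq0 kn_neq0 u0_neq0 un_neq0).

Definition colaurent (f : (nat -> F) -> V) : Prop := forall d, laurent (fun t => co (f t) d).

Lemma laurentV_co f : laurentV n f -> colaurent f.
Proof.
move=> [s fs] d; exists [seq (p.1, co p.2 d) | p <- s] => t tt.
rewrite fs // co_sum big_map; apply: eq_bigr => p _ /=; by rewrite coZ mulrC.
Qed.

Lemma co_laurentV f : colaurent f -> laurentV n f.
Proof.
move=> fl; suff H l : exists s : seq ({ffun 'I_n -> int} * V), forall t, torus n t ->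
    \sum_(r <- l) co (f t) (wsign r plus) *: vb (wsign r plus) = \sum_(p <- s) mono p.1 t *: p.2.
  by have [s sP] := H ws; exists s => t tt; rewrite -sP // -co_expand.
elim: l => [|r l [s sP]]; first by exists [::] => t _; rewrite !big_nil.
have [s' s'P] := fl (wsign r plus).
exists ([seq (p.1, p.2 *: vb (wsign r plus)) | p <- s'] ++ s) => t tt.
rewrite big_cons sP // big_cat big_map /= s'P // scaler_suml; congr (_ + _).
by apply: eq_bigr => p _; rewrite scalerA mulrC.
Qed.

Lemma colaurentD f g : colaurent f -> colaurent g -> colaurent (fun t => f t + g t).
Proof.
move=> fl gl d; apply: laurent_ext (laurentD (fl d) (gl d)) => t _; exact: coD.
Qed.

Lemma colaurentZ (a : (nat -> F) -> F) f : laurent a -> colaurent f -> colaurent (fun t => a t *: f t).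
Proof.
move=> al fl d; apply: laurent_ext (laurentM al (fl d)) => t _; exact: coZ.
Qed.

Lemma colaurentB f g : colaurent f -> colaurent g -> colaurent (fun t => f t - g t).
Proof.
move=> fl gl d; apply: laurent_ext (laurentB (fl d) (gl d)) => t _; exact: coB.
Qed.

Lemma colaurent_sj j f : (j <= n)%N -> colaurent f -> colaurent (fun t => f (sj j t)).
Proof. by move=> jn fl d; apply: (laurent_sj n_ge2 q12_neq0 jn (fl d)). Qed.

Lemma colaurentA j f : colaurent f -> colaurent (fun t => A j (f t)).
Proof.
move=> /co_laurentV [s fs]; apply: laurentV_co; exists [seq (p.1, A j p.2) | p <- s] => t tt.
rewrite fs // big_map /piT linear_sum; apply: eq_bigr => p _; exact: linearZ.
Qed.

Lemma colaurent_vanish h g : lnonzero h -> colaurent g ->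
  (forall p : gpt, h (pt p) != 0 -> g (pt p) = 0) -> forall t, torus n t -> g t = 0.
Proof.
move=> hn gl H t tt; apply: (co_inj (n_ge2:=n_ge2) (W:=W) (M:=M)) => d; rewrite co0.
apply: (laurent_vanish uncountable q12_neq0 hn (gl d)) => // p hp; by rewrite H // co0.
Qed.

Definition Ainv j x : V := A j x - c j *: x.
Definition Kden j (t : nat -> F) : F := (kap j)^-1 + lB j * lvar j t + - kap j * lvar j t ^+ lmul n j.
Definition Knum j (t : nat -> F) (x : V) : V :=
  Ainv j x + (lB j * lvar j t) *: x - lvar j t ^+ lmul n j *: A j x.
(* The intertwiner with [Knum] composed to [Kden * ctnum]; [ctnum] is the numerator of the
   function in [varpiT], so it is the bridge between the KZ equations and [varpiT]. *)
Definition Kadj j (t : nat -> F) (x : V) : V :=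
  A j x - (lB j * lvar j t) *: x - lvar j t ^+ lmul n j *: Ainv j x.

Lemma Kmid j : (0 < j < n)%N -> ((j == 0%N) = false) * ((j == n) = false).
Proof. by case/andP => j0 jn; rewrite (gtn_eqF j0) (ltn_eqF jn). Qed.

Lemma kap_neq0' j : kap j != 0.
Proof. by rewrite /kap; case: ifP => // _; case: ifP. Qed.

Lemma KZsolE f : KZsol f <->
  forall j, (j <= n)%N -> aeq n (fun t => (Kden j t)^-1 *: Knum j t (f (sj j t))) f.
Proof.
have n0 : (n == 0)%N = false by apply: gtn_eqF; apply: ltnW.
have E0 : (fun t => (Kden 0 t)^-1 *: Knum 0 t (f (sj 0 t))) =
    fun t => K0 k0 k kn u0 pi (q12 / t 0%N) (f (sj 0 t)).
  apply: funext => t; rewrite /K0 /Kden /Knum /piop /Ainv /lB /lvar /kap /lmul /=.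
  by move: (q12 / _) => y; congr (_^-1 *: _); field; rewrite k0_neq0 u0_neq0.
have En : (fun t => (Kden n t)^-1 *: Knum n t (f (sj n t))) =
    fun t => Kn k0 k kn un pi (t n.-1) (f (sj n t)).
  apply: funext => t; rewrite /Kn /Kden /Knum /piop /Ainv /lB /lvar /kap /lmul ?eqxx ?n0 ?orbT /=.
  by move: (t n.-1) => y; congr (_^-1 *: _); field; rewrite kn_neq0 un_neq0.
have Em j : (0 < j < n)%N -> (fun t => (Kden j t)^-1 *: Knum j t (f (sj j t))) =
    fun t => Ri k0 k kn pi j (t j.-1 / t j) (f (sj j t)).
  move=> jm; apply: funext => t; rewrite /Ri /Kden /Knum /piop /Ainv /lB /lvar /kap /lmul /=.
  rewrite !(Kmid jm) /= mul0r scale0r !addr0 expr1.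
  by move: (_ / _) => y; congr (_^-1 *: _); field.
split.
  move=> [H0 [Hm Hn]]; apply: (letter_cases n_ge2); rewrite ?E0 ?En // => j jm.
  by rewrite Em //; apply: Hm.
move=> H; split; first by rewrite -E0; apply: H.
by split; [move=> j jm; rewrite -Em //; apply: H; case/andP: jm => _ /ltnW | rewrite -En; apply: H].
Qed.

Lemma piTN j x : A j (- x) = - A j x. Proof. exact: linearN. Qed.

(** Unitarity K(y) K(1/y) = 1 with denominators cleared: [Kadj] and [ctnum] are $-y^m$ times [Knum]
    and [Kden] at 1/y. *)
Lemma Knum_adj j t x : (j <= n)%N -> Knum j t (Kadj j t x) = (Kden j t * ctnum j t) *: x.
Proof.
move=> jn; rewrite /Knum /Kadj /Ainv !(piTD, piTN, piTZ) !(piT_quadratic M) //.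
apply: (co_inj (n_ge2:=n_ge2) (W:=W) (M:=M)) => d; rewrite !(coD, coN, coZ) /Kden /ctnum.
by field; apply: kap_neq0'.
Qed.

Lemma Kadj_num j t x : (j <= n)%N -> Kadj j t (Knum j t x) = (Kden j t * ctnum j t) *: x.
Proof.
move=> jn; rewrite /Knum /Kadj /Ainv !(piTD, piTN, piTZ) !(piT_quadratic M) //.
apply: (co_inj (n_ge2:=n_ge2) (W:=W) (M:=M)) => d; rewrite !(coD, coN, coZ) /Kden /ctnum.
by field; apply: kap_neq0'.
Qed.

Lemma KadjZ j t a x : Kadj j t (a *: x) = a *: Kadj j t x.
Proof.
apply: (co_inj (n_ge2:=n_ge2) (W:=W) (M:=M)) => d.
by rewrite /Kadj /Ainv !piTZ !(coD, coN, coZ); ring.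
Qed.

Lemma KnumZ j t a x : Knum j t (a *: x) = a *: Knum j t x.
Proof.
apply: (co_inj (n_ge2:=n_ge2) (W:=W) (M:=M)) => d.
by rewrite /Knum /Ainv !piTZ !(coD, coN, coZ); ring.
Qed.

Lemma lnonzero_Kden j : (j <= n)%N -> lnonzero (Kden j).
Proof. by move=> jn; apply: lnonzero_lvar; rewrite ?invr_eq0 ?kap_neq0'. Qed.

Lemma lnonzero_ctnum j : (j <= n)%N -> lnonzero (ctnum j).
Proof. by move=> jn; apply: lnonzero_lvar; rewrite ?kap_neq0'. Qed.

Lemma colaurent_Kadj j f : (j <= n)%N -> colaurent f -> colaurent (fun t => Kadj j t (f t)).
Proof.
move=> jn fl; have Al := @colaurentA j _ fl; have ly := laurent_lvar n_ge2 q12_neq0 jn.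
apply: colaurentB; last apply: colaurentZ; [apply: colaurentB => //; apply: colaurentZ => //| |].
- exact: laurentZ.
- exact: laurentX.
- by apply: colaurentB => //; apply: colaurentZ => //; apply: laurent_const.
Qed.

Lemma colaurent_Knum j f : (j <= n)%N -> colaurent f -> colaurent (fun t => Knum j t (f t)).
Proof.
move=> jn fl; have Al := @colaurentA j _ fl; have ly := laurent_lvar n_ge2 q12_neq0 jn.
apply: colaurentB; last by apply: colaurentZ => //; apply: laurentX.
apply: colaurentD; last by apply: colaurentZ => //; apply: laurentZ.
by apply: colaurentB => //; apply: colaurentZ => //; apply: laurent_const.
Qed.

(** Applying [Kadj] clears the denominator, so both sides become Laurent, and equality off a
    hypersurface amounts to equality at all good points. *)
Lemma KZ_good j f : (j <= n)%N -> colaurent f ->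
  aeq n (fun t => (Kden j t)^-1 *: Knum j t (f (sj j t))) f <->
  forall p : gpt, Kadj j (pt p) (f (pt p)) = ctnum j (pt p) *: f (sj j (pt p)).
Proof.
move=> jn fl; have fsl := colaurent_sj jn fl.
have [lD _] := lnonzero_Kden jn; have [lC _] := lnonzero_ctnum jn.
split=> [/aeq_elim [h [hn H]] p | H].
  have gl := colaurentB (colaurent_Kadj jn fl) (colaurentZ lC fsl).
  apply/eqP; rewrite -subr_eq0; apply/eqP.
  apply: (colaurent_vanish (lnonzeroM uncountable q12_neq0 hn (lnonzero_Kden jn)) gl _ (pt_torus p)).
  move=> r; rewrite mulf_eq0 negb_or => /andP[h1 h2]; rewrite -(H _ (pt_torus r) h1).
  by rewrite KadjZ Kadj_num // scalerA mulrA mulVf // mul1r subrr.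
have gl := colaurentB (colaurent_Knum jn fsl) (colaurentZ lD fl).
have E : forall t, torus n t -> Knum j t (f (sj j t)) - Kden j t *: f t = 0.
  apply: (colaurent_vanish (lnonzero_ctnum jn) gl) => p h1.
  apply: (scalerI h1); rewrite scaler0 scalerBr -KnumZ -H Knum_adj //.
  by rewrite scalerA mulrC subrr.
apply: (aeq_intro (lnonzero_Kden jn)) => t tt h1.
by have /eqP := E t tt; rewrite subr_eq0 => /eqP ->; rewrite scalerA mulVf // scale1r.
Qed.

Definition fX (f : (nat -> F) -> V) (d : nat -> bool) : X := fun p => co (f (pt p)) d.

(** Dividing by $1-y^m$, which is invertible at good points, leaves varpi(T_j) f = pi(T_j)^-1 f,
    written in coefficients. *)
Lemma Kadj_TX j f p : (j <= n)%N ->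
  Kadj j (pt p) (f (pt p)) = ctnum j (pt p) *: f (sj j (pt p)) <->
  forall d, TX j (fX f d) p = co (A j (f (pt p))) d - c j * fX f d p.
Proof.
move=> jn; have y1 := lvar_neq1 n_ge2 q12_neq0 p jn.
have ct := ctilde_num n_ge2 q12_neq0 k0_neq0 k_neq0 kn_neq0 u0_neq0 un_neq0 jn (pt_torus p) y1.
have TXE d : (1 - lvar j (pt p) ^+ lmul n j) * TX j (fX f d) p =
   (1 - lvar j (pt p) ^+ lmul n j) * (kap j)^-1 * fX f d p +
   ctnum j (pt p) * (co (f (sj j (pt p))) d - fX f d p).
  by rewrite -ct /TX /reflop /fX pt_sG //; ring.
have adj d : co (Kadj j (pt p) (f (pt p))) d = (1 - lvar j (pt p) ^+ lmul n j) *
  (co (A j (f (pt p))) d - c j * fX f d p - (kap j)^-1 * fX f d p) + ctnum j (pt p) * fX f d p.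
  rewrite /Kadj /Ainv /ctnum !(coD, coN, coZ) /fX; field; exact: kap_neq0'.
split=> [E d | E].
  apply: (mulfI y1); rewrite TXE; have := congr1 (co^~ d) E; rewrite adj coZ.
  by move=> h; rewrite mulrBr -h; ring.
apply: (co_inj (n_ge2:=n_ge2) (W:=W) (M:=M)) => d; rewrite adj coZ.
by have := TXE d; rewrite E => h; rewrite mulrBr h; ring.
Qed.

Lemma KZ_TX f : colaurent f -> KZsol f <->
  forall j p d, (j <= n)%N -> TX j (fX f d) p = co (A j (f (pt p))) d - c j * fX f d p.
Proof.
move=> fl; rewrite KZsolE; split=> H j.
  by move=> p d jn; have /(KZ_good jn fl) /(_ p) /(Kadj_TX f p jn) := H j jn; apply.
by move=> jn; apply/(KZ_good jn fl) => p; apply/(Kadj_TX f p jn) => d; apply: H.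
Qed.

Lemma fX_ext f d e : same_sign n d e -> fX f d = fX f e.
Proof. by move=> de; apply: funext => p; apply: co_ext. Qed.

Local Notation TXq := (TX_quadratic n_ge2 q12_neq0 k0_neq0 k_neq0 kn_neq0 u0_neq0 un_neq0).
Local Notation co_raise_ := (co_raise n_ge2 k0_neq0 k_neq0 kn_neq0 psi0_neq0 psin_neq0 W M).
Local Notation co_lower_ := (co_lower n_ge2 k0_neq0 k_neq0 kn_neq0 psi0_neq0 psin_neq0 W M).
Local Notation co_fix_ := (co_fix n_ge2 k0_neq0 k_neq0 kn_neq0 psi0_neq0 psin_neq0 W M).
Local Notation co_0_ := (co_0 n_ge2 k0_neq0 k_neq0 kn_neq0 psi0_neq0 psin_neq0 W M).
Local Notation co_0_swap_ := (co_0' n_ge2 k0_neq0 k_neq0 kn_neq0 psi0_neq0 psin_neq0 W M).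

Definition spin_relations (f : (nat -> F) -> V) : Prop :=
  [/\ forall j d, (0 < j <= n)%N -> raises j d -> TX j (fX f (flip j d)) = fX f d,
      forall j d, (0 < j < n)%N -> d j.-1 = d j -> TX j (fX f d) = k^-1 *: fX f d &
      forall d : nat -> bool, d 0%N -> TX 0 (fX f (flip 0 d)) = psi *: fX f d].

(** Of the two equations for d and [flip j d] one is kept; the other follows from it by the
    quadratic relation of [TX]. *)
Lemma TX_relations f :
  (forall j p d, (j <= n)%N -> TX j (fX f d) p = co (A j (f (pt p))) d - c j * fX f d p) <->
  spin_relations f.
Proof.
split=> [H|[H1 H2 H3] j p d jn].
  split=> [j d /[dup] jn /andP[_ jn'] r|j d jm s|d d0]; apply: funext => p.
  - by rewrite H // co_raise_ // addrK.
  - rewrite H ?co_fix_ //; last by case/andP: jm => _ /ltnW.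
    by rewrite (kap_mid _ _ _ jm) -mulrBl subKr.
  - by rewrite H // co_0_ // addrK.
have [j0|j0] := posnP j; last first.
  have jn' : (0 < j <= n)%N by rewrite j0.
  have [r|r|[jm sd]] := raises_cases d jn'.
  - have E := TXq (fX f (flip j d)) jn; rewrite (H1 _ _ jn' r) in E.
    by rewrite E co_lower_ // /lA -opprB addrC !fctE /GRing.scale /= mulNr.
  - have e : same_sign n (flip j (flip j d)) d by move=> i i_n; rewrite flipK.
    rewrite -(fX_ext f e) (H1 _ _ jn' r) -(co_ext n_ge2 W M _ e) co_raise_ //.
    by rewrite addrK.
  - rewrite (H2 _ _ jm sd) co_fix_ // (kap_mid _ _ _ jm) -mulrBl subKr //.
subst j; have [d0|d0] := boolP (d 0%N).
  have E := TXq (fX f (flip 0 d)) jn; rewrite (H3 _ d0) TXs in E.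
  have psin0 : psi != 0 by rewrite mulf_neq0.
  apply: (mulfI psin0); rewrite mulrBr co_0_swap_ //; have := congr1 (fun g : X => g p) E.
  rewrite !fctE /GRing.scale /= => ->; rewrite /lA /fX; ring.
have e : same_sign n (flip 0 (flip 0 d)) d by move=> i i_n; rewrite flip0K.
have d0' : flip 0 d 0%N by rewrite /flipsign /= d0.
by rewrite -(fX_ext f e) (H3 _ d0') -(co_ext n_ge2 W M _ e) co_0_ // addrK.
Qed.

Lemma spinvec_first (T : nat -> X -> X) (x0 : X) : spinvec n T x0 (fun i => i == 0%N) = tailop n T 1 x0.
Proof.
suff H m : (0 < m)%N -> spinpart n T x0 m (fun i => i == 0%N) = tailop n T 1 x0.
  by apply: H; apply: ltnW.
by elim: m => // -[//|m] IH _; apply: IH.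
Qed.

(** The component at d comes from the one at [flip j d], against the direction of the basis vectors;
    complementing the patterns reconciles the two directions. *)
Lemma raises_neg j d : (0 < j <= n)%N -> raises j d ->
  raises j (flip j (fun i => ~~ d i)) /\ flip j (fun i => ~~ d i) =1 (fun i => ~~ flip j d i).
Proof.
move=> /andP[j0 jn]; rewrite /raises /flipsign (gtn_eqF j0); case: (eqVneq j n) => [_ r|nj].
  by rewrite eqxx negbK r; split=> // i; case: eqP.
rewrite !eqxx (_ : (j == j.-1) = false); last by apply: gtn_eqF; rewrite prednK.
by case/and3P => jm d1 d2; rewrite jm d1 d2; split=> // i; do 2?case: ifP.
Qed.

Lemma spin_relationsP f : spin_relations f <->
  [/\ symX (fX f (fun _ => true)), affX psi (fX f (fun _ => true)) &
      forall d, fX f d = spinvec n TX (fX f (fun _ => true)) (fun i => ~~ d i)].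
Proof.
set P := fX f (fun _ => true); split=> [[H1 H2 H3]|[Ps Pa H]].
  have word s : allraise n s plus -> fX f (fun i => ~~ wsign s plus i) = foldr TX P s.
    elim: s => //= j s IH /andP[rs r]; rewrite -(IH rs).
    have jn : (0 < j <= n)%N.
      by have := allraise_legal n_ge2 (s := j :: s) (d := plus); rewrite /= rs r => /(_ isT) /andP[].
    have [r' E] := raises_neg jn r; have := H1 _ _ jn r'.
    rewrite (fX_ext f (e := fun i => ~~ wsign s plus i)); last first.
      by apply: flipK => //; case/andP: jn.
    by move=> ->; apply: fX_ext => i _; rewrite E.
  have spin e : fX f (fun i => ~~ e i) = spinvec n TX P e.
    have [s [rs se]] := raising_word n_ge2 e.
    rewrite -(fX_ext f (d := fun i => ~~ wsign s plus i)); last by move=> i i_n; rewrite se.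
    rewrite word // -[P in LHS](@spinvec_plus _ n _ TX P plus) //.
    by rewrite (spinvec_word _ n_ge2 TXbr TXs rs); apply: spinpart_ext.
  split=> [j jm||d]; first exact: H2.
    (* The pattern with its only plus at the first place is [flip 0] of the all-minus one, and its
       component is $T_1\cdots T_n$ applied to P. *)
    by rewrite /affX -spinvec_first -spin -H3.
  by rewrite -spin; apply: fX_ext => i _; rewrite negbK.
have fE e : spinvec n TX P e = fX f (fun i => ~~ e i).
  by rewrite H; apply: spinpart_ext => // i _; rewrite negbK.
have Pm j : (0 < j < n)%N -> TX j P = k^-1 *: P by apply: Ps.
split=> [j d jn r|j d jm sd|d d0].
- have [r' E] := raises_neg jn r.
  rewrite (H (flip j d)) (_ : spinvec _ _ _ _ = spinvec n TX P (flip j (fun i => ~~ d i))); last first.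
    by apply: spinpart_ext => // i _; rewrite E.
  rewrite (spinvec_raise n_ge2 TXbr TXs) // H; apply: spinpart_ext => // i i_n.
  by rewrite flipK //; case/andP: jn.
- by rewrite H (spinvec_fix n_ge2 TXbr TXs Pm) //= sd.
- rewrite H (spinvec_0 n_ge2 TXbr TXs Pa); last by rewrite /flipsign /= negbK.
  by rewrite H; congr (_ *: _); apply: spinpart_ext => // -[|i] i_n; rewrite /flipsign //= negbK.
Qed.

Lemma KZ_spin f : laurentV n f -> KZsol f <->
  [/\ symX (fX f (fun _ => true)), affX psi (fX f (fun _ => true)) &
      forall d, fX f d = spinvec n TX (fX f (fun _ => true)) (fun i => ~~ d i)].
Proof.
move=> fl; rewrite KZ_TX ?TX_relations ?spin_relationsP //; exact: laurentV_co.
Qed.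

End KZEquations.

(** * Classification of the solutions *)

Section KoornwinderPolynomials.
Variables (F : closedFieldType) (n : nat) (q12 k0 k kn u0 un : F).
Hypothesis uncountable : forall f : nat -> F, exists x : F, forall i, f i != x.
Hypothesis n_ge2 : (2 <= n)%N.
Hypothesis q12_neq0 : q12 != 0.
Hypotheses (k0_neq0 : k0 != 0) (k_neq0 : k != 0) (kn_neq0 : kn != 0).
Hypotheses (u0_neq0 : u0 != 0) (un_neq0 : un != 0).
Hypothesis generic : forall a b c d : int,
  (q q12) ^ a * k0 ^ b * kn ^ c * k ^ d = 1 -> a = 0 /\ d = 0.
Local Notation gpt := (gpt n q12).
Local Notation YX := (@YX F n q12 k0 k kn u0 un n_ge2 q12_neq0).
Local Notation levX := (@levX F n q12).
Local Notation eigY i := (@wdiag F n q12 k0 k kn (Yword n (@nat_of_ord n i).+1)).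
Local Notation isK := (isKoornwinder q12 k0 k kn u0 un).

Lemma Yword_letters i : (i < n)%N -> all (fun a : nat * bool => a.1 <= n)%N (Yword n i.+1).
Proof.
move=> i_n; rewrite /Yword !all_cat !all_map /=.
apply/and3P; split; apply/allP => j; rewrite ?mem_rev mem_iota /=; lia.
Qed.

Lemma levX_of (P : (nat -> F) -> F) (s : lpoly F n) : (forall t, torus n t -> P t = lev s t) ->
  (fun r : gpt => P (pt r)) = levX s.
Proof. by move=> H; apply: funext => r; apply: H; apply: pt_torus. Qed.

Lemma Koornwinder_eigenvector m P : isK (constvec n m) P -> exists s : lpoly F n,
  [/\ lcoef s (constvec n m) = 1, forall t, torus n t -> P t = lev s t &
      forall i : 'I_n, YX i.+1 (levX s) = eigY i (constvec n m) *: levX s].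
Proof.
move=> [lP [[s [_ [Ps s1]]] EP]]; exists s; split=> // i.
have lg : laurent n (fun t => (gamma q12 k0 k kn (constvec n m) i)^-1 * P t) by apply: laurentZ.
have /(varpi_word_aeq uncountable n_ge2 q12_neq0 k0_neq0 k_neq0 kn_neq0 u0_neq0 un_neq0
  (Yword_letters (ltn_ord i)) lP lg) := EP i.
rewrite (levX_of Ps) Yeigen_const // => E; rewrite /YX E; apply: funext => r.
by rewrite Ps //; apply: pt_torus.
Qed.

Lemma Koornwinder_exists m : exists P, isK (constvec n m) P.
Proof.
have [s [s1 Es]] := joint_eigenvector uncountable n_ge2 q12_neq0 k0_neq0 k_neq0 kn_neq0 u0_neq0 un_neq0
  generic (constvec n m).
have lP := laurent_lev s; exists (lev s); split=> //; split.
  (* [coef_is] asks for a list without repeated exponents, so like terms are collected. *)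
  pose u := undup (map fst s); exists [seq (lam, lcoef s lam) | lam <- u].
  split; [|split].
  - by rewrite -map_comp map_id undup_uniq.
  - move=> t _; rewrite (@lev_lcoef _ _ s u) ?undup_uniq // ?big_map //.
    by move=> x; rewrite mem_undup.
  rewrite big_map /= -s1; have [mu|mu] := boolP (constvec n m \in u).
    rewrite big_mkcond (bigD1_seq (constvec n m)) ?undup_uniq //= eqxx big1 ?addr0 //.
    by move=> lam /negbTE ->.
  rewrite lcoef_out; last by move: mu; rewrite mem_undup.
  by rewrite big1_seq // => lam /andP[/eqP -> lu]; rewrite lu in mu.
move=> i; have lg : laurent n (fun t => (gamma q12 k0 k kn (constvec n m) i)^-1 * lev s t) by apply: laurentZ.
apply/(varpi_word_aeq uncountable n_ge2 q12_neq0 k0_neq0 k_neq0 kn_neq0 u0_neq0 un_neq0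
  (Yword_letters (ltn_ord i)) lP lg).
by have := Es i; rewrite /YX Yeigen_const.
Qed.

End KoornwinderPolynomials.

Section KZSolutions.
Variables (F : closedFieldType) (n : nat) (q12 k0 k kn u0 un psi0 psin : F).
Hypothesis uncountable : forall f : nat -> F, exists x : F, forall i, f i != x.
Hypothesis n_ge2 : (2 <= n)%N.
Hypothesis q12_neq0 : q12 != 0.
Hypotheses (k0_neq0 : k0 != 0) (k_neq0 : k != 0) (kn_neq0 : kn != 0).
Hypotheses (u0_neq0 : u0 != 0) (un_neq0 : un != 0).
Hypotheses (psi0_neq0 : psi0 != 0) (psin_neq0 : psin != 0).
Variables (V : lmodType F) (pi : 'I_n.+1 -> {linear V -> V}) (v0 : V).
Variables (red : seq nat -> seq nat) (ws : seq (seq nat)) (w0 w0J : seq nat).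
Hypothesis W : W0data n red ws w0 w0J.
Hypothesis M : is_MJ k0 k kn pi psi0 psin ws v0.
Hypothesis generic : forall a b c d : int,
  (q q12) ^ a * k0 ^ b * kn ^ c * k ^ d = 1 -> a = 0 /\ d = 0.
Local Notation gpt := (gpt n q12).
Local Notation X := (gpt -> F^o).
Local Notation kap := (kap n k0 k kn).
Local Notation TX := (@TX F n q12 k0 k kn u0 un n_ge2 q12_neq0).
Local Notation affX := (@affX F n q12 k0 k kn u0 un n_ge2 q12_neq0).
Local Notation laurent := (@laurent F n).
Local Notation KZsol := (KZsol q12 k0 k kn u0 un pi).
Local Notation psi := (psi0 * psin).
Local Notation wsign := (wsign n).
Local Notation co := (co n_ge2 W M).
Local Notation vb := (vb pi v0).
Local Notation c j := (kap j - (kap j)^-1).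
Local Notation TXs := (TXZ k0 k kn u0 un n_ge2 q12_neq0).
Local Notation TXbr := (TX_braid n_ge2 q12_neq0 k0_neq0 k_neq0 kn_neq0 u0_neq0 un_neq0).

Local Notation fX := (fX n_ge2 W M (q12 := q12)).
Local Notation levX := (@levX F n q12).
Local Notation isK := (isKoornwinder q12 k0 k kn u0 un).
Local Notation KZcand := (KZcand q12 k0 k kn u0 un pi red ws w0 w0J v0).
Local Notation minus := (fun _ : nat => true).

Lemma spinvecZ a (x : X) d : spinvec n TX (a *: x) d = a *: spinvec n TX x d.
Proof.
suff H m : spinpart n TX (a *: x) m d = a *: spinpart n TX x m d by apply: H.
by elim: m => //= j ->; case: (d j) => //; rewrite (tailopZ n TXs).
Qed.

Lemma laurentV_aeq f g : laurentV n f -> laurentV n g ->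
  aeq n f g <-> forall d, fX f d = fX g d.
Proof.
move=> fl gl; have dl := colaurentB (laurentV_co n_ge2 W M fl) (laurentV_co n_ge2 W M gl).
split=> [/aeq_elim [h [hn H]] d | H].
  apply: funext => p; rewrite /fX; apply/eqP; rewrite -subr_eq0 -coB.
  rewrite (colaurent_vanish uncountable q12_neq0 hn dl _ (pt_torus p)) ?co0 // => r hr.
  by rewrite H ?subrr //; apply: pt_torus.
apply: aeq_eq => t tt; apply/eqP; rewrite -subr_eq0; apply/eqP.
apply: (colaurent_vanish uncountable q12_neq0 (@lnonzero1 F n) dl _ tt) => p _.
apply: (co_inj (n_ge2:=n_ge2) (W:=W) (M:=M)) => d; rewrite coB co0.
by have := congr1 (fun u : X => u p) (H d); rewrite /fX => ->; rewrite subrr.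
Qed.

(** Each coefficient of the candidate is replaced by the Laurent polynomial that it agrees with; by
    [red_raise] the components of the result are the spin vectors generated by P. *)
Lemma cand_laurent P : laurent P -> exists L, [/\ laurentV n L, aeq n (KZcand P) L &
  forall d, fX L d = spinvec n TX (fun r => P (pt r)) (fun i => ~~ d i)].
Proof.
move=> lP.
have word s : exists L, s \in ws -> [/\ laurent L,
    aeq n (apply_word (varpiop n q12 k0 k kn u0 un) (plain (red (s ++ w0J ++ rev w0))) P) L &
    forall p, L (pt p) = spinvec n TX (fun r => P (pt r)) (fun i => ~~ wsign s plus i) p].
  have [sw|sw] := boolP (s \in ws); last by exists (fun _ => 0).
  have [rr rs] := red_raise n_ge2 W sw; set r := red _ in rr rs *.
  have rn : all (fun a : nat * bool => a.1 <= n)%N (plain r).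
    by rewrite all_map; apply: sub_all (allraise_legal n_ge2 rr) => j /andP[].
  have [L [lL aL LE]] := varpi_word_laurent uncountable n_ge2 q12_neq0 k0_neq0 k_neq0 kn_neq0 u0_neq0 un_neq0 rn lP.
  exists L => _; split=> // p; rewrite LE apply_plain.
  rewrite -[X in foldr _ X _](@spinvec_plus _ n _ TX _ plus) //.
  by rewrite (spinvec_word _ n_ge2 TXbr TXs rr); congr (_ p); apply: (spinpart_ext TX n_ge2).
have [Lf LP] := choice word.
pose L t := \sum_(s <- ws) Lf s t *: vb (wsign s plus).
have Lco t s : s \in ws -> co (L t) (wsign s plus) = Lf s t.
  by move=> sw; apply: (co_val n_ge2 W M (f := fun s => Lf s t) sw).
have Ld d : exists2 s, s \in ws & forall t, co (L t) d = Lf s t.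
  have [s sw sd] := ws_sign_surj n_ge2 W d; exists s => // t.
  by rewrite -Lco //; apply: co_ext => i i_n; rewrite sd.
exists L; split.
- apply: (co_laurentV (n_ge2:=n_ge2) (W:=W) (M:=M)) => d; have [s sw E] := Ld d.
  by have [lL _ _] := LP s sw; apply: laurent_ext lL => t _.
- have H (r : seq (seq nat)) : {subset r <= ws} -> aeq n
      (fun t => \sum_(s <- r) apply_word (varpiop n q12 k0 k kn u0 un) (plain (red (s ++ w0J ++ rev w0))) P t *: Tw k0 k kn pi s v0)
      (fun t => \sum_(s <- r) Lf s t *: vb (wsign s plus)).
    elim: r => [_|s r IH sub]; first by apply: aeq_eq => t _; rewrite !big_nil.
    have sw : s \in ws by apply: sub; rewrite inE eqxx.
    have [_ /aeq_elim [h [hn H]] _] := LP s sw.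
    have [|h' [hn' H']] := aeq_elim (IH _); first by move=> x xr; apply: sub; rewrite inE xr orbT.
    apply: (aeq_intro (lnonzeroM uncountable q12_neq0 hn hn')) => t tt.
    rewrite mulf_eq0 negb_or => /andP[h1 h2].
    by rewrite !big_cons H // (Tw_vb n_ge2 W M sw) H'.
  exact: H.
move=> d; apply: funext => p; have [s sw E] := Ld d.
have [s' sw' sd] := ws_sign_surj n_ge2 W d.
have [_ _ LE] := LP s' sw'; rewrite /fX -(co_ext n_ge2 W M (L (pt p)) sd) Lco // LE.
by congr (_ p); apply: (spinpart_ext TX n_ge2) => i i_n; rewrite sd.
Qed.

Lemma fX_minus f : laurentV n f -> exists s : lpoly F n, fX f minus = levX s.
Proof.
by move=> /(laurentV_co n_ge2 W M) /(_ minus) [s sP]; exists s; apply: funext => p; apply: sP; apply: pt_torus.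
Qed.

Lemma fX0 d : fX (fun _ => 0) d = 0.
Proof. by apply: funext => p; apply: co0. Qed.

Lemma laurentV0 : laurentV n (fun _ => 0 : V).
Proof. by exists [::] => t _; rewrite big_nil. Qed.

(** Every component is a word applied to the all-minus one, so f vanishes with it. *)
Lemma KZ_nonzero f : laurentV n f -> KZsol f -> ~ aeq n f (fun _ => 0) -> fX f minus != 0.
Proof.
move=> fl /(KZ_spin uncountable n_ge2 q12_neq0 k0_neq0 k_neq0 kn_neq0 u0_neq0 un_neq0 psi0_neq0 psin_neq0 W M fl) [_ _ H] nz.
apply/eqP => E; apply: nz; apply/(laurentV_aeq fl laurentV0) => d; rewrite fX0 H E.
by rewrite -(scale0r (0 : X)) spinvecZ !scale0r.
Qed.

Local Notation KZ_spin_ := (KZ_spin uncountable n_ge2 q12_neq0 k0_neq0 k_neq0 kn_neq0 u0_neq0 un_neq0 psi0_neq0 psin_neq0 W M).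

Lemma weight_cond m :
  psi * q q12 ^ m = (k0 * kn * k ^+ n.-1) ^ eta_sgn m <->
  psi = q q12 ^ (- m) * (k0 * kn * k ^+ n.-1) ^ eta_sgn m.
Proof.
have qm : q q12 ^ m != 0 by rewrite expfz_neq0 ?expf_neq0.
by split=> [<-|->]; rewrite -invr_expz; [rewrite mulrCA mulVf ?mulr1 | rewrite mulrAC mulVf ?mul1r].
Qed.

Lemma KZ_weight f : laurentV n f -> KZsol f -> ~ aeq n f (fun _ => 0) ->
  exists m : int, psi * q q12 ^ m = (k0 * kn * k ^+ n.-1) ^ eta_sgn m.
Proof.
move=> fl fs nz; have g0 := KZ_nonzero fl fs nz; have [Ps Pa _] := (KZ_spin_ fl).1 fs.
have [s gE] := fX_minus fl; rewrite gE in g0 Ps Pa.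
have [m E] := sym_aff_weight uncountable k0_neq0 k_neq0 kn_neq0 u0_neq0 un_neq0 generic g0 Ps Pa.
by exists m; apply/weight_cond.
Qed.

Lemma KZ_multiple m P f : psi * q q12 ^ m = (k0 * kn * k ^+ n.-1) ^ eta_sgn m ->
  isK (constvec n m) P -> laurentV n f ->
  (KZsol f /\ ~ aeq n f (fun _ => 0)) <->
  exists a : F, a != 0 /\ aeq n f (fun t => a *: KZcand P t).
Proof.
move=> /weight_cond psiE KP fl; have [lP _] := KP.
have [sP [P1 PE EP]] := Koornwinder_eigenvector uncountable n_ge2 q12_neq0 k0_neq0 k_neq0 kn_neq0 u0_neq0 un_neq0 KP.
have [L [Ll aL LE]] := cand_laurent lP; rewrite (levX_of q12 PE) in LE.
have sym := eigenvector_sym uncountable k0_neq0 k_neq0 kn_neq0 u0_neq0 un_neq0 generic EP.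
have aff := eigenvector_aff uncountable k0_neq0 k_neq0 kn_neq0 u0_neq0 un_neq0 generic EP.
rewrite -psiE in aff.
have P0 : levX sP != 0.
  apply/eqP => E; have := oner_neq0 F; rewrite -P1 -(@levX_lcoef _ _ q12 uncountable q12_neq0 [::] sP).
    by rewrite /lcoef big_nil eqxx.
  by rewrite E levX_nil.
have aLl a : laurentV n (fun t => a *: L t).
  by move: Ll => [l H]; exists [seq (p.1, a *: p.2) | p <- l] => t tt; rewrite H // big_map scaler_sumr;
    apply: eq_bigr => p _ /=; rewrite !scalerA mulrC.
have aLE a d : fX (fun t => a *: L t) d = a *: spinvec n TX (levX sP) (fun i => ~~ d i).
  by rewrite -LE; apply: funext => p; rewrite /fX coZ.
have aLa a : aeq n (fun t => a *: KZcand P t) (fun t => a *: L t).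
  by have [h [hn H]] := aeq_elim aL; apply: (aeq_intro hn) => t tt ht; rewrite H.
split=> [[fs nz] | [a [a0 fa]]].
  have g0 := KZ_nonzero fl fs nz; have [gs ga gE] := (KZ_spin_ fl).1 fs.
  have [s sE] := fX_minus fl; rewrite sE in g0 gs ga gE.
  (* For this value of psi, [sym_YX] gives exactly the eigenvalues of (m, ..., m), so uniqueness of
     the joint eigenvector applies. *)
  have Es (i : 'I_n) : YX k0 k kn u0 un n_ge2 q12_neq0 i.+1 (levX s) = wdiag q12 k0 k kn (Yword n (@nat_of_ord n i).+1) (constvec n m) *: levX s.
    by rewrite (sym_YX k0_neq0 k_neq0 kn_neq0 u0_neq0 un_neq0 i gs ga) eigY_const // -psiE.
  have := eigenvector_unique uncountable k0_neq0 k_neq0 kn_neq0 u0_neq0 un_neq0 generic P1 EP Es.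
  set a := lcoef s _ => E; exists a; split.
    by apply: contra g0 => /eqP a0; rewrite E a0 scale0r.
  apply: (aeq_trans uncountable q12_neq0) (aeq_sym (aLa a)).
  by apply/(laurentV_aeq fl (aLl a)) => d; rewrite gE E spinvecZ aLE.
have {}fa := aeq_trans uncountable q12_neq0 fa (aLa a).
have fE d : fX f d = a *: spinvec n TX (levX sP) (fun i => ~~ d i).
  by rewrite ((laurentV_aeq fl (aLl a)).1 fa) aLE.
have fm : fX f minus = a *: levX sP by rewrite fE spinvec_plus.
split.
  apply/(KZ_spin_ fl); rewrite fm; split=> [j jn||d].
  - by rewrite TXs sym // !scalerA mulrC.
  - by rewrite /affX (tailopZ n TXs) TXs aff !scalerA mulrC.
  - by rewrite fE spinvecZ.
move=> /(laurentV_aeq fl laurentV0) /(_ minus); rewrite fX0 fm => /eqP.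
by rewrite scaler_eq0 (negbTE a0) (negbTE P0).
Qed.

Lemma KZ_exists m : psi * q q12 ^ m = (k0 * kn * k ^+ n.-1) ^ eta_sgn m ->
  exists f, [/\ laurentV n f, KZsol f & ~ aeq n f (fun _ => 0)].
Proof.
move=> E; have [P KP] := Koornwinder_exists uncountable n_ge2 q12_neq0 k0_neq0 k_neq0 kn_neq0 u0_neq0 un_neq0 generic m.
have [lP _] := KP; have [L [Ll aL _]] := cand_laurent lP.
exists L; suff [] : KZsol L /\ ~ aeq n L (fun _ => 0) by split.
apply/(KZ_multiple E KP Ll); exists 1; split; first exact: oner_neq0.
apply: (aeq_trans uncountable q12_neq0 (aeq_sym aL)); apply: aeq_eq => t _; by rewrite scale1r.
Qed.

End KZSolutions.

Theorem mainTheorem17 (F : closedFieldType) (n : nat) :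
  [pchar F] =i pred0 ->
  (forall f : nat -> F, exists x : F, forall i, f i != x) ->
  (2 <= n)%N ->
  exists S : nat -> mpoly F 6, (forall i, S i != 0) /\
  forall q12 k0 k kn u0 un : F,
    q12 != 0 -> k0 != 0 -> k != 0 -> kn != 0 -> u0 != 0 -> un != 0 ->
    (forall i, meval (S i) (params6 q12 k0 k kn u0 un) != 0) ->
  forall psi0 psin : F, psi0 != 0 -> psin != 0 ->
  forall (V : lmodType F) (pi : 'I_n.+1 -> {linear V -> V}) (v0 : V)
         (red : seq nat -> seq nat) (ws : seq (seq nat)) (w0 w0J : seq nat),
    W0data n red ws w0 w0J ->
    is_MJ k0 k kn pi psi0 psin ws v0 ->
    ((exists f : (nat -> F) -> V,
        laurentV n f /\ KZsol q12 k0 k kn u0 un pi f /\ ~ aeq n f (fun _ => 0))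
     <-> exists m : int,
        psi0 * psin * q q12 ^ m = (k0 * kn * k ^+ n.-1) ^ eta_sgn m) /\
    (forall m : int,
      psi0 * psin * q q12 ^ m = (k0 * kn * k ^+ n.-1) ^ eta_sgn m ->
      (exists P, isKoornwinder q12 k0 k kn u0 un (constvec n m) P) /\
      forall P, isKoornwinder q12 k0 k kn u0 un (constvec n m) P ->
      forall f : (nat -> F) -> V, laurentV n f ->
        ((KZsol q12 k0 k kn u0 un pi f /\ ~ aeq n f (fun _ => 0))
         <-> exists c : F, c != 0 /\
             aeq n f (fun t => c *: KZcand q12 k0 k kn u0 un pi red ws w0 w0J v0 P t))).
Proof.
move=> char0 uncountable n_ge2; exists (generic_family F); split; first exact: generic_family_neq0.
move=> q12 k0 k kn u0 un q12_neq0 k0_neq0 k_neq0 kn_neq0 u0_neq0 un_neq0 nz.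
have generic := generic_familyP q12_neq0 k0_neq0 k_neq0 kn_neq0 nz.
move=> psi0 psin psi0_neq0 psin_neq0 V pi v0 red ws w0 w0J W M; split.
  split=> [[f [fl [fs fnz]]]|[m E]].
    exact: (KZ_weight uncountable n_ge2 q12_neq0 k0_neq0 k_neq0 kn_neq0 u0_neq0 un_neq0
      psi0_neq0 psin_neq0 W M generic fl fs fnz).
  have [f [fl fs fnz]] := KZ_exists uncountable n_ge2 q12_neq0 k0_neq0 k_neq0 kn_neq0 u0_neq0 un_neq0
    psi0_neq0 psin_neq0 W M generic E.
  by exists f.
move=> m E; split.
  exact: (Koornwinder_exists uncountable n_ge2 q12_neq0 k0_neq0 k_neq0 kn_neq0 u0_neq0 un_neq0 generic m).
move=> P KP f fl; exact: (KZ_multiple uncountable n_ge2 q12_neq0 k0_neq0 k_neq0 kn_neq0 u0_neq0 un_neq0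
  psi0_neq0 psin_neq0 W M generic E KP fl).
Qed.
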